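(* Let $m\in\mathcal P(\mathbb T^d)$ have a density in $H^{q-1}(\mathbb T^d)$ with $\inf_{x\in\mathbb T^d}m(x)\ge\gamma$ for some $\gamma\in(0,1)$, and let $\mathcal F,\mathcal G,H$ satisfy (FG.1)–(FG.4) and (H.5). There is an integer $\widetilde N$, depending only on $d,T,\mathcal F,\mathcal G,H,q,\gamma$ and $\|m\|_{2,q-1}$, such that for every $N\ge\widetilde N$ the following holds. Let $(\mu^N,u^N)$ be the unique solution of $$\begin{cases}\partial_t\mu^N_t=\Delta\mu^N_t+\mathrm{div}\big(\mathrm D_pH(\cdot,\nabla u^N_t)(\mu^N_t*D^N)\big),\quad \mu^N_0=m,\\ \partial_tu^N_t=-\Delta u^N_t+H(\cdot,\nabla u^N_t)*D^N-\delta_\mu\mathcal F(\mu^N_t*D^N,\cdot)*D^N,\\ u^N_T=\delta_\mu\mathcal G(\mu^N_T*D^N,\cdot)*D^N,\end{cases}\qquad t\in[0,T].$$ Then the control $\alpha^{*,N}=-\mathrm D_pH(\cdot,\nabla u^N)$ is the unique minimizer of the approximating mean field control problem $$\inf_\alpha J^N(\alpha,0,m),\qquad J^N(\alpha,0,m)=\mathcal G(\mu^{\alpha}_T*D^N)+\int_0^T\Big\{\mathcal F(\mu^{\alpha}_s*D^N)+\int_{\mathbb T^d}L(x,\alpha_s(x))(\mu^{\alpha}_s*D^N)(dx)\Big\}ds,$$ where the infimum is over admissible feedback controls $\alpha$ and $\mu^\alpha$ denotes the solution of $\partial_s\mu^\alpha_s=\Delta\mu^\alpha_s-\mathrm{div}(\alpha_s(\mu^\alpha_s*D^N))$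 on $(0,T]$ with $\mu^\alpha_0=m$.
   Context: Notation. $\mathbb T^d=\mathbb R^d/\mathbb Z^d$, $d\ge1$; $\mathcal P(\mathbb T^d)$ is the set of Borel probability measures on $\mathbb T^d$ with the weak topology; a measure with a Lebesgue density is identified with its density. For $k\in\mathbb Z^d$, $|k|=\max_i|k_i|$, $e_k(x)=e^{\mathrm i2\pi k\cdot x}$, $\widehat\mu(k)=\int e_{-k}\,d\mu$ (for a function $\varphi$, $\widehat\varphi(k)=\int e_{-k}\varphi\,dx$). For an integer $N\ge1$, $(\mu*D^N)(x)=\sum_{|k|\le N}\widehat\mu(k)e_k(x)$ ($D^N$ is the Dirichlet kernel), and likewise for functions; e.g. $H(\cdot,\nabla u)*D^N$ is the truncation of $x\mapsto H(x,\nabla u(x))$. $\|\cdot\|_2$ is the $L^2(\mathbb T^d)$ norm, $\|\varphi\|_{2,r}^2=\sum_{k}(1+|k|^2)^r|\widehat\varphi(k)|^2$ is the norm of $H^r(\mathbb T^d)$, $\|\varphi\|_{\infty,r}=\|\varphi\|_\infty+\sum_{i=1}^r\|\nabla^i\varphi\|_\infty$. Data. $T>0$; $q\in\mathbb N$, $q\ge d+3$; $\mathcal F,\mathcal G:\mathcal P(\mathbb T^d)\to\mathbb R$; Lagrangian $L:\mathbb T^d\times\mathbb R^d\to\mathbb R$ and Hamiltonian $H(x,p)=\sup_{a\in\mathbb R^d}\{-L(x,a)-a\cdot p\}$, with also $L(x,a)=\sup_{p\in\mathbb R^d}\{-a\cdot p-H(x,p)\}$. A continuous $\phi:\mathcal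 P(\mathbb T^d)\to\mathbb R$ is in $\mathrm C^1(\mathcal P(\mathbb T^d))$ if there is a continuous $\delta_\mu\phi:\mathcal P(\mathbb T^d)\times\mathbb T^d\to\mathbb R$ with $\phi(\mu)-\phi(\nu)=\int_0^1\int\delta_\mu\phi(t\mu+(1-t)\nu,x)(\mu-\nu)(dx)dt$ for all $\mu,\nu$, normalized by $\int\delta_\mu\phi(\mu,x)\mu(dx)=0$. (FG.1) $\mathcal F,\mathcal G\in\mathrm C^1(\mathcal P(\mathbb T^d))$. (FG.2) $\delta_\mu\mathcal F(\mu,\cdot),\delta_\mu\mathcal G(\mu,\cdot)\in\mathrm C^q(\mathbb T^d)$, with $\|\cdot\|_{\infty,q}$ norms bounded uniformly in $\mu$. (FG.3) There is $L_{\mathcal F}>0$ with $|\delta_\mu\mathcal F(\mu,x)-\delta_\mu\mathcal F(\mu',x)|\le L_{\mathcal F}\|\mu-\mu'\|_2$ for all $x$ and all $\mu,\mu'\in\mathcal P(\mathbb T^d)\cap L^2(\mathbb T^d)$, and similarly for $\mathcal G$. (FG.4) $\mathcal F,\mathcal G$ are convex: $\mathcal F(\lambda\mu+(1-\lambda)\mu')\le\lambda\mathcal F(\mu)+(1-\lambda)\mathcal F(\mu')$ for $\lambda\in[0,1]$, and similarly for $\mathcal G$. (H.5) $H\in\mathrm C^q(\mathbb T^d\times\mathbb R^d)$ and $C_H^{-1}I_d\le\mathrm D^2_{pp}H(x,p)\le C_HI_d$ for all $(x,p)$ and some $C_H>1$. A solution of the forward-backward system is a pair with $u^N$ a classical solution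 of the backward equation, $\mu^N\in\mathrm C([0,T];L^2(\mathbb T^d))$ a weak solution of the forward equation, and $\mu^N_t*D^N\in\mathcal P(\mathbb T^d)$ for all $t$; for $N\ge\widetilde N$ such a solution exists and is unique. Admissible controls: bounded Borel measurable $\alpha:[0,T]\times\mathbb T^d\to\mathbb R^d$ for which the controlled equation for $\mu^\alpha$, formulated in the weak sense, has a unique solution and $\mu^\alpha_t*D^N\in\mathcal P(\mathbb T^d)$ for all $t\in[0,T]$. Controls that agree almost everywhere on $[0,T]\times\mathbb T^d$ are identified. *)

(* Defs.v *)
From HB Require Import structures.
From mathcomp Require Import all_boot all_order all_algebra.
From mathcomp Require Import all_classical all_reals all_analysis.
From mathcomp Require Import measurable_realfun.
From mathcomp Require Import complex.

Set Implicit Arguments.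
Unset Strict Implicit.
Unset Printing Implicit Defensive.

Import Order.TTheory GRing.Theory Num.Theory.
Import numFieldNormedType.Exports.

Local Open Scope classical_set_scope.
Local Open Scope ring_scope.

(* The torus T^d = R^d / Z^d is handled through R^d = 'rV[R]_d: functions on
   T^d are Z^d-periodic functions on R^d, and Borel measures on T^d are Borel
   measures on R^d carried by the fundamental cell [0, 1)^d. *)

(* Borel sigma-algebra on matrices. *)
HB.instance Definition _ (R : realType) (m n : nat) :=
  @isMeasurable.Build (sigma_display (@open 'M[R]_(m, n))) 'M[R]_(m, n)
    <<s (@open 'M[R]_(m, n)) >>
    (@sigma_algebra0 _ setT _) (@sigma_algebraC _ _)
    (@sigma_algebra_bigcup _ setT _).

Section lebesgue_torus.
Context {R : realType}.

Definition row_of_tuple d (x : d.-tuple (measurableTypeR R)) : 'rV[R]_d :=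
  \row_i tnth x i.

Lemma measurable_row_of_tuple d : measurable_fun setT (@row_of_tuple d).
Proof.
have mball (c : 'rV[rat]_d) (e : R) :
    measurable (@row_of_tuple d @^-1` ball (map_mx ratr c : 'rV[R]_d) e).
  have [e0|e0] := ltP 0 e; last first.
    rewrite (_ : _ @^-1` _ = set0)//.
    by rewrite -subset0 => x [] /(le_lt_trans e0); rewrite ltxx.
  rewrite (_ : _ @^-1` _ = \bigcap_(i in [set: 'I_d])
      ((fun x : d.-tuple (measurableTypeR R) => tnth x i)
         @^-1` ball (ratr (c 0 i) : R) e)); last first.
    apply/seteqP; split=> x /=.
      by move=> [_ h] i _; have := h 0 i; rewrite !mxE.
    by move=> h; split=> // j i; rewrite (ord1 j) !mxE; exact: h.
  apply: fin_bigcap_measurable => // i _.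
  rewrite -[X in measurable X]setTI; apply: measurable_tnth => //.
  exact: measurable_ball.
apply: (@measurability _ _ _ _ _ _ (@open 'rV[R]_d)) => //.
move=> _ [U oU <-]; rewrite setTI.
pose I := [set p : 'rV[rat]_d * nat |
  ball (map_mx ratr p.1 : 'rV[R]_d) (p.2.+1%:R^-1 : R) `<=` U].
rewrite (_ : _ @^-1` _ = \bigcup_(p in I)
  (@row_of_tuple d @^-1`
    ball (map_mx ratr p.1 : 'rV[R]_d) (p.2.+1%:R^-1 : R))); last first.
  apply/seteqP; split=> x /=; last by move=> [p Ip] /Ip.
  move=> Ux; have /nbhs_ballP[e /= e0 eU] := open_nbhs_nbhs (conj oU Ux).
  have [n ne] : exists n, (n.+1%:R^-1 : R) < e / 2.
    have := @near_infty_natSinv_lt R (PosNum (divr_gt0 e0 (ltr0Sn _ 1))).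
    by case=> n _ /(_ n) /= h; exists n; apply: h => /=.
  have rq i : exists r : rat, `|tnth x i - ratr r| < (n.+1%:R^-1 : R).
    have : tnth x i - n.+1%:R^-1 < tnth x i + n.+1%:R^-1 :> R.
      by rewrite ltrBlDr -addrA ltrDl addr_gt0// invr_gt0.
    move=> /rat_in_itvoo[r]; rewrite in_itv/= => /andP[h1 h2]; exists r.
    by rewrite distrC ltr_distl h1 h2.
  pose c : 'rV[rat]_d := \row_i xget 0 [set r : rat |
    `|tnth x i - ratr r| < (n.+1%:R^-1 : R)].
  have cP i : `|tnth x i - ratr (c 0 i)| < (n.+1%:R^-1 : R).
    by rewrite mxE; case: xgetP => [r _ //|h]; have [r /h] := rq i.
  exists (c, n) => /=.
    move=> y [_ hy]; apply: eU; split=> // i j.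
    rewrite (ord1 i).
    rewrite (splitr e).
    apply: (@ball_triangle _ _ (ratr (c 0 j) : R)).
      by rewrite mxE /ball/=; apply: (lt_trans (cP j)).
    by have := hy 0 j; rewrite mxE; apply: le_ball; exact: ltW.
  split; first by rewrite invr_gt0.
  move=> i j; rewrite (ord1 i).
  by rewrite !mxE /ball/= distrC; have := cP j; rewrite mxE.
rewrite bigcup_mkcond; apply: countable_bigcupT_measurable.
  exact: countableP.
by move=> p; case: ifP.
Qed.

HB.instance Definition _ d :=
  isMeasurableFun.Build _ _ _ _ (@row_of_tuple d) (@measurable_row_of_tuple d).

Definition tcons d (z : measurableTypeR R * d.-tuple (measurableTypeR R)) :
  d.+1.-tuple (measurableTypeR R) := [tuple of z.1 :: z.2].

Lemma measurable_tcons d : measurable_fun setT (@tcons d).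
Proof. exact: measurable_cons. Qed.

HB.instance Definition _ d :=
  isMeasurableFun.Build _ _ _ _ (@tcons d) (@measurable_tcons d).

Fixpoint unif_cube d : probability (d.-tuple (measurableTypeR R)) R :=
  match d with
  | 0%N => \d_([tuple] : 0.-tuple (measurableTypeR R))
  | d'.+1 => distribution (uniform_prob (@ltr01 R) \x unif_cube d')%E
               (@tcons d')
  end.

(* Lebesgue (Haar) probability measure of T^d: the d-fold product of the
   uniform measure on [0, 1]. *)
Definition lebT d : probability 'rV[R]_d R :=
  distribution (unif_cube d) (@row_of_tuple d).

End lebesgue_torus.
Arguments lebT {R} d.

Section torus.
Context {R : realType} {d : nat}.
Local Notation V := 'rV[R]_d.
Local Notation C := (complex.complex R).

Definition dot (x y : V) : R := \sum_(i < d) x 0 i * y 0 i.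

Definition zvec (k : 'rV[int]_d) : V := map_mx (fun z : int => z%:~R) k.

Definition Zperiodic {S : Type} (f : V -> S) : Prop :=
  forall (x : V) (k : 'rV[int]_d), f (x + zvec k) = f x.

Definition cell : set V := [set x : V | forall i, 0 <= x 0 i < 1].

Record PT := MkPT {
  PT_prob :> probability V R ;
  PT_cell : PT_prob cell = 1%E }.

Lemma dirac0_cell : (\d_(0 : V) : probability V R) cell = 1%E.
Proof.
rewrite /= diracE mem_set// => i.
by rewrite mxE lexx ltr01.
Qed.

Definition PT0 : PT := MkPT dirac0_cell.

HB.instance Definition _ := gen_eqMixin PT.
HB.instance Definition _ := gen_choiceMixin PT.

(* The weak topology is the coarsest one making mu |-> \int f dmu continuous
   for every continuous f on T^d. *)
Definition test_fun := {f : V -> R | continuous f /\ Zperiodic f}.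

Definition PT_eval (mu : PT) : {ptws test_fun -> R} :=
  fun f => \int[mu]_x sval f x.

HB.instance Definition _ := Topological.copy PT (initial_topology PT_eval).

(* Measures are extensional, so at most one mu qualifies in the two choices
   below; they are only used when one does. *)
Definition mix (t : R) (mu nu : PT) : PT :=
  xget PT0 [set rho : PT | forall A, measurable A ->
    rho A = (t%:E * mu A + (1 - t)%:E * nu A)%E].

Definition has_density (mu : PT) (f : V -> R) : Prop :=
  [/\ measurable_fun setT f, Zperiodic f, {ae lebT d, forall x, 0 <= f x} &
      forall A, measurable A -> mu A = (\int[lebT d]_(x in A) (f x)%:E)%E].

Definition is_density (f : V -> R) : Prop := exists mu, has_density mu f.

Definition dens (f : V -> R) : PT := xget PT0 [set mu : PT | has_density mu f].

Definition L2norm (f : V -> R) : \bar R := ('N[lebT d]_2%:E[EFin \o f])%E.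

Definition in_L2 (f : V -> R) : Prop :=
  [/\ measurable_fun setT f, Zperiodic f & (L2norm f < +oo)%E].

Definition kabs (k : 'rV[int]_d) : nat := (\max_(i < d) `|k 0%R i|)%N.

Definition echar (k : 'rV[int]_d) (x : V) : C :=
  complex.Complex (cos (2 * pi * dot (zvec k) x))
                  (sin (2 * pi * dot (zvec k) x)).

Definition cintegral (g : V -> C) : C :=
  complex.Complex (\int[lebT d]_x complex.Re (g x))
                  (\int[lebT d]_x complex.Im (g x)).

Definition fourier (f : V -> R) (k : 'rV[int]_d) : C :=
  cintegral (fun x => echar (- k) x * complex.Complex (f x) 0).

(* f * D^N; the sum is real since f is, as the terms for k and -k are
   conjugate. *)
Definition trunc (N : nat) (f : V -> R) (x : V) : R :=
  complex.Re (\sum_(k \in [set k : 'rV[int]_d | (kabs k <= N)%N])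
    fourier f k * echar k x).

Definition sobnorm (r : nat) (f : V -> R) : \bar R :=
  ((\esum_(k in [set: 'rV[int]_d])
     ((1 + (kabs k)%:R ^+ 2) ^+ r *
      (complex.Re (fourier f k) ^+ 2 + complex.Im (fourier f k) ^+ 2))%:E)
   `^ (2^-1))%E.

Definition pderiv (i : 'I_d) (f : V -> R) : V -> R :=
  fun x => 'D_(delta_mx 0 i) f x.

Definition grad (f : V -> R) (x : V) : V := \row_i pderiv i f x.

Definition hess (f : V -> R) (x : V) : 'M[R]_d :=
  \matrix_(i, j) pderiv i (pderiv j f) x.

Definition lap (f : V -> R) (x : V) : R := \tr (hess f x).

(* Euclidean norm of the tensor of all i-th order partial derivatives. *)
Definition nabla_norm (i : nat) (f : V -> R) (x : V) : R :=
  Num.sqrt (\sum_(s : i.-tuple 'I_d) (foldr pderiv f s x) ^+ 2).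

Definition supnorm (r : nat) (f : V -> R) : \bar R :=
  (ereal_sup [set `|f x|%:E | x in [set: V]] +
   \sum_(1 <= i < r.+1) ereal_sup [set (nabla_norm i f x)%:E | x in [set: V]])%E.

(* phi and dphi are continuous, dphi is the normalized linear derivative. *)
Definition C1_with_deriv (phi : PT -> R) (dphi : PT -> V -> R) : Prop :=
  [/\ continuous phi,
      continuous (fun z : PT * V => dphi z.1 z.2),
      (forall mu : PT, Zperiodic (dphi mu)),
      (forall mu nu : PT, phi mu - phi nu =
         \int[lebesgue_measure]_(t in `[0, 1])
           ((\int[mu]_x dphi (mix t mu nu) x) -
            (\int[nu]_x dphi (mix t mu nu) x))) &
      (forall mu : PT, \int[mu]_x dphi mu x = 0)].

End torus.
Arguments PT R d : clear implicits.

(* C^n in terms of iterated directional derivatives, which for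
   finite-dimensional W is the usual notion. *)
Fixpoint Cn {R : realType} {W : normedModType R} (n : nat) (f : W -> R) : Prop :=
  match n with
  | 0%N => continuous f
  | n'.+1 => continuous f /\
      forall v : W, (forall x, derivable f x v) /\ Cn n' (fun x => 'D_v f x)
  end.

Section assumptions.
Context {R : realType} {d : nat}.
Local Notation V := 'rV[R]_d.

Definition derivative_Cq (q : nat) (dphi : PT R d -> V -> R) : Prop :=
  (forall mu, Cn q (dphi mu)) /\
  exists K : R, forall mu, (supnorm q (dphi mu) <= K%:E)%E.

Definition derivative_L2_lipschitz (dphi : PT R d -> V -> R) : Prop :=
  exists K : R, 0 < K /\
    forall (mu mu' : PT R d) (f f' : V -> R),
      has_density mu f -> in_L2 f -> has_density mu' f' -> in_L2 f' ->
      forall x, (`|dphi mu x - dphi mu' x|%:E <=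
                 K%:E * L2norm (f \- f')%R)%E.

Definition convexPT (phi : PT R d -> R) : Prop :=
  forall (t : R) (mu mu' : PT R d), 0 <= t <= 1 ->
    phi (mix t mu mu') <= t * phi mu + (1 - t) * phi mu'.

Definition fenchel_pair (L H : V -> V -> R) : Prop :=
  (forall x p, (H x p)%:E = ereal_sup [set (- L x a - dot a p)%:E | a in [set: V]])
  /\
  (forall x a, (L x a)%:E = ereal_sup [set (- dot a p - H x p)%:E | p in [set: V]]).

Definition smooth_unif_convex (q : nat) (H : V -> V -> R) : Prop :=
  Cn q (fun z : V * V => H z.1 z.2) /\
  exists CH : R, 1 < CH /\
    forall x p xi : V,
      CH^-1 * dot xi xi <= dot (xi *m hess (H x) p) xi <= CH * dot xi xi.

End assumptions.

Section system.
Context {R : realType} {d : nat}.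
Local Notation V := 'rV[R]_d.
Variables (T : R) (N : nat).

Definition in_CL2 (mu : R -> V -> R) : Prop :=
  (forall t, 0 <= t <= T -> in_L2 (mu t)) /\
  (forall t, 0 <= t <= T ->
     (fun s => L2norm (fun x => mu s x - mu t x))
       @ within `[0, T] (nbhs t) --> 0%E).

(* Weak solution in C([0,T]; L^2) of
   d_t mu = Delta mu - div (b_t (mu_t * D^N)), mu_0 = m. *)
Definition weak_solution (m : V -> R) (b : R -> V -> V) (mu : R -> V -> R) :
    Prop :=
  [/\ in_CL2 mu,
      {ae lebT d, forall x, mu 0 x = m x} &
      forall phi : V -> R, Zperiodic phi -> (forall n, Cn n phi) ->
      forall t, 0 <= t <= T ->
        \int[lebT d]_x (phi x * mu t x) =
        \int[lebT d]_x (phi x * m x) +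
        \int[lebesgue_measure]_(s in `[0, t])
          ((\int[lebT d]_x (lap phi x * mu s x)) +
           (\int[lebT d]_x (dot (grad phi x) (b s x) * trunc N (mu s) x)))].

Definition feedback (H : V -> V -> R) (u : R -> V -> R) : R -> V -> V :=
  fun t x => - grad (H x) (grad (u t) x).

Definition continuous_slab (f : R -> V -> R) : Prop :=
  {within (`[0, T] `*` [set: V]), continuous (fun z : R * V => f z.1 z.2)}.

(* The time derivative ut is taken relative to [0,T], hence one-sided at the
   end points. *)
Definition classical_backward (H : V -> V -> R) (dF dG : PT R d -> V -> R)
    (mu u : R -> V -> R) : Prop :=
  [/\ forall t, 0 <= t <= T -> Zperiodic (u t) /\ Cn 2 (u t),
      [/\ continuous_slab u,
          forall i, continuous_slab (fun t => pderiv i (u t)) &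
          forall i j, continuous_slab (fun t => pderiv i (pderiv j (u t)))],
      exists ut : R -> V -> R,
        [/\ continuous_slab ut,
            forall t x, 0 <= t <= T ->
              (fun s => (u s x - u t x) / (s - t))
                @ within `[0, T] t^' --> ut t x &
            forall t x, 0 <= t <= T ->
              ut t x = - lap (u t) x
                + trunc N (fun y => H y (grad (u t) y)) x
                - trunc N (dF (dens (trunc N (mu t)))) x] &
      forall x, u T x = trunc N (dG (dens (trunc N (mu T)))) x].

Definition fb_solution (H : V -> V -> R) (dF dG : PT R d -> V -> R)
    (m : V -> R) (mu u : R -> V -> R) : Prop :=
  [/\ classical_backward H dF dG mu u,
      weak_solution m (feedback H u) mu &
      forall t, 0 <= t <= T -> is_density (trunc N (mu t))].

Definition fb_unique_solution (H : V -> V -> R) (dF dG : PT R d -> V -> R)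
    (m : V -> R) (mu u : R -> V -> R) : Prop :=
  fb_solution H dF dG m mu u /\
  forall mu' u', fb_solution H dF dG m mu' u' ->
    forall t, 0 <= t <= T ->
      {ae lebT d, forall x, mu' t x = mu t x} /\ (forall x, u' t x = u t x).

Definition initial_class (q : nat) (gamma M : R) (m : V -> R) : Prop :=
  [/\ is_density m, sobnorm q.-1 m = M%:E & forall x, gamma <= m x].

Definition admissible (m : V -> R) (alpha : R -> V -> V) : Prop :=
  [/\ measurable_fun (`[0, T] `*` [set: V] : set (measurableTypeR R * V))
        (fun z => alpha z.1 z.2),
      forall t, 0 <= t <= T -> Zperiodic (alpha t),
      exists K : R, forall t x, 0 <= t <= T -> `|alpha t x| <= K &
      exists mu, [/\ weak_solution m alpha mu,
        forall mu', weak_solution m alpha mu' ->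
          forall t, 0 <= t <= T -> {ae lebT d, forall x, mu' t x = mu t x} &
        forall t, 0 <= t <= T -> is_density (trunc N (mu t))]].

(* mu^alpha; determined up to null sets when alpha is admissible. *)
Definition controlled (m : V -> R) (alpha : R -> V -> V) : R -> V -> R :=
  xget (fun _ => m) [set mu | weak_solution m alpha mu].

Definition cost (F G : PT R d -> R) (L : V -> V -> R) (m : V -> R)
    (alpha : R -> V -> V) : R :=
  let nu t := dens (trunc N (controlled m alpha t)) in
  G (nu T) +
  \int[lebesgue_measure]_(s in `[0, T])
    (F (nu s) + \int[nu s]_x L x (alpha s x)).

Definition unique_minimizer (F G : PT R d -> R) (L : V -> V -> R) (m : V -> R)
    (alpha : R -> V -> V) : Prop :=
  [/\ admissible m alpha,
      forall beta, admissible m beta -> cost F G L m alpha <= cost F G L m beta &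
      forall beta, admissible m beta -> cost F G L m beta = cost F G L m alpha ->
        {ae (lebesgue_measure \x lebT d)%E,
          forall z, 0 <= z.1 <= T -> beta z.1 z.2 = alpha z.1 z.2}].

End system.

Definition well_posed_from {R : realType} {d : nat} (T : R) (q : nat)
    (H : 'rV[R]_d -> 'rV[R]_d -> R) (dF dG : PT R d -> 'rV[R]_d -> R)
    (gamma M : R) (N0 : nat) : Prop :=
  forall (N : nat) (m : 'rV[R]_d -> R),
    (0 < N)%N -> (N0 <= N)%N -> initial_class q gamma M m ->
    exists mu u, fb_unique_solution T N H dF dG m mu u.

(* Main.v *)
(* This is a verification argument, valid for every N. The function u^N is a
   trigonometric polynomial: by the backward equation, its modes with |k| > N
   solve a' = lambda a with a(T) = 0. Let beta be an admissible control, rho and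
   sigma the truncated flows driven by beta and by the feedback, and p = grad u^N.
   Since truncation is self-adjoint and u^N lies in its range, testing the
   difference of the two forward equations against u^N gives
     int dG(sigma_T)(rho_T - sigma_T) = int_0^T [ int H(x,p)(rho - sigma)
       - int dF(sigma)(rho - sigma) + int p.(beta rho - alpha sigma) ] dt,
   so that convexity of F and G yields
     J(beta) - J(alpha) >= int_0^T int (L(x,beta) + beta.p + H(x,p)) rho dx dt.
   The integrand is nonnegative by the Fenchel inequality, which is an equality
   only if beta = -D_p H(x,p). A nonzero trigonometric polynomial vanishes on a
   null set only, so rho > 0 almost everywhere; hence equality of the costs
   forces beta = alpha almost everywhere. *)

From HB Require Import structures.
Require Import Defs.
From mathcomp Require Import all_boot all_order all_algebra.
From mathcomp Require Import all_classical all_reals all_analysis.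
From mathcomp Require Import measurable_realfun complex ring lra zify.
From mathcomp Require finmap.

Set Implicit Arguments.
Unset Strict Implicit.
Unset Printing Implicit Defensive.

Import Order.TTheory GRing.Theory Num.Theory.
Import numFieldNormedType.Exports.

Local Open Scope classical_set_scope.
Local Open Scope ring_scope.

(** The weak formulation admits only test functions independent of time, and a competing control is
    merely measurable, so u^N cannot be inserted in the forward equations directly. Both equations
    are therefore projected onto real Fourier modes. Each coefficient of a flow is the primitive of
    a bounded measurable rate, each coefficient of u^N is differentiable in time, and the two are
    paired by an integration by parts that rests on Fubini alone; the finitely many resulting
    identities are then summed. Admissibility of the feedback includes uniqueness for its forward
    equation. There the drift sees the solution only through its truncation, so finitely many
    coefficients satisfy a closed Gronwall inequality, and injectivity of the Fourier transform
    recovers the whole solution. The Lagrangian is accessible only as a supremum: its measurability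
    comes from lower semicontinuity, its bounds from strong convexity of H. The tangent inequality
    for F and G is derived along mixtures of densities, where (FG.3) makes the linear derivative
    Lipschitz in the mixing parameter. *)

Section bounded_integrals.
Context d (T : measurableType d) (R : realType).

Lemma integrable_bdd (mu : {finite_measure set T -> \bar R}) (f : T -> R)
    (D : set T) (K : R) : measurable D ->
  measurable_fun D f -> (forall x, D x -> `|f x| <= K) ->
  mu.-integrable D (EFin \o f).
Proof.
move=> mD mf fK; apply: measurable_bounded_integrable => //.
  by rewrite -ge0_fin_numE ?fin_num_measure.
exists K; split; first exact: num_real.
by move=> y Ky x Dx; exact: le_trans (fK x Dx) (ltW Ky).
Qed.

Variable mu : {measure set T -> \bar R}.

Lemma integrable_mul_bdd (h g : T -> R) (D : set T) (K : R) : measurable D ->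
  mu.-integrable D (EFin \o h) -> measurable_fun D g ->
  (forall x, D x -> `|g x| <= K) ->
  mu.-integrable D (EFin \o (fun x => h x * g x)).
Proof.
move=> mD ih mg gK.
rewrite [X in _.-integrable _ X](_ : _ = (EFin \o h) \* (EFin \o g))%E//.
apply: integrableMl => //.
exists K; split; first exact: num_real.
by move=> y Ky x Dx; exact: le_trans (gK x Dx) (ltW Ky).
Qed.

Lemma integrable_scale (D : set T) (k : R) (f : T -> R) : measurable D ->
  mu.-integrable D (EFin \o f) ->
  mu.-integrable D (EFin \o (fun x => k * f x)).
Proof.
move=> mD fi; rewrite (_ : EFin \o _ = fun x => (k%:E * (EFin \o f) x)%E)//.
exact: integrableZl.
Qed.

Lemma integrable_addR (D : set T) (f g : T -> R) : measurable D ->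
  mu.-integrable D (EFin \o f) -> mu.-integrable D (EFin \o g) ->
  mu.-integrable D (EFin \o (fun x => f x + g x)).
Proof.
move=> mD fi gi.
rewrite (_ : EFin \o _ = (EFin \o f) \+ (EFin \o g))%E; last first.
  by apply/funext => x /=; rewrite EFinD.
exact: integrableD.
Qed.

Lemma integrable_subR (D : set T) (f g : T -> R) : measurable D ->
  mu.-integrable D (EFin \o f) -> mu.-integrable D (EFin \o g) ->
  mu.-integrable D (EFin \o (fun x => f x - g x)).
Proof.
move=> mD fi gi.
rewrite (_ : EFin \o _ = (EFin \o f) \- (EFin \o g))%E; last first.
  by apply/funext => x /=; rewrite EFinB.
exact: integrableB.
Qed.

Lemma Rintegral_dominated (D : set T) (f_ : nat -> T -> R) (f h : T -> R) :
  measurable D -> (forall n, measurable_fun D (f_ n)) -> measurable_fun D f ->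
  {ae mu, forall x, D x -> f_ ^~ x @ \oo --> f x} ->
  mu.-integrable D (EFin \o h) ->
  (forall n x, D x -> `|f_ n x| <= h x) ->
  (fun n => \int[mu]_(x in D) f_ n x) @ \oo --> \int[mu]_(x in D) f x.
Proof.
move=> mD mf_ mf cf ih fh.
have [|||||iF _ cv] := @dominated_convergence _ _ _ mu D mD
  (fun n => EFin \o f_ n) (EFin \o f) (EFin \o h).
- by move=> n; exact/measurable_EFinP.
- exact/measurable_EFinP.
- apply: filterS cf => x cx Dx.
  by apply: cvg_EFin => //; [exact: nearW | exact: cx].
- exact: ih.
- by apply: aeW => x n Dx; rewrite lee_fin; exact: fh.
by apply: fine_cvg; rewrite fineK; [exact: cv|exact: integrable_fin_num].
Qed.

Lemma Rintegral_sum (D : set T) (I : Type) (s : seq I) (f : I -> T -> R) :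
  measurable D -> (forall i, mu.-integrable D (EFin \o f i)) ->
  \int[mu]_(x in D) (\sum_(i <- s) f i x) = \sum_(i <- s) \int[mu]_(x in D) f i x.
Proof.
move=> mD fi; elim: s => [|i s ih].
  by under eq_Rintegral do rewrite big_nil; rewrite big_nil Rintegral_cst// mul0r.
under eq_Rintegral do rewrite big_cons.
rewrite big_cons RintegralD// ?ih//.
rewrite (_ : EFin \o _ = fun x => \sum_(i0 <- s) (f i0 x)%:E)%E; last first.
  by apply/funext => x /=; rewrite sumEFin.
by apply: integrable_sum => // *; exact: fi.
Qed.

Lemma integrable_sumR (D : set T) (I : Type) (s : seq I) (f : I -> T -> R) :
  measurable D -> (forall i, mu.-integrable D (EFin \o f i)) ->
  mu.-integrable D (EFin \o (fun x => \sum_(i <- s) f i x)).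
Proof.
move=> mD fi.
rewrite (_ : EFin \o _ = fun x => \sum_(i0 <- s) (f i0 x)%:E)%E; last first.
  by apply/funext => x /=; rewrite sumEFin.
by apply: integrable_sum => // *; exact: fi.
Qed.

End bounded_integrals.

(** * Uniqueness of Fourier coefficients *)

Section fourier_1d.
Context {R : realType}.
Implicit Types (n : int) (c x : R).

(** The free phase covers sines as well as cosines, so the single product formula [cwM] shows that
    these waves span an algebra. *)
Definition cw n c x : R := cos (2 * pi * (n%:~R * x) + c).

Lemma continuous_cw n c : continuous (cw n c).
Proof.
move=> x; apply: (@continuous_comp _ _ _ (fun x => 2 * pi * (n%:~R * x) + c) cos);
  last exact: continuous_cos.
apply: cvgD; last exact: cvg_cst.
by apply: cvgM; [exact: cvg_cst|apply: cvgM; [exact: cvg_cst|exact: cvg_id]].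
Qed.

Lemma measurable_cw n c : measurable_fun setT (cw n c).
Proof. exact: continuous_measurable_fun (@continuous_cw n c). Qed.

Lemma cw_le1 n c x : `|cw n c x| <= 1. Proof. exact: cos_max. Qed.

Lemma cos_prod (a b : R) : cos a * cos b = (cos (a + b) + cos (a - b)) / 2.
Proof. by rewrite cosD cosB; lra. Qed.

Lemma cwM n m c e x : cw n c x * cw m e x =
  2^-1 * cw (n + m) (c + e) x + 2^-1 * cw (n - m) (c - e) x.
Proof.
rewrite /cw cos_prod mulrDl ![_ / 2]mulrC; congr (_ * cos _ + _ * cos _).
  by rewrite rmorphD/=; lra.
by rewrite rmorphB/=; lra.
Qed.

Variable mu : probability (measurableTypeR R) R.
Variable h : measurableTypeR R -> R.
Hypothesis ih : mu.-integrable setT (EFin \o h).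

(** Orthogonality is required of [h * g] against every wave, and not just of [h] against [g]: this
    makes the class stable under multiplication by waves, hence by every trigonometric
    polynomial. *)
Definition annih (g : R -> R) : Prop :=
  [/\ measurable_fun setT g, exists K : R, forall x, `|g x| <= K &
   forall n c, \int[mu]_x (h x * (g x * cw n c x)) = 0].

Let ihg (g : R -> R) n c : measurable_fun setT g -> (exists K : R, forall x, `|g x| <= K) ->
  mu.-integrable setT (EFin \o (fun x => h x * (g x * cw n c x))).
Proof.
move=> mg [K gK]; apply: (@integrable_mul_bdd _ _ _ _ _ _ _ K) => //.
  by apply: measurable_funM => //; exact: measurable_cw.
move=> x _; rewrite normrM -[K]mulr1 ler_pM//; exact: cw_le1.
Qed.

Lemma annih_lin a b g1 g2 : annih g1 -> annih g2 ->
  annih (fun x => a * g1 x + b * g2 x).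
Proof.
move=> [m1 b1 z1] [m2 b2 z2]; split.
- by apply: measurable_funD; apply: measurable_funM.
- case: b1 b2 => [K1 b1] [K2 b2]; exists (`|a| * K1 + `|b| * K2) => x.
  by rewrite (le_trans (ler_normD _ _))// !normrM lerD// ler_wpM2l.
move=> n c.
transitivity (\int[mu]_x (a * (h x * (g1 x * cw n c x)) +
                          b * (h x * (g2 x * cw n c x)))).
  by apply: eq_Rintegral => x _; ring.
have i1 := ihg n c m1 b1; have i2 := ihg n c m2 b2.
rewrite RintegralD//; [|exact: integrable_scale|exact: integrable_scale].
by rewrite !RintegralZl// z1 z2 !mulr0 addr0.
Qed.

Lemma annih_cw m e g : annih g -> annih (fun x => g x * cw m e x).
Proof.
move=> [mg bg zg]; split.
- by apply: measurable_funM => //; exact: measurable_cw.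
- case: bg => K gK; exists K => x; rewrite normrM -[K]mulr1 ler_pM//; exact: cw_le1.
move=> n c.
transitivity (\int[mu]_x (2^-1 * (h x * (g x * cw (m + n) (e + c) x)) +
                          2^-1 * (h x * (g x * cw (m - n) (e - c) x)))).
  by apply: eq_Rintegral => x _; rewrite -mulrA cwM; ring.
rewrite RintegralD//; [|by apply: integrable_scale => //; exact: ihg..].
by rewrite !RintegralZl ?zg ?mulr0 ?addr0//; exact: ihg.
Qed.

Lemma annih_exp (g t : R -> R) (m : nat) : (forall g', annih g' -> annih (fun x => g' x * t x)) ->
  annih g -> annih (fun x => g x * t x ^+ m).
Proof.
move=> Ht; elim: m => [|m IHm] ag.
  by rewrite (_ : (fun _ => _) = g)//; apply/funext => x; rewrite expr0 mulr1.
rewrite (_ : (fun _ => _) = fun x => (g x * t x ^+ m) * t x); last first.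
  by apply/funext => x; rewrite exprSr mulrA.
by apply: Ht; exact: IHm.
Qed.

Hypothesis h0 : forall n c, \int[mu]_x (h x * cw n c x) = 0.

Lemma annih1 : annih (fun=> 1).
Proof.
split; [exact: measurable_cst| by exists 1 => x; rewrite normr1|].
by move=> n c; under eq_Rintegral do rewrite mul1r; exact: h0.
Qed.

(* Stone's trick: (1 - t^n)^(2^n) tends to the indicator of {t < 1/2}. *)
Lemma annih_stone (t : R -> R) (n : nat) : (forall g', annih g' -> annih (fun x => g' x * t x)) ->
  annih (fun x => (1 - t x ^+ n) ^+ (2 ^ n)).
Proof.
move=> Ht.
have Hs g' : annih g' -> annih (fun x => g' x * (1 - t x ^+ n)).
  move=> ag; rewrite (_ : (fun _ => _) =
    (fun x => 1 * g' x + (-1) * (g' x * t x ^+ n))); last first.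
    by apply/funext => x; rewrite mulrBr mulN1r mul1r mulr1.
  by apply: annih_lin => //; exact: annih_exp.
have := annih_exp (2 ^ n)%N Hs annih1.
by congr annih; apply/funext => x; rewrite mul1r.
Qed.

End fourier_1d.

(** * Bernoulli bounds behind Stone's trick *)

Section stone.
Context {R : realType}.

Lemma bernoulli_ineq (y : R) m : 0 <= y <= 1 -> 1 - m%:R * y <= (1 - y) ^+ m.
Proof.
move=> /andP[y0 y1]; elim: m => [|m IH]; first by rewrite mul0r subr0 expr0.
rewrite exprS.
have : (1 - y) * (1 - m%:R * y) <= (1 - y) * (1 - y) ^+ m.
  by apply: ler_wpM2l => //; rewrite subr_ge0.
apply: le_trans; rewrite -natr1.
have : 0 <= m%:R * y * y by rewrite !mulr_ge0.
by nra.
Qed.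

(** The companion upper bound, free of division; the induction step works because the new factor
    only subtracts a multiple of [y ^+ 2]. *)
Lemma bernoulli_ineq2 (y : R) m : 0 <= y <= 1 -> (1 - y) ^+ m * (1 + m%:R * y) <= 1.
Proof.
move=> /andP[y0 y1]; elim: m => [|m IH]; first by rewrite mul0r addr0 expr0 mulr1.
rewrite exprS; set P := (1 - y) ^+ m in IH *.
have P0 : 0 <= P by rewrite exprn_ge0// subr_ge0.
apply: le_trans IH; rewrite -natr1.
rewrite [leLHS](_ : _ = P * (1 + m%:R * y - (m%:R + 1) * y ^+ 2)); last by ring.
apply: ler_wpM2l => //; rewrite gerBl mulr_ge0 ?sqr_ge0// addr_ge0//.
Qed.

(** With y = t^n and m = 2^n the Bernoulli bound reads 1 - (2t)^n, which is where the threshold 1/2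
    comes from. *)
Lemma stone_lt (t : R) : 0 <= t < 1 / 2 ->
  (fun n => (1 - t ^+ n) ^+ (2 ^ n)) @ \oo --> (1 : R).
Proof.
move=> /andP[t0 t12].
have t1 n : 0 <= t ^+ n <= 1 by rewrite exprn_ge0//= exprn_ile1//; lra.
apply: (@squeeze_cvgr _ _ _ _ (fun n => 1 - (2 * t) ^+ n) (fun=> 1)).
- apply: nearW => n; rewrite exprn_ile1 ?andbT; last 2 first.
  + by rewrite subr_ge0; case/andP: (t1 n).
  + by rewrite gerBl; case/andP: (t1 n).
  have := bernoulli_ineq (2 ^ n) (t1 n).
  by rewrite natrX -exprMn.
- rewrite -[X in _ --> X](subr0 1); apply: cvgB; first exact: cvg_cst.
  by apply: cvg_expr; rewrite ger0_norm; lra.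
- exact: cvg_cst.
Qed.

Lemma stone_gt (t : R) : 1 / 2 < t <= 1 ->
  (fun n => (1 - t ^+ n) ^+ (2 ^ n)) @ \oo --> (0 : R).
Proof.
move=> /andP[t12 tl1].
have t0 : 0 < t by lra.
have t1 n : 0 <= t ^+ n <= 1 by rewrite exprn_ge0//= ?exprn_ile1//; lra.
apply: (@squeeze_cvgr _ _ _ _ (fun=> 0) (fun n => (2 * t)^-1 ^+ n)).
- apply: nearW => n; apply/andP; split.
    by rewrite exprn_ge0// subr_ge0; case/andP: (t1 n).
  have P0 : 0 < (2 * t) ^+ n by rewrite exprn_gt0//; lra.
  rewrite exprVn -[leRHS]mul1r ler_pdivlMr//.
  have := bernoulli_ineq2 (2 ^ n) (t1 n).
  rewrite natrX -exprMn; apply: le_trans.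
  apply: ler_wpM2l; last by rewrite lerDr.
  by rewrite exprn_ge0// subr_ge0; case/andP: (t1 n).
- exact: cvg_cst.
- apply: cvg_expr; rewrite ger0_norm; last by rewrite invr_ge0; lra.
  by rewrite invf_lt1; lra.
Qed.

End stone.

(** * The uniform measure on the unit interval *)

Section unif.
Context {R : realType}.
Local Notation leb := (@lebesgue_measure R).

Definition U01 : probability (measurableTypeR R) R := uniform_prob (@ltr01 R).

Lemma integral_U01 (f : measurableTypeR R -> \bar R) : measurable_fun setT f ->
  (\int[U01]_x f x = \int[leb]_(x in `[0%R, 1%R]) f x)%E.
Proof.
move=> mf; rewrite integralE [RHS]integralE.
rewrite !integral_uniform ?subr0 ?invr1 ?mul1e//.
  exact: measurable_funeneg.
exact: measurable_funepos.
Qed.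

Lemma Rintegral_U01 (f : measurableTypeR R -> R) : measurable_fun setT f ->
  \int[U01]_x f x = \int[leb]_(x in `[0%R, 1%R]) f x.
Proof. by move=> mf; rewrite /Rintegral integral_U01//; exact/measurable_EFinP. Qed.

Lemma U01_setC : U01 (~` `[0%R, 1%R]) = 0%E.
Proof.
rewrite probability_setC//.
by rewrite [X in (1 - X)%E]integral_uniform_pdf1 ?subee.
Qed.

Lemma ae_U01 (P : R -> Prop) :
  {ae leb, forall x, 0 < x < 1 -> P x} -> {ae U01, forall x, P x}.
Proof.
move=> [N [mN N0 NP]].
have mN' : measurable (N `|` [set 0] `|` [set 1] : set (measurableTypeR R)).
  by apply: measurableU => //; apply: measurableU.
exists (~` `[0%R, 1%R] `|` (N `|` [set 0] `|` [set 1])); split.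
- by apply: measurableU => //; exact: measurableC.
- rewrite null_set_setU//; [exact: measurableC|exact: U01_setC|].
  have /null_content_dominatesP dom := @dominates_uniform_prob R 0 1 ltr01.
  apply: dom => //.
  apply: null_set_setU => //; first exact: measurableU.
    by apply: null_set_setU => //; exact: lebesgue_measure_set1.
  exact: lebesgue_measure_set1.
- move=> x /= nP; have [x01|] := pselect (`[0%R, 1%R]%classic x); last by left.
  right; move: x01; rewrite /= in_itv/= !le_eqVlt => /andP[].
  case/predU1P=> [<-|x0]; first by left; right.
  case/predU1P=> [->|x1]; first by right.
  by left; left; apply: NP => /= /(_ _) H; apply: nP; apply: H; rewrite x0 x1.
Qed.

Lemma integrable_U01 (h : measurableTypeR R -> R) :
  U01.-integrable setT (EFin \o h) -> leb.-integrable `[0%R, 1%R] (EFin \o h).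
Proof.
move=> /integrableP[mh ih]; apply/integrableP; split.
  exact: measurable_funTS.
by rewrite -integral_U01//; exact: measurableT_comp.
Qed.

(** By Lebesgue differentiation [h] is almost everywhere the derivative of its primitive, and that
    primitive is constant on the open interval. *)
Lemma ae0_of_itv_integrals (h : R -> R) :
  leb.-integrable `[0, 1] (EFin \o h) ->
  (forall c, 0 < c < 1 -> \int[leb]_(x in `[0, c]) h x = 0) ->
  {ae leb, forall x, 0 < x < 1 -> h x = 0}.
Proof.
move=> ih h0; pose f := h \_ `[0, 1].
have iF : leb.-integrable setT (EFin \o f).
  by rewrite -restrict_EFin; exact: (integrable_mkcond _ _).1.
have iFy y : leb.-integrable [set` Interval (BLeft 0) (BRight y)] (EFin \o f).
  by apply: integrableS iF => //; exact: measurable_itv.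
have := FTC1 iFy (open_integrable_locally openT iF).
apply: filterS; first exact: (ae_filter_ringOfSetsType leb).
move=> x /= H /andP[x0 x1].
have [|_] := H; first by rewrite lte_fin.
have -> : f x = h x by rewrite /f /patch mem_set//; rewrite /= in_itv/= (ltW x0) (ltW x1).
move=> <-; rewrite derive1E (@near_eq_derive _ _ _ _ (cst 0)) ?derive_cst//.
have : \forall y \near x, y \in `]0, 1[.
  by apply: near_in_itvoo; rewrite in_itv/= x0 x1.
apply: filterS => y; rewrite in_itv/= => y01.
rewrite -[RHS](h0 _ y01); apply: eq_Rintegral => z.
rewrite inE/= in_itv/= => /andP[z0 zy].
by rewrite /f /patch mem_set//; rewrite /= in_itv/= z0 (le_trans zy)//; case/andP: y01 => _ /ltW.
Qed.

End unif.

Section fourier_1d_inj.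
Context {R : realType}.
Local Notation leb := (@lebesgue_measure R).

(** The wave is the cosine of 2 pi times the circular distance from [x] to the midpoint c/2 of the
    arc ]0, c[, and cos (pi c) is its value at the end points. So 1/2 separates the arc from its
    complement; the division by 4 keeps the values in [0, 1]. *)
Definition arcfun (c x : R) : R := 1 / 2 + (cos (pi * c) - cw 1 (- (pi * c)) x) / 4.

Lemma arcfun_itv (c x : R) : 0 <= arcfun c x <= 1.
Proof.
rewrite /arcfun; have := cos_max (pi * c); have := cw_le1 1 (- (pi * c)) x.
by rewrite !ler_norml => /andP[? ?] /andP[? ?]; apply/andP; split; lra.
Qed.

Lemma arcfun_lt (c x : R) : 0 < c < 1 -> 0 < x < c -> arcfun c x < 1 / 2.
Proof.
move=> /andP[c0 c1] /andP[x0 xc]; have p0 := pi_gt0 R.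
have : cos (pi * c) < cw 1 (- (pi * c)) x.
  rewrite /cw mul1r -(cos_norm (_ + _)) ltr_cos.
  - by rewrite lter_norml; nra.
  - by rewrite in_itv/= normr_ge0/= ler_norml; nra.
  - by rewrite in_itv/=; nra.
by rewrite /arcfun; lra.
Qed.

Lemma arcfun_gt (c x : R) : 0 < c < 1 -> c < x < 1 -> 1 / 2 < arcfun c x.
Proof.
move=> /andP[c0 c1] /andP[xc x1]; have p0 := pi_gt0 R.
have : cw 1 (- (pi * c)) x < cos (pi * c).
  rewrite /cw mul1r; have [h|h] := leP (2 * x - c) 1.
    rewrite ltr_cos; first by nra.
    - by rewrite in_itv/=; nra.
    - by rewrite in_itv/=; nra.
  (* Here the angle exceeds pi; reflecting it brings it back to the interval where cosine
     decreases. *)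
  have -> : cos (2 * pi * x + - (pi * c)) = cos (2 * pi - (2 * pi * x - pi * c)).
    by rewrite -[LHS]cosN -[LHS]cosD2pi; congr cos; ring.
  rewrite ltr_cos; first by nra.
  - by rewrite in_itv/=; nra.
  - by rewrite in_itv/=; nra.
by rewrite /arcfun; lra.
Qed.

Lemma annih_arcfun (mu : probability (measurableTypeR R) R) h c g :
  mu.-integrable setT (EFin \o h) ->
  annih mu h g -> annih mu h (fun x => g x * arcfun c x).
Proof.
move=> ih ag.
rewrite (_ : (fun _ => _) = (fun x => (1 / 2 + cos (pi * c) / 4) * g x +
   (- 4^-1) * (g x * cw 1 (- (pi * c)) x))); last first.
  by apply/funext => x; rewrite /arcfun; lra.
by apply: annih_lin => //; exact: annih_cw.
Qed.

(** Stone's trick applied to [arcfun c] produces trigonometric polynomials that tend boundedly to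
    the indicator of [0, c], so the integral of [h] over every such interval vanishes. *)
Lemma fourier_1d_inj (h : measurableTypeR R -> R) :
  U01.-integrable setT (EFin \o h) ->
  (forall n c, \int[U01]_x (h x * cw n c x) = 0) ->
  {ae U01, forall x, h x = 0}.
Proof.
move=> ih h0.
have mh : measurable_fun setT h by case/integrableP: ih => /measurable_EFinP.
apply: ae_U01; apply: ae0_of_itv_integrals; first exact: integrable_U01.
move=> c c01; have [c0 c1] := andP c01.
pose g n x := (1 - arcfun c x ^+ n) ^+ (2 ^ n).
have ag n : annih U01 h (g n).
  apply: annih_stone => // g' ag; exact: annih_arcfun.
have mg n : measurable_fun setT (g n) by case: (ag n).
have zg n : \int[U01]_x (h x * g n x) = 0.
  have [_ _ /(_ 0 0)] := ag n; under eq_Rintegral => x _.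
    by rewrite /cw mul0r mulr0 addr0 cos0 mulr1; over.
  by [].
have cvg_hg : {ae U01, forall x, setT x -> (fun n => h x * g n x) @ \oo -->
    (h x * \1_(`[0, c]%classic) x)}.
  apply: ae_U01.
  (* At [x = c] the value of [arcfun] is exactly 1/2, where neither limit of Stone's trick applies;
     a single point is negligible. *)
  have [N [mN N0 Nc]] : {ae leb, forall x, x != c}.
    exists [set c]; split => //; first exact: lebesgue_measure_set1.
    by move=> x /= /negP; rewrite negbK => /eqP.
  exists N; split => // x /= nP; apply: Nc => /= xc; apply: nP.
  move=> /andP[x0 x1] _; apply: cvgM; first exact: cvg_cst.
  have /andP[t0 t1] := arcfun_itv c x.
  rewrite indicE /g; have [xc'|cx] := ltP x c.
    rewrite mem_set; last by rewrite /= in_itv/= !ltW.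
    by apply: stone_lt; rewrite t0 arcfun_lt// x0.
  have {}cx : c < x by rewrite lt_neqAle eq_sym xc.
  rewrite memNset; last by rewrite /= in_itv/= => /andP[_]; rewrite leNgt cx.
  by apply: stone_gt; rewrite t1 andbT arcfun_gt// cx.
have mind : measurable_fun setT (\1_(`[0, c]%classic) : measurableTypeR R -> R).
  exact: measurable_indic.
have cv : (fun n => \int[U01]_x (h x * g n x)) @ \oo -->
    \int[U01]_x (h x * \1_(`[0, c]%classic) x).
  apply: (@Rintegral_dominated _ _ _ U01 setT _ _ (fun x => `|h x|)) => //.
  - by move=> n; apply: measurable_funM => //; exact: mg.
  - exact: measurable_funM.
  - exact: integrable_norm.
  - move=> n x _; rewrite normrM -[leRHS]mulr1 ler_wpM2l//.
    have /andP[t0 t1] := arcfun_itv c x.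
    have /andP[q0 q1] : 0 <= 1 - arcfun c x ^+ n <= 1.
      by rewrite subr_ge0 exprn_ile1//= gerBl exprn_ge0.
    by rewrite ger0_norm ?exprn_ge0// exprn_ile1.
have : \int[U01]_x (h x * \1_(`[0, c]%classic) x) = 0.
  apply/esym/(@cvg_unique _ _ _ _ _ _ _ cv).
    exact: (@Rhausdorff R).
  rewrite (_ : (fun n => _) = fun=> 0); first exact: cvg_cst.
  by apply/funext => n; exact: zg.
rewrite Rintegral_U01; last exact: measurable_funM.
move=> h1; rewrite -[RHS]h1.
rewrite [LHS]Rintegral_mkcond [RHS]Rintegral_mkcond; apply: eq_Rintegral => x _.
rewrite /patch indicE; have [xc|xc] := boolP (x \in `[0, c]%classic); last first.
  by rewrite mulr0 if_same.
rewrite mulr1 mem_set//; move: xc; rewrite inE /= !in_itv/= => /andP[-> xc].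
exact: le_trans xc (ltW c1).
Qed.
End fourier_1d_inj.

(** * Injectivity of the Fourier transform on the cube *)

Section cube.
Context {R : realType}.
Local Notation mR := (measurableTypeR R).
Local Notation C d := (@unif_cube R d).

Lemma integral_cubeS d (g : d.+1.-tuple mR -> \bar R) :
  measurable_fun setT g -> (forall x, 0 <= g x)%E ->
  (\int[C d.+1]_x g x = \int[U01]_z \int[C d]_x g (tcons (z, x)))%E.
Proof.
move=> mg g0; rewrite /= ge0_integral_distribution//.
have mg' : measurable_fun setT (g \o @tcons R d).
  by apply: measurableT_comp => //; exact: measurable_tcons.
by rewrite fubini_tonelli1//= => x; exact: g0.
Qed.

Lemma integrable_cubeS d (f : d.+1.-tuple mR -> R) :
  (C d.+1).-integrable setT (EFin \o f) ->
  (U01 \x C d)%E.-integrable setT (EFin \o (f \o @tcons R d)).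
Proof.
move=> /integrableP[mf fi]; apply/integrableP; split.
  by apply: (measurableT_comp mf); exact: measurable_tcons.
rewrite /= ge0_integral_distribution// in fi.
by apply/measurable_EFinP/measurableT_comp => //; exact/measurable_EFinP.
Qed.

Definition wave d (k : 'rV[int]_d) (c : R) (x : d.-tuple mR) : R :=
  cos (2 * pi * dot (zvec k) (row_of_tuple x) + c).

Definition kcons d (n : int) (k : 'rV[int]_d) : 'rV[int]_d.+1 :=
  \row_i oapp (fun j => k 0 j) n (unlift ord0 i).

Lemma dot_kcons d n (k : 'rV[int]_d) (z : R) (x : d.-tuple mR) :
  dot (zvec (kcons n k)) (row_of_tuple (tcons (z, x))) =
  n%:~R * z + dot (zvec k) (row_of_tuple x).
Proof.
rewrite /dot big_ord_recl !mxE unlift_none/=; congr (_ + _).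
by apply: eq_bigr => i _; rewrite !mxE liftK/= tnthS.
Qed.

Lemma measurable_dot_tuple d (k : 'rV[int]_d) :
  measurable_fun setT (fun x : d.-tuple mR => dot (zvec k) (row_of_tuple x)).
Proof.
apply: measurable_sum => i; apply: measurable_funM => //.
rewrite (_ : (fun _ => _) = (fun x => tnth x i)); first exact: measurable_tnth.
by apply/funext => x; rewrite mxE.
Qed.

Lemma measurable_wave d k c : measurable_fun setT (@wave d k c).
Proof.
apply: (@measurableT_comp _ _ _ _ _ _ (@cos R)).
  exact: continuous_measurable_fun (@continuous_cos R).
apply: measurable_funD => //; apply: measurable_funM => //.
exact: measurable_dot_tuple.
Qed.

Lemma wave_le1 d k c x : `|@wave d k c x| <= 1. Proof. exact: cos_max. Qed.

Lemma cw_wave d n (k : 'rV[int]_d) (c c' z : R) x :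
  wave k c' x * cw n c z =
  2^-1 * wave (kcons n k) (c' + c) (tcons (z, x)) +
  2^-1 * wave (kcons (- n) k) (c' - c) (tcons (z, x)).
Proof.
rewrite /wave /cw cos_prod mulrDl ![_ / 2]mulrC.
by congr (_ * cos _ + _ * cos _); rewrite dot_kcons ?rmorphN/=; ring.
Qed.

(** Two phases per frequency suffice, so only countably many waves, and countably many exceptional
    null sets, have to be considered. *)
Lemma wave_shift d (k : 'rV[int]_d) c x :
  wave k c x = cos c * wave k 0 x + sin c * wave k (pi / 2) x.
Proof. by rewrite /wave cosDpihalf cosD addr0; ring. Qed.

Lemma ae_forall_countable d' (T : measurableType d') (mu : {measure set T -> \bar R})
    (I : countType) (P : I -> T -> Prop) :
  (forall i, {ae mu, forall x, P i x}) -> {ae mu, forall x, forall i, P i x}.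
Proof.
move=> h.
have : {ae mu, forall x (n : nat), forall i, unpickle n = Some i -> P i x}.
  apply/ae_foralln => n; case: (unpickle n) => [i|]; last exact: aeW.
  by apply: filterS (h i) => x Pi _ [<-].
by apply: filterS => x H i; apply: (H (pickle i)); rewrite pickleK.
Qed.

(** Induction on the dimension. For a fixed wave in the last [d] variables, the partial integral is
    a function of the first variable orthogonal to all one-dimensional waves, hence zero almost
    everywhere. Outside a countable union of null sets, the induction hypothesis then applies to the
    slice. *)
Theorem cube_fourier_inj d (f : d.-tuple mR -> R) :
  (C d).-integrable setT (EFin \o f) ->
  (forall k c, \int[C d]_x (f x * wave k c x) = 0) ->
  {ae C d, forall x, f x = 0}.
Proof.
elim: d f => [|d IH] f fi f0.
  apply: aeW => x; have := f0 0 0.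
  rewrite /Rintegral integral_dirac ?diracT ?mul1e//=; last first.
    by apply/measurable_EFinP/measurable_funM; [case/integrableP: fi => /measurable_EFinP
      |exact: measurable_wave].
  rewrite /wave /dot big_ord0 mulr0 addr0 cos0 mulr1 => <-.
  by rewrite (tuple0 x).
have mf : measurable_fun setT f by case/integrableP: fi => /measurable_EFinP.
have Fi := integrable_cubeS fi.
have mt := @measurable_tcons R d.
pose F z x := f (tcons (z, x)).
have Fwi k c : (U01 \x C d)%E.-integrable setT
    (EFin \o (fun zx => f (tcons zx) * wave k c zx.2)).
  apply: (@integrable_mul_bdd _ _ _ _ _ _ _ 1) => //.
    by apply: measurableT_comp => //; exact: measurable_wave.
  by move=> x _; exact: wave_le1.
have Fz : {ae U01, forall z, (C d).-integrable setT (EFin \o F z)}.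
  exact: (ae_integrable1 Fi).
pose h k c (z : mR) := \int[C d]_x (F z x * wave k c x).
have hE k c : {ae U01, forall z, (h k c z)%:E =
    fubini_F (C d) (EFin \o (fun zx => f (tcons zx) * wave k c zx.2)) z}.
  apply: filterS Fz => z Fz; rewrite /h /fubini_F /Rintegral fineK//.
  apply: integrable_fin_num => //.
  apply: (@integrable_mul_bdd _ _ _ _ _ _ _ 1) => //.
    exact: measurable_wave.
  by move=> x _; exact: wave_le1.
have mFF k c := measurable_fubini_F (Fwi k c).
have iFF k c := integrable_fubini_F (Fwi k c).
have mh k c : measurable_fun setT (h k c).
  by apply: (@measurableT_comp _ _ _ _ _ _ (@fine R)) => //; exact: mFF.
(* [fine] sends an infinite value to 0, so [h] is dominated by the Fubini marginal even at the
   exceptional points where the slice is not integrable. *)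
have ihk k c : U01.-integrable setT (EFin \o h k c).
  apply: le_integrable (iFF k c) => //; first exact/measurable_EFinP.
  move=> z _ /=; rewrite /h /Rintegral /fubini_F /=.
  by case: (integral _ _ _) => [r| |]//=; rewrite normr0 leey.
have h0 k c : {ae U01, forall z, h k c z = 0}.
  apply: fourier_1d_inj => // n e.
  transitivity (\int[C d.+1]_x (2^-1 * (f x * wave (kcons n k) (c + e) x) +
                                2^-1 * (f x * wave (kcons (- n) k) (c - e) x))).
    pose g (x : d.+1.-tuple mR) := 2^-1 * (f x * wave (kcons n k) (c + e) x) +
                      2^-1 * (f x * wave (kcons (- n) k) (c - e) x).
    pose G (zx : mR * d.-tuple mR) := f (tcons zx) * wave k c zx.2 * cw n e zx.1.
    have gG zx : g (tcons zx) = G zx.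
      by case: zx => z x; rewrite /g /G /= -[RHS]mulrA cw_wave; ring.
    have mg : measurable_fun setT g.
      by apply: measurable_funD; do 2 (apply: measurable_funM => //);
        exact: measurable_wave.
    have Gi : (U01 \x C d)%E.-integrable setT (EFin \o G).
      apply: (@integrable_mul_bdd _ _ _ _ _ _ _ 1) => //.
        by apply: measurableT_comp => //; exact: measurable_cw.
      by move=> x _; exact: cw_le1.
    have gGE : (EFin \o g) \o @tcons R d = EFin \o G.
      by apply/funext => zx; congr EFin; exact: gG.
    have -> : \int[C d.+1]_x g x = fine (\int[(U01 \x C d)%E]_zx (G zx)%:E).
      rewrite /Rintegral [X in fine X = _]integral_distribution/=.
      + by congr fine; apply: eq_integral => zx _; exact: (congr1 (@^~ zx) gGE).
      + exact/measurable_EFinP.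
      + by apply: eq_integrable Gi => // zx _; rewrite -gGE.
    rewrite -(integral12_prod_meas1 Gi); congr fine.
    apply: ae_eq_integral => //.
    - by apply/measurable_EFinP/measurable_funM => //; exact: measurable_cw.
    - exact: (measurable_fubini_F Gi).
    apply: filterS Fz => z Fz _; rewrite /fubini_F /G /=.
    have Fw : (C d).-integrable setT (EFin \o (fun x => F z x * wave k c x)).
      apply: (@integrable_mul_bdd _ _ _ _ _ _ _ 1) => //.
        exact: measurable_wave.
      by move=> x _; exact: wave_le1.
    rewrite /h -RintegralZr// /Rintegral fineK//.
    apply: integrable_fin_num => //.
    apply: (@integrable_mul_bdd _ _ _ _ _ _ _ 1) => // x _; exact: cw_le1.
  have fw k' c' : (C d.+1).-integrable setT (EFin \o (fun x => f x * wave k' c' x)).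
    apply: (@integrable_mul_bdd _ _ _ _ _ _ _ 1) => //.
      exact: measurable_wave.
    by move=> x _; exact: wave_le1.
  rewrite RintegralD//; [|exact: integrable_scale..].
  by rewrite !RintegralZl// !f0 !mulr0 addr0.
(* The boolean selects one of the two phases of [wave_shift]; the index type is countable. *)
have : {ae U01, forall z, forall kb : 'rV[int]_d * bool,
    h kb.1 (if kb.2 then pi / 2 else 0) z = 0}.
  by apply: ae_forall_countable => -[k b]; exact: h0.
move=> hz.
have F0 : {ae U01, forall z, {ae C d, forall x, F z x = 0}}.
  apply: filterS2 Fz hz => z Fz hz.
  apply: IH => // k c.
  have Fw k' c' : (C d).-integrable setT (EFin \o (fun x => F z x * wave k' c' x)).
    apply: (@integrable_mul_bdd _ _ _ _ _ _ _ 1) => //.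
      exact: measurable_wave.
    by move=> x _; exact: wave_le1.
  transitivity (\int[C d]_x (cos c * (F z x * wave k 0 x) + sin c * (F z x * wave k (pi / 2) x))).
    by apply: eq_Rintegral => x _; rewrite [in LHS]wave_shift; ring.
  rewrite RintegralD//; [|exact: integrable_scale..].
  rewrite !RintegralZl//.
  have /= := hz (k, false); have /= := hz (k, true); rewrite /h => -> ->.
  by rewrite !mulr0 addr0.
(* Vanishing on almost every slice is converted by Tonelli into a zero L^1 norm, hence into
   vanishing almost everywhere in the larger cube. *)
have I0 : (\int[C d.+1]_x `|(f x)%:E| = 0)%E.
  rewrite integral_cubeS//; last exact/measurableT_comp/measurable_EFinP.
  transitivity (\int[@U01 R]_z (cst 0 z))%E; last by rewrite integral_cst// mul0e.
  apply: ae_eq_integral => //.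
  - apply: (measurable_fun_fubini_tonelli_F (fun zx => `|(f (tcons zx))%:E|%E)) => //.
    do 2 apply: measurableT_comp => //.
    exact: measurableT_comp.
  - apply: filterS F0 => z F0 _.
    apply/ae_eq_integral_abs => //.
      by case/integrableP : (Fi) => m _; exact: (measurableT_comp m).
    by apply: filterS F0 => x Fx _; rewrite /= /F in Fx *; rewrite Fx.
have /(ae_eq_integral_abs _ measurableT) : measurable_fun setT (EFin \o f).
  exact/measurable_EFinP.
move=> /(_ (C d.+1))[/(_ I0) H _].
by apply: filterS H => x /(_ I) [].
Qed.

End cube.

(** * Zero sets of trigonometric polynomials on the cube *)

Section resampling.
Context {R : realType}.
Local Notation mR := (measurableTypeR R).
Local Notation C d := (@unif_cube R d).

Definition updt d (x : d.-tuple mR) (i : 'I_d) (s : mR) : d.-tuple mR :=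
  [tuple if j == i then s else tnth x j | j < d].

Lemma updt0 d (z s : mR) (x : d.-tuple mR) :
  updt (tcons (z, x)) ord0 s = tcons (s, x).
Proof.
apply: eq_from_tnth => j; rewrite tnth_mktuple.
by case: (unliftP ord0 j) => [k|] ->; rewrite ?eqxx ?tnth0 // !tnthS.
Qed.

Lemma updtS d (z s : mR) (x : d.-tuple mR) i :
  updt (tcons (z, x)) (lift ord0 i) s = tcons (z, updt x i s).
Proof.
apply: eq_from_tnth => j; rewrite tnth_mktuple.
case: (unliftP ord0 j) => [k|] ->; last by rewrite !tnth0.
by rewrite (inj_eq lift_inj) !tnthS tnth_mktuple.
Qed.

Lemma measurable_updt d (i : 'I_d) :
  measurable_fun setT (fun xs : d.-tuple mR * mR => updt xs.1 i xs.2).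
Proof.
apply/measurable_fun_tnthP => j.
rewrite (_ : _ \o _ = if j == i then snd else (fun xs : d.-tuple mR * mR => tnth xs.1 j)).
  case: ifP => _; first exact: measurable_snd.
  by apply: (@measurableT_comp _ _ _ _ _ _ (fun x : d.-tuple mR => tnth x j)) => //;
    exact: measurable_tnth.
by apply/funext => xs /=; rewrite tnth_mktuple; case: ifP.
Qed.

Lemma measurable_tcons1 d (z : mR) :
  measurable_fun setT (fun x : d.-tuple mR => tcons (z, x)).
Proof.
exact: (measurableT_comp (@measurable_tcons R d) (measurable_pair1 z)).
Qed.

(** Resampling one coordinate by an independent uniform variable leaves a product measure unchanged.
    This gives access to integrals along lines in any coordinate, not just the first. *)
Lemma integral_updt d (i : 'I_d) (g : d.-tuple mR -> \bar R) :
  measurable_fun setT g -> (forall x, 0 <= g x)%E ->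
  (\int[C d]_x g x = \int[C d]_x \int[U01]_s g (updt x i s))%E.
Proof.
elim: d i g => [[]//|d IH] i g mg g0.
have mgu : measurable_fun setT (fun x => \int[U01]_s g (updt x i s))%E.
  apply: (measurable_fun_fubini_tonelli_F (fun xs => g (updt xs.1 i xs.2))) => //.
  by apply: (measurableT_comp mg); exact: measurable_updt.
rewrite !integral_cubeS//; last by move=> x; exact: integral_ge0.
case: (unliftP ord0 i) => [k ->|->].
  apply: eq_integral => z _; rewrite (IH k)//; last first.
    by apply: (measurableT_comp mg); exact: measurable_tcons1.
  apply: eq_integral => x _; apply: eq_integral => s _; by rewrite updtS.
transitivity (\int[@U01 R]_z (cst (\int[C d]_x \int[U01]_s g (tcons (s, x))) z))%E.
  rewrite integral_cst//= probability_setT mule1.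
  apply: (fubini_tonelli (fun zx : mR * d.-tuple mR => g (tcons zx))) => //.
  by apply: (measurableT_comp mg); exact: measurable_tcons.
apply: eq_integral => z _; apply: eq_integral => x _; apply: eq_integral => s _.
by rewrite updt0.
Qed.

Lemma U01_itv (a b : R) : 0 <= a -> a < b -> b <= 1 -> (0 < U01 `]a, b[%classic)%E.
Proof.
move=> a0 ab b1.
rewrite /U01 /= /uniform_prob (eq_integral (fun=> 1%E)); last first.
  move=> x; rewrite inE/= in_itv/= => /andP[ax xb].
  by rewrite /uniform_pdf !ltW ?(le_lt_trans a0 ax) ?(lt_le_trans xb b1)//= subr0 invr1.
rewrite integral_cst//= mul1e lebesgue_measure_itv/= lte_fin ab.
by rewrite -EFinB lte_fin subr_gt0.
Qed.

Lemma measurable_cube_box d (y : 'I_d -> R) (e : R) :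
  measurable [set x : d.-tuple mR | forall i, `|tnth x i - y i| < e].
Proof.
rewrite (_ : mkset _ = \bigcap_(i in [set: 'I_d])
   ((fun x : d.-tuple mR => tnth x i) @^-1` ball (y i) e)); last first.
  by apply/seteqP; split => x /= H i; [move=> _|have := H i I]; rewrite /ball/= distrC.
apply: fin_bigcap_measurable => // i _.
rewrite -[X in measurable X]setTI; apply: measurable_tnth => //.
exact: measurable_ball.
Qed.

Lemma cube_box_gt0 d (y : 'I_d -> R) (e : R) : 0 < e -> (forall i, 0 <= y i < 1) ->
  (0 < C d [set x | forall i, (`|tnth x i - y i| < e)%R])%E.
Proof.
elim: d y => [|d IH] y e0 y01.
  by rewrite (_ : [set x | _] = setT) ?probability_setT ?lte01//;
    apply/seteqP; split => // x _ [].
pose A := [set x : d.-tuple mR | forall i, `|tnth x i - y (lift ord0 i)| < e].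
have mA : measurable A by exact: measurable_cube_box.
have [y0 y1] := andP (y01 ord0).
(* Only the part of the box above [y ord0] is used: [y ord0 < 1] leaves room there, while
   [y ord0 = 0] would leave none below. *)
pose b := Num.min (y ord0 + e) 1.
have yb : y ord0 < b by rewrite lt_min ltrDl e0 y1.
have IHA : (0 < C d A)%E by apply: IH.
apply: (@lt_le_trans _ _ ((U01 \x C d)%E (`]y ord0, b[%classic `*` A))).
  rewrite product_measure1E//.
  by rewrite mule_gt0// U01_itv// ge_min lexx orbT.
rewrite /= /distribution /pushforward; apply: le_measure.
- by rewrite inE; exact: measurableX (measurable_itv _) mA.
- rewrite inE -[X in measurable X]setTI; apply: measurable_tcons => //.
  exact: measurable_cube_box.
- move=> [z x] [/= + Ax] i; rewrite in_itv/= lt_min => /and3P[yz ze _].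
  case: (unliftP ord0 i) => [k ->|->]; rewrite ?tnthS ?tnth0//.
  by rewrite /= ger0_norm ?subr_ge0 ?(ltW yz)// ltrBlDl.
Qed.

(* On each coordinate line f vanishes identically or almost nowhere; by
   induction on the dimension the same alternative then holds globally. *)
Lemma cube_zero_dichotomy d (f : d.-tuple mR -> R) : measurable_fun setT f ->
  (forall x i, (forall s, f (updt x i s) = 0) \/ {ae U01, forall s, f (updt x i s) != 0}) ->
  {ae C d, forall x, f x != 0} \/ (forall x, f x = 0).
Proof.
elim: d f => [|d IH] f mf Hf.
  have [f0|f0] := eqVneq (f [tuple]) 0.
    by right => x; rewrite (tuple0 x).
  by left; apply: aeW => x; rewrite (tuple0 x).
pose S := [set x : d.-tuple mR | forall z, f (tcons (z, x)) = 0].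
(* If [S] is not negligible, no slice at a fixed first coordinate can be nonzero almost everywhere,
   so the induction hypothesis makes every slice vanish identically. *)
have [nS|nS] := pselect {ae C d, forall x, ~ S x}; last first.
  right => x; rewrite (tuple_eta x).
  rewrite (_ : [tuple of _] = tcons (thead x, [tuple of behead x]))//.
  set z := thead x.
  have [||H|-> //] := IH (fun x => f (tcons (z, x))).
  - by apply: (measurableT_comp mf); exact: measurable_tcons1.
  - move=> x' i; case: (Hf (tcons (z, x')) (lift ord0 i)) => H.
      by left=> s; rewrite -updtS; exact: H.
    by right; apply: filterS H => s; rewrite updtS.
  - by exfalso; apply: nS; apply: filterS H => x' /eqP fx Sx; exact: fx.
left.
have mt := measurableT_comp mf (@measurable_tcons R d).
have mI : measurable [set zx | f (@tcons R d zx) = 0].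
  by rewrite -[X in measurable X]setTI; apply: (mt measurableT [set 0]).
exists (f @^-1` [set 0]); split.
- by rewrite -[X in measurable X]setTI; exact: mf.
- have := @integral_indic _ _ _ (U01 \x C d)%E setT measurableT _ mI.
  rewrite setIT => I1; transitivity ((U01 \x C d)%E [set zx | f (tcons zx) = 0]) => //.
  rewrite -I1.
  rewrite fubini_tonelli2//; last exact/measurable_EFinP/measurable_indic.
  transitivity (\int[C d]_x (cst 0 x))%E; last by rewrite integral_cst// mul0e.
  apply: ae_eq_integral => //.
    apply: (measurable_fun_fubini_tonelli_G (EFin \o \1_[set zx | f (tcons zx) = 0])).
      exact/measurable_EFinP/measurable_indic.
    by move=> x; rewrite lee_fin.
  (* Outside [S] the line through [x] in the first coordinate contains a nonzero value, so by the
     alternative on lines its zeros have measure 0. *)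
  apply: filterS nS => x nSx _ /=; rewrite /fubini_G.
  have [fx|fx] := Hf (tcons (0, x)) ord0.
    by exfalso; apply: nSx => z; rewrite -(updt0 0) fx.
  transitivity (\int[@U01 R]_x (cst 0 x))%E; last by rewrite integral_cst// mul0e.
  apply: ae_eq_integral => //.
    exact: (measurableT_comp ((measurable_EFinP _ _).2 (measurable_indic mI))
             (measurable_pair2 x)).
  apply: filterS fx => s; rewrite updt0 => /eqP fs _ /=.
  by rewrite indicE memNset.
- by move=> x /= /negP; rewrite negbK => /eqP.
Qed.
End resampling.

(** * Fourier analysis on the torus *)

Section torus_measure.
Context {R : realType}.
Local Notation mR := (measurableTypeR R).
Local Notation C d := (@unif_cube R d).
Local Notation V d := 'rV[R]_d.

Lemma open_measurable_row d (U : set (V d)) : open U -> measurable U.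
Proof. by move=> oU; exact: sub_sigma_algebra. Qed.

(** Lower semicontinuity, rather than continuity, is what the Lagrangian offers as a supremum of
    continuous functions. *)
Lemma lsc_measurable_row d (f : V d -> R) :
  (forall c, open [set x | c < f x]) -> measurable_fun setT f.
Proof.
move=> lf; apply: (measurability _ (RGenOInfty.measurableE R)).
move=> _ [_ [c ->] <-]; rewrite setTI; apply: open_measurable_row.
rewrite (_ : _ @^-1` _ = [set x | c < f x])//.
by apply/seteqP; split => x /=; rewrite in_itv/= andbT.
Qed.

Lemma continuous_measurable_row d (f : V d -> R) :
  continuous f -> measurable_fun setT f.
Proof.
move=> cf; apply: lsc_measurable_row => c.
rewrite (_ : mkset _ = f @^-1` [set y | c < y])//; apply: open_comp; last exact: open_gt.
by move=> x _; exact: cf.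
Qed.

Lemma measurable_coord d (i : 'I_d) : measurable_fun setT (fun x : V d => x 0 i).
Proof. by apply: continuous_measurable_row; exact: coord_continuous. Qed.

Lemma measurable_rowP d' (T : measurableType d') d (f : T -> V d) (D : set T) :
  measurable D ->
  (forall i, measurable_fun D (fun x => f x 0 i)) -> measurable_fun D f.
Proof.
move=> mD mf.
pose g x : d.-tuple mR := [tuple ((fun x => f x 0 i) \_ D) x | i < d].
have mg : measurable_fun setT (@row_of_tuple R d \o g).
  apply: measurableT_comp; first exact: measurable_row_of_tuple.
  apply/measurable_fun_tnthP => i.
  rewrite (_ : _ \o _ = (fun x => f x 0 i) \_ D); first by apply: (measurable_restrictT _ _).1 => //; exact: mf.
  by apply/funext => x /=; rewrite tnth_mktuple.
apply: eq_measurable_fun (measurable_funS measurableT (@subsetT _ _) mg) => x xD /=.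
by apply/rowP => i; rewrite mxE tnth_mktuple /patch xD.
Qed.

Lemma ge0_integral_lebT d (f : V d -> \bar R) : measurable_fun setT f ->
  (forall x, 0 <= f x)%E ->
  (\int[lebT d]_x f x = \int[C d]_x f (row_of_tuple x))%E.
Proof. by move=> mf f0; rewrite ge0_integral_distribution. Qed.

Lemma integrable_lebT d (f : V d -> R) :
  (lebT d).-integrable setT (EFin \o f) ->
  (C d).-integrable setT (EFin \o (f \o @row_of_tuple R d)).
Proof.
move=> /integrableP[mf fi]; apply/integrableP; split.
  by apply: (measurableT_comp mf); exact: measurable_row_of_tuple.
rewrite ge0_integral_lebT// in fi.
by apply/measurable_EFinP/measurableT_comp => //; exact/measurable_EFinP.
Qed.

Lemma Rintegral_lebT d (f : V d -> R) :
  (lebT d).-integrable setT (EFin \o f) ->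
  \int[lebT d]_x f x = \int[C d]_x f (row_of_tuple x).
Proof.
move=> fi; rewrite /Rintegral [X in fine X = _]integral_distribution//.
  by case/integrableP: fi.
exact: integrable_lebT.
Qed.

Lemma ae_lebT d (P : V d -> Prop) :
  measurable [set x | P x] -> {ae C d, forall x, P (row_of_tuple x)} ->
  {ae lebT d, forall x, P x}.
Proof.
move=> mP [N [mN N0 NP]]; exists (~` [set x | P x]); split => //.
  exact: measurableC.
apply/eqP; rewrite eq_le measure_ge0 andbT -N0.
suff : (C d (@row_of_tuple R d @^-1` (~` [set x | P x])) <= C d N)%E by [].
apply: le_measure; rewrite ?inE//.
rewrite -[X in measurable X]setTI; apply: measurable_row_of_tuple => //.
exact: measurableC.
Qed.

End torus_measure.

Lemma cvg_sumR {R : realType} (T : Type) (F : set_system T) {FF : Filter F} (I : Type)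
    (s : seq I) (f : I -> T -> R) (l : I -> R) :
  (forall i, f i @ F --> l i) ->
  (fun x => \sum_(i <- s) f i x) @ F --> \sum_(i <- s) l i.
Proof.
move=> fl; elim: s => [|i s IH].
  by rewrite big_nil; under eq_fun do rewrite big_nil; exact: cvg_cst.
by rewrite big_cons; under eq_fun do rewrite big_cons; apply: cvgD.
Qed.

(** * Real Fourier modes on the torus *)

Section torus_trig.
Context {R : realType} {d : nat}.
Local Notation mR := (measurableTypeR R).
Local Notation V := 'rV[R]_d.
Local Notation C := (@unif_cube R d).
Local Notation leb := (@lebesgue_measure R).
Local Notation mode := ('rV[int]_d * bool)%type.

Lemma dotE (x y : V) : dot x y = \sum_i x 0 i * y 0 i. Proof. by []. Qed.

Lemma dotDr (x y z : V) : dot x (y + z) = dot x y + dot x z.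
Proof. by rewrite /dot -big_split; apply: eq_bigr => i _; rewrite mxE mulrDr. Qed.
Lemma dotZr (a : R) (x y : V) : dot x (a *: y) = a * dot x y.
Proof. by rewrite /dot mulr_sumr; apply: eq_bigr => i _; rewrite mxE mulrCA. Qed.
Lemma dotC (x y : V) : dot x y = dot y x.
Proof. by apply: eq_bigr => i _; rewrite mulrC. Qed.
Lemma dotDl (x y z : V) : dot (x + y) z = dot x z + dot y z.
Proof. by rewrite dotC dotDr ![dot z _]dotC. Qed.
Lemma dotZl (a : R) (x y : V) : dot (a *: x) y = a * dot x y.
Proof. by rewrite dotC dotZr dotC. Qed.
Lemma dotNr (x y : V) : dot x (- y) = - dot x y.
Proof. by rewrite -scaleN1r dotZr mulN1r. Qed.
Lemma dotNl (x y : V) : dot (- x) y = - dot x y.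
Proof. by rewrite dotC dotNr dotC. Qed.
Lemma dotBr (x y z : V) : dot x (y - z) = dot x y - dot x z.
Proof. by rewrite dotDr dotNr. Qed.
Lemma dotBl (x y z : V) : dot (x - y) z = dot x z - dot y z.
Proof. by rewrite dotDl dotNl. Qed.
Lemma dot0r (x : V) : dot x 0 = 0.
Proof. by rewrite /dot big1// => i _; rewrite mxE mulr0. Qed.
Lemma dot_ge0 (x : V) : 0 <= dot x x.
Proof. by apply: sumr_ge0 => i _; rewrite -expr2 sqr_ge0. Qed.
Lemma dot_delta (x : V) i : dot x (delta_mx 0 i) = x 0 i.
Proof.
rewrite /dot (bigD1 i)//= mxE !eqxx mulr1 big1 ?addr0// => j ji.
by rewrite mxE eqxx (negbTE ji) mulr0.
Qed.

Lemma continuous_dotr (x : V) : continuous (dot x).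
Proof.
move=> y; apply: (@cvg_sumR R V (nbhs y) _ _ _ (fun i z => x 0 i * z 0 i)) => i; apply: cvgM; first exact: cvg_cst.
exact: coord_continuous.
Qed.

Definition phi (j : mode) (x : V) : R :=
  if j.2 then cos (2 * pi * dot (zvec j.1) x) else sin (2 * pi * dot (zvec j.1) x).

Lemma phi_shift k b x : phi (k, b) x =
  cos (2 * pi * dot (zvec k) x + (if b then 0 else - (pi / 2))).
Proof. by rewrite /phi/=; case: b; rewrite ?addr0// cosBpihalf. Qed.

Lemma phi_le1 j x : `|phi j x| <= 1.
Proof. by rewrite /phi; case: ifP => _; [exact: cos_max|exact: sin_max]. Qed.

Lemma continuous_cosdot k (c : R) :
  continuous (fun x : V => cos (2 * pi * dot (zvec k) x + c)).
Proof.
move=> x; apply: (@continuous_comp _ _ _ (fun x => 2 * pi * dot (zvec k) x + c) cos);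
  last exact: continuous_cos.
apply: continuousD; last exact: cst_continuous.
by apply: continuousM; [exact: cst_continuous|exact: continuous_dotr].
Qed.

Lemma continuous_phi j : continuous (phi j).
Proof.
case: j => k b; set c : R := if b then 0 else - (pi / 2).
rewrite (_ : phi _ = fun x => cos (2 * pi * dot (zvec k) x + c)); last first.
  by apply/funext => x; rewrite phi_shift.
exact: continuous_cosdot.
Qed.

Lemma measurable_phi j : measurable_fun setT (phi j).
Proof. by apply: continuous_measurable_row; exact: continuous_phi. Qed.

Lemma dot_zvec (k l : 'rV[int]_d) : exists n : int, dot (zvec k : V) (zvec l) = n%:~R.
Proof.
exists (\sum_i k 0 i * l 0 i); rewrite /dot rmorph_sum/=.
by apply: eq_bigr => i _; rewrite !mxE intrM.
Qed.

Lemma cosD2pin (x : R) (n : nat) : cos (x + 2 * pi * n%:R) = cos x.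
Proof.
elim: n => [|n IH]; first by rewrite mulr0 addr0.
rewrite -[RHS]IH -[RHS]cosD2pi; congr cos; rewrite -natr1 -mulr_natl; ring.
Qed.

Lemma cosD2piz (x : R) (n : int) : cos (x + 2 * pi * n%:~R) = cos x.
Proof.
case: n => n; first by rewrite cosD2pin.
rewrite -[LHS](cosD2pin _ n.+1) NegzE rmorphN/=; congr cos.
by rewrite -pmulrn; ring.
Qed.

Lemma periodic_phi j : Zperiodic (phi j).
Proof.
move=> x l; case: j => k b; rewrite !phi_shift dotDr.
have [n ->] := dot_zvec k l.
by rewrite -[RHS](cosD2piz _ n); congr cos; ring.
Qed.

Definition coef (f : V -> R) (j : mode) : R := \int[lebT d]_x (f x * phi j x).

Lemma integrable_phi (f : V -> R) j : (lebT d).-integrable setT (EFin \o f) ->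
  (lebT d).-integrable setT (EFin \o (fun x => f x * phi j x)).
Proof.
move=> fi; apply: (@integrable_mul_bdd _ _ _ _ _ _ _ 1) => //.
  exact: measurable_phi.
by move=> x _; exact: phi_le1.
Qed.

Theorem torus_fourier_inj (f : V -> R) : (lebT d).-integrable setT (EFin \o f) ->
  (forall j, coef f j = 0) -> {ae lebT d, forall x, f x = 0}.
Proof.
move=> fi f0.
have mf : measurable_fun setT f by case/integrableP: fi => /measurable_EFinP.
apply: ae_lebT.
  by rewrite -[X in measurable X]setTI; exact: (mf _ [set 0]).
apply: (cube_fourier_inj (integrable_lebT fi)) => k c.
rewrite -[LHS](@Rintegral_lebT _ _
  (fun x => f x * cos (2 * pi * dot (zvec k) x + c))); last first.
  have mc : measurable_fun setT (fun x : V => cos (2 * pi * dot (zvec k) x + c)).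
    by apply: continuous_measurable_row; exact: continuous_cosdot.
  by apply: (@integrable_mul_bdd _ _ _ _ _ _ _ 1) => // x _; exact: cos_max.
transitivity (\int[lebT d]_x (cos c * (f x * phi (k, true) x) +
   (- sin c) * (f x * phi (k, false) x))).
  by apply: eq_Rintegral => x _; rewrite cosD /phi/=; ring.
rewrite RintegralD//; [|by apply: integrable_scale => //; exact: integrable_phi..].
rewrite !RintegralZl//; [|exact: integrable_phi..].
by rewrite -!/(coef _ _) !f0 !mulr0 addr0.
Qed.

Definition floorv (x : V) : 'rV[int]_d := \row_i Num.floor (x 0 i).

Lemma floorv_cell (x : V) i : 0 <= (x - zvec (floorv x)) 0 i < 1.
Proof. rewrite !mxE subr_ge0 ltrBlDr floor_le /=.
by have := floorD1_gt (x 0 i); rewrite intrD addrC.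
Qed.

Lemma periodic_floor (S : Type) (f : V -> S) x : Zperiodic f ->
  f (x - zvec (floorv x)) = f x.
Proof. by move=> pf; have := pf (x - zvec (floorv x)) (floorv x); rewrite subrK => ->. Qed.

(** A nonzero value would persist on a box around the representative of the point in the fundamental
    cell, and such a box has positive measure. *)
Lemma ae0_continuous (f : V -> R) : continuous f -> Zperiodic f ->
  {ae lebT d, forall x, f x = 0} -> forall x, f x = 0.
Proof.
move=> cf pf [N [mN N0 fN]] x; apply: contrapT => /eqP; rewrite -(periodic_floor x pf).
set y := x - _ => fy.
have yc : forall i, 0 <= y 0 i < 1 by exact: floorv_cell.
have : \forall z \near y, f z != 0.
  exact: (cvgr_neq0 (f y) (cf y) fy).
move=> /nbhs_ballP[e /= e0 ef].
have := cube_box_gt0 e0 yc.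
suff -> : C [set x | forall i, (`|tnth x i - y 0 i| < e)%R] = 0%E by rewrite ltxx.
apply/eqP; rewrite eq_le measure_ge0 andbT.
have <- : C (@row_of_tuple R d @^-1` N) = 0%E by [].
apply: le_measure; rewrite ?inE.
- exact: (@measurable_cube_box _ _ (fun i => y 0 i)).
- by rewrite -[X in measurable X]setTI; apply: (@measurable_row_of_tuple R d).
- move=> z /= zy; apply: fN => /= fz; move/eqP: fz; apply/negP; apply: ef.
  by split => // i j; rewrite (ord1 i) /ball/= [row_of_tuple z 0 j]mxE distrC; exact: zy.
Qed.

Definition setc (x : V) (i : 'I_d) (s : R) : V := \row_j (if j == i then s else x 0 j).

Lemma setcE x i s : setc x i s = x + (s - x 0 i) *: delta_mx 0 i.
Proof.
apply/rowP => j; rewrite !mxE eqxx/=; case: eqVneq => [->|_].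
  by rewrite mulr1 addrC subrK.
by rewrite mulr0 addr0.
Qed.

Lemma row_updt (x : d.-tuple mR) i s :
  row_of_tuple (updt x i s) = setc (row_of_tuple x) i s.
Proof. by apply/rowP => j; rewrite !mxE tnth_mktuple; case: ifP. Qed.

Lemma Rintegral_line0 (f : V -> R) (K : R) : measurable_fun setT f ->
  (forall x, `|f x| <= K) ->
  (forall x i, measurable_fun setT (fun s : mR => f (setc x i s))) ->
  forall i, (forall x, \int[leb]_(s in `[0, 1]) f (setc x i s) = 0) ->
  \int[lebT d]_x f x = 0.
Proof.
move=> mf fK mfs i f0.
have fi : (lebT d).-integrable setT (EFin \o f) by exact: (@integrable_bdd _ _ _ _ _ _ K).
have Ki : (lebT d).-integrable setT (EFin \o (fun=> K)).
  exact: finite_measure_integrable_cst.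
(* [integral_updt] concerns nonnegative integrands; adding the bound [K] makes the integrand
   nonnegative, and the constant cancels at the end. *)
have e0 : \int[lebT d]_x (f x + K) = K.
  rewrite /Rintegral ge0_integral_lebT; last 2 first.
  - by apply/measurable_EFinP; exact: measurable_funD.
  - by move=> x; rewrite lee_fin -lerBlDr sub0r; have := fK x; rewrite ler_norml => /andP[].
  rewrite (integral_updt i)//; last 2 first.
  - by apply/measurable_EFinP/measurable_funD => //; exact: (measurableT_comp mf (@measurable_row_of_tuple R d)).
  - by move=> x; rewrite lee_fin -lerBlDr sub0r; have := fK (row_of_tuple x); rewrite ler_norml => /andP[].
  under eq_integral => x _.
    under eq_integral => s _ do rewrite row_updt.
    have fis : U01.-integrable setT (EFin \o (fun s => f (setc (row_of_tuple x) i s))).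
      exact: (@integrable_bdd _ _ _ _ _ _ K).
    rewrite (_ : integral _ _ _ = K%:E); last first.
      under eq_integral do rewrite EFinD.
      rewrite integralD_EFin//=; last exact: finite_measure_integrable_cst.
      rewrite integral_cst//= probability_setT mule1.
      rewrite -[X in (X + _)%E]fineK; last exact: integrable_fin_num.
      have := f0 (row_of_tuple x); rewrite -Rintegral_U01// /Rintegral => ->.
      by rewrite add0e.
    over.
  by rewrite integral_cst//= [X in (_ * X)%E]probability_setT mule1.
have : \int[lebT d]_x f x + K = K.
  rewrite -[RHS]e0 RintegralD//; congr (_ + _).
  by rewrite Rintegral_cst// [X in fine X]probability_setT mulr1.
by move=> h; apply: (addIr K); rewrite h add0r.
Qed.

End torus_trig.

(** * Zeros of one-dimensional trigonometric sums *)

Section trig_zeros.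
Context {R : realType}.
Local Notation CC := (complex.complex R).

Definition cis (t : R) : CC := complex.Complex (cos t) (sin t).

Lemma cisD a b : cis (a + b) = cis a * cis b.
Proof. by rewrite /cis cosD sinD; apply/eqP; rewrite eq_complex /= eqxx/= addrC mulrC [sin b * _]mulrC. Qed.

Lemma cis0 : cis 0 = 1.
Proof. by rewrite /cis cos0 sin0. Qed.

Lemma cisX t n : cis t ^+ n = cis (n%:R * t).
Proof.
elim: n => [|n IH]; first by rewrite expr0 mul0r cis0.
by rewrite exprS IH -cisD; congr cis; rewrite -natr1; ring.
Qed.

Lemma cis_neq0 t : cis t != 0.
Proof.
rewrite /cis eq_complex /=; apply/negP => /andP[/eqP c0 /eqP s0].
by have := cos2Dsin2 t; rewrite c0 s0 expr0n /= addr0 => /esym/eqP; rewrite oner_eq0.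
Qed.

Lemma cos_eq1 (y : R) : `|y| < 2 * pi -> cos y = 1 -> y = 0.
Proof.
move=> yp cy.
have {cy} s0 : sin (`|y| / 2) = 0.
  apply/eqP; rewrite -sqrf_eq0 sin2cos2.
  have := cos_mulr2n (`|y| / 2).
  rewrite (_ : _ *+ 2 = `|y|); last by rewrite -mulr_natl; field.
  by rewrite cos_norm cy -mulr_natl => h; apply/eqP; lra.
have [y0|] := ltP 0 `|y|; last by rewrite normr_le0 => /eqP.
have : 0 < sin (`|y| / 2) by apply: sin_gt0_pi; apply/andP; split; lra.
by rewrite s0 ltxx.
Qed.

Lemma cis_inj01 (s t : R) : 0 < s < 1 -> 0 < t < 1 ->
  cis (2 * pi * s) = cis (2 * pi * t) -> s = t.
Proof.
move=> /andP[s0 s1] /andP[t0 t1] [cE sE]; have p0 := pi_gt0 R.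
have : 2 * pi * s - 2 * pi * t = 0.
  apply: cos_eq1; first by rewrite ltr_norml; apply/andP; split; nra.
  by rewrite cosB cE sE -!expr2 cos2Dsin2.
by rewrite -mulrBr => /eqP; rewrite !mulf_eq0 pnatr_eq0/= gt_eqF//= subr_eq0 => /eqP.
Qed.

Lemma finite_roots (P : {poly CC}) : P != 0 -> finite_set [set z | root P z].
Proof.
move=> P0; apply: contrapT => inf; have [B BP sB] := @infinite_set_fset _ _ (size P) inf.
have aB : all (root P) (finmap.enum_fset B) by apply/allP => z zB; exact: BP.
by have := max_poly_roots P0 aB (finmap.fset_uniq _); rewrite ltnNge sB.
Qed.

(** An entry of [S] is a triple (amplitude, frequency, phase); restricting a trigonometric
    polynomial of the torus to a coordinate line produces a sum of this kind. *)
Definition tpoly (S : seq (R * int * R)) (s : R) : R :=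
  \sum_(j <- S) j.1.1 * cos (2 * pi * (j.1.2%:~R * s) + j.2).

(* Multiplying a real trigonometric sum by a power of exp(2 pi i s) turns it
   into a complex polynomial in exp(2 pi i s). *)
Lemma tpoly_dichotomy (S : seq (R * int * R)) :
  (forall s, tpoly S s = 0) \/ {ae U01, forall s, tpoly S s != 0}.
Proof.
(* [M] dominates every frequency, so the exponents M + n and M - n of the polynomial are natural
   numbers. *)
pose M := (\sum_(j <- S) `|j.1.2|)%N.
pose P : {poly CC} := \sum_(j <- S) (complex.Complex j.1.1 0) *:
  (cis j.2 *: 'X^(absz (M%:Z + j.1.2)) + cis (- j.2) *: 'X^(absz (M%:Z - j.1.2))).
have jM j : j \in S -> (`|j.1.2| <= M)%N.
  by move=> jS; rewrite /M (big_rem j)//= leq_addr.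
have PE s : P.[cis (2 * pi * s)] =
    complex.Complex (2 * tpoly S s) 0 * cis (M%:R * (2 * pi * s)).
  rewrite /P horner_sum /tpoly mulr_sumr.
  have -> : complex.Complex (\sum_(j <- S) 2 * (j.1.1 * cos (2 * pi * (j.1.2%:~R * s) + j.2))) 0 =
     \sum_(j <- S) complex.Complex (2 * (j.1.1 * cos (2 * pi * (j.1.2%:~R * s) + j.2))) 0.
    elim/big_rec2: _ => // j y1 y2 _ <-.
    by apply/eqP; rewrite eq_complex/= addr0 !eqxx.
  rewrite mulr_suml; apply: eq_big_seq => j /jM jS.
  rewrite hornerZ hornerD !hornerZ !hornerXn !cisX.
  have -> : (absz (M%:Z + j.1.2))%:R = M%:R + j.1.2%:~R :> R.
    by rewrite [LHS]pmulrn gez0_abs ?intrD//; lia.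
  have -> : (absz (M%:Z - j.1.2))%:R = M%:R - j.1.2%:~R :> R.
    by rewrite [LHS]pmulrn gez0_abs ?intrB//; lia.
  rewrite -!cisD.
  set th := 2 * pi * (j.1.2%:~R * s) + j.2.
  have -> : j.2 + (M%:R + j.1.2%:~R) * (2 * pi * s) = th + M%:R * (2 * pi * s).
    by rewrite /th; ring.
  have -> : - j.2 + (M%:R - j.1.2%:~R) * (2 * pi * s) = - th + M%:R * (2 * pi * s).
    by rewrite /th; ring.
  rewrite (cisD th) (cisD (- th)) -mulrDl [LHS]mulrA; congr (_ * _).
  rewrite -/th.
  by rewrite /cis cosN sinN; apply/eqP; rewrite eq_complex/=; apply/andP; split; apply/eqP; ring.
have [P0|P0] := eqVneq P 0.
  left => s; have := PE s; rewrite P0 horner0 => /esym/eqP.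
  rewrite mulf_eq0 (negbTE (cis_neq0 _)) orbF eq_complex/= => /andP[+ _].
  by rewrite mulf_eq0 pnatr_eq0/= => /eqP.
right; apply: ae_U01.
pose Z := [set s : R | 0 < s < 1 /\ tpoly S s = 0].
(* On the open interval exp (2 pi i s) is injective and maps the zeros of the sum to roots of
   [P]. *)
have fZ : finite_set Z.
  pose w (s : R) := cis (2 * pi * s).
  have fwZ : finite_set (w @` Z).
    apply: sub_finite_set (finite_roots P0) => _ [s [s01 ts] <-] /=.
    by rewrite /root /w PE ts mulr0 mul0r.
  suff inj : {in Z &, injective w} by rewrite -(eq_finite_set (inj_card_eq inj)).
  by move=> s t /set_mem[s01 _] /set_mem[t01 _]; exact: cis_inj01.
exists Z; split.
- rewrite (_ : Z = \bigcup_(s in Z) [set s]); first exact: fin_bigcup_measurable.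
  by apply/seteqP; split => [s Zs|s [t Zt ->]] //; exists s.
- by apply: countable_lebesgue_measure0; exact: finite_set_countable.
- by move=> s /= H; apply: contrapT => nZ; apply: H => s01; apply/eqP => ts; apply: nZ.
Qed.
End trig_zeros.

(** * Truncated Fourier series and their coefficients *)

Section torus_trunc.
Import (canonicals, coercions) finmap.
Context {R : realType} {d : nat}.
Local Notation mR := (measurableTypeR R).
Local Notation V := 'rV[R]_d.
Local Notation leb := (@lebesgue_measure R).
Local Notation mode := ('rV[int]_d * bool)%type.

Lemma dot_setc (k x : V) i s : dot k (setc x i s) = dot k x + (s - x 0 i) * k 0 i.
Proof. by rewrite setcE dotDr dotZr dot_delta. Qed.

Lemma setc_line (x : V) i s : setc x i s = setc x i 0 + s *: delta_mx 0 i.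
Proof. by apply/rowP => j; rewrite !mxE eqxx; case: eqVneq => _ /=; rewrite ?mulr1 ?mulr0 ?add0r ?addr0. Qed.

Lemma FTC2_01 (F f : R -> R) (a b : R) : a < b ->
  (forall s : R, is_derive s 1 F (f s)) -> continuous f ->
  \int[leb]_(s in `[a, b]) f s = F b - F a.
Proof.
move=> ab dF cf.
have cF : continuous F.
  by move=> s; apply: differentiable_continuous; apply/derivable1_diffP; have [] := dF s.
rewrite /Rintegral (@continuous_FTC2 _ _ F)//.
- by apply: continuous_subspaceT.
- split; [by move=> s _; have [] := dF s| |].
    by apply: cvg_at_right_filter; exact: cF.
  by apply: cvg_at_left_filter; exact: cF.
- by move=> s _; rewrite derive1E; have [_ ->] := dF s.
Qed.

Lemma int_cw0 (n : int) (c : R) : n != 0 ->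
  \int[leb]_(s in `[0, 1]) cw n c s = 0.
Proof.
move=> n0; have p0 := pi_gt0 R.
have w0 : 2 * pi * n%:~R != 0 :> R by rewrite !mulf_neq0// ?pnatr_eq0// ?intr_eq0// (gt_eqF p0).
pose w : R := 2 * pi * n%:~R.
pose F (s : R) : R := w^-1 * sin (w * s + c).
have -> : \int[leb]_(s in `[0, 1]) cw n c s = F 1 - F 0.
  apply: FTC2_01; [exact: ltr01| |exact: continuous_cw].
  move=> s.
  have d1 : is_derive s 1 (fun t : R => w * t + c) w.
    by apply: is_derive_eq; rewrite addr0 [_%:A]mulr1.
  have d2 := @is_derive1_comp _ _ _ s _ _ (is_derive_sin (w * s + c)) d1.
  have := @is_deriveZ _ _ _ _ w^-1 _ _ _ d2.
  rewrite /cw (_ : 2 * pi * (n%:~R * s) = w * s); last by rewrite /w; ring.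
  by move=> h; apply: is_derive_eq; rewrite /GRing.scale/= mulrCA mulVf// mulr1.
rewrite /F mulr1 mulr0 add0r.
have sE (x : R) : sin x = cos (x - pi / 2) by rewrite cosBpihalf.
rewrite (_ : sin (w + c) = sin c) ?subrr// !sE.
by rewrite -[RHS](cosD2piz _ n); congr cos; rewrite /w; ring.
Qed.

(** A nonzero [k] has a nonzero coordinate, and along that coordinate the integrand runs through
    whole periods. *)
Lemma int_cosdot (k : 'rV[int]_d) (c : R) :
  \int[lebT d]_x cos (2 * pi * dot (zvec k) x + c) = if k == 0 then cos c else 0.
Proof.
case: eqVneq => [->|k0].
  rewrite (_ : (fun x => _) = fun=> cos c); last first.
    apply/funext => x; rewrite (_ : zvec 0 = 0 :> V); last by apply/rowP => i; rewrite !mxE.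
    by rewrite dotC dot0r mulr0 add0r.
  by rewrite Rintegral_cst// [X in fine X]probability_setT mulr1.
have [i ki] : exists i, k 0 i != 0.
  apply: contrapT => /forallNP H; move/eqP: k0; apply; apply/rowP => i.
  by have /negP := H i; rewrite negbK mxE => /eqP.
have lineE x : (fun s : mR => cos (2 * pi * dot (zvec k) (setc x i s) + c)) =
    cw (k 0 i) (2 * pi * (dot (zvec k) x - x 0 i * (k 0 i)%:~R) + c).
  by apply/funext => s; rewrite /cw dot_setc !mxE; congr cos; ring.
apply: (@Rintegral_line0 _ _ _ 1 _ _ _ i).
- by apply: continuous_measurable_row; exact: continuous_cosdot.
- by move=> x; exact: cos_max.
- move=> x i'.
  rewrite (_ : (fun s => _) = cw (k 0 i') (2 * pi * (dot (zvec k) x - x 0 i' * (k 0 i')%:~R) + c)).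
    exact: measurable_cw.
  by apply/funext => s; rewrite /cw dot_setc !mxE; congr cos; ring.
- by move=> x; rewrite -[RHS](int_cw0 (2 * pi * (dot (zvec k) x - x 0 i * (k 0 i)%:~R) + c) ki) lineE.
Qed.

Lemma zvecD (k l : 'rV[int]_d) : zvec (k + l) = zvec k + zvec l :> V.
Proof. by apply/rowP => i; rewrite !mxE intrD. Qed.
Lemma zvecN (k : 'rV[int]_d) : zvec (- k) = - zvec k :> V.
Proof. by apply/rowP => i; rewrite !mxE mulrNz. Qed.

Definition mph (b : bool) : R := if b then 0 else - (pi / 2).

(** The second indicator appears because [k] and [-k] carry the same function up to sign. At k = l =
    0 the two terms combine to 1 for the cosine and to 0 for the sine. *)
Lemma phi_orth k b l b' : \int[lebT d]_x (phi (k, b) x * phi (l, b') x) =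
  if b == b' then 2^-1 * ((k == l)%:R + (-1) ^+ (~~ b) * (k == - l)%:R) else 0 :> R.
Proof.
transitivity (\int[lebT d]_x (2^-1 * cos (2 * pi * dot (zvec (k + l)) x + (mph b + mph b')) +
                          2^-1 * cos (2 * pi * dot (zvec (k - l)) x + (mph b - mph b')))).
  apply: eq_Rintegral => x _.
  rewrite !phi_shift -/(mph b) -/(mph b') cos_prod mulrDl ![_ / 2]mulrC.
  by rewrite !(zvecD, zvecN) dotBl dotDl; congr (_ * cos _ + _ * cos _); ring.
have ic m c : (lebT d).-integrable setT (EFin \o (fun x : V => cos (2 * pi * dot (zvec m) x + c))).
  apply: (@integrable_bdd _ _ _ _ _ _ 1) => //; last by move=> x _; exact: cos_max.
  by apply: continuous_measurable_row; exact: continuous_cosdot.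
rewrite RintegralD//; [|exact: integrable_scale..].
rewrite !RintegralZl// !int_cosdot subr_eq0 addr_eq0.
have p2 : cos (- (pi / 2)) = 0 :> R by rewrite cosN cos_pihalf.
have p2' : cos (pi / 2) = 0 :> R by rewrite cos_pihalf.
case: b; case: b' => /=; rewrite ?expr0 ?expr1 ?mul1r ?mulN1r /mph ?addr0 ?add0r ?subr0 ?sub0r ?opprK ?oppr0.
- by rewrite cos0; do 2 case: eqP => _ /=; lra.
- by rewrite p2 p2'; do 2 case: eqP => _ /=; lra.
- by rewrite p2; do 2 case: eqP => _ /=; lra.
- rewrite addNr cos0 (_ : - (pi / 2) - pi / 2 = - pi); last by field.
  by rewrite cosN cospi; do 2 case: eqP => _ /=; lra.
Qed.

Lemma phiN l b (x : V) : phi (- l, b) x = (-1) ^+ (~~ b) * phi (l, b) x.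
Proof.
rewrite /phi/= zvecN dotNl mulrN; case: b => /=; first by rewrite cosN mul1r.
by rewrite sinN expr1 mulN1r.
Qed.

Lemma coefN (f : V -> R) l b : (lebT d).-integrable setT (EFin \o f) ->
  coef f (- l, b) = (-1) ^+ (~~ b) * coef f (l, b) :> R.
Proof.
move=> fi; rewrite /coef -RintegralZl//; last exact: integrable_phi.
by apply: eq_Rintegral => x _; rewrite phiN mulrCA.
Qed.

Lemma finite_kabs N : finite_set [set k : 'rV[int]_d | (kabs k <= N)%N].
Proof.
pose g (h : {ffun 'I_d -> 'I_(N + N).+1}) : 'rV[int]_d := \row_i ((h i : nat)%:Z - N%:Z).
have : finite_set (g @` setT) by apply: finite_image; exact: finite_finset.
apply: sub_finite_set => k /= kN.
have ki i : (`|k 0%R i| <= N)%N.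
  by apply: leq_trans kN; exact: (leq_bigmax i).
exists [ffun i => inord (absz (k 0 i + N%:Z))] => //.
apply/rowP => i; rewrite mxE ffunE inordK; have := ki i; lia.
Qed.

Definition freqs N : seq 'rV[int]_d :=
  finmap.enum_fset (fset_set [set k : 'rV[int]_d | (kabs k <= N)%N]).

Lemma mem_freqs N k : (k \in freqs N) = (kabs k <= N)%N.
Proof.
rewrite /freqs -[LHS]/(k \in fset_set _) in_fset_set; last exact: finite_kabs.
by apply/idP/idP; rewrite inE.
Qed.

Lemma kabsN (k : 'rV[int]_d) : kabs (- k) = kabs k.
Proof. by apply: eq_bigr => i _; rewrite mxE abszN. Qed.

(* Both k and -k are listed, so every frequency k != 0 occurs twice; this makes up for
   the missing factor 2 in the real Fourier expansion. *)
Definition modes N : seq mode := [seq (k, b) | k <- freqs N, b <- [:: true; false]].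

Lemma big_modes N (F : mode -> R) : \sum_(j <- modes N) F j =
  \sum_(k <- freqs N) (F (k, true) + F (k, false)).
Proof.
rewrite /modes big_allpairs_dep/=; apply: eq_bigr => k _.
by rewrite !big_cons big_nil addr0.
Qed.

(** With cosine and sine coefficients a and b, the complex coefficient is a - ib, and the real part
    of its product with the character is a cos + b sin. *)
Lemma truncE N (f : V -> R) x : (lebT d).-integrable setT (EFin \o f) ->
  trunc N f x = \sum_(j <- modes N) coef f j * phi j x.
Proof.
move=> fi; rewrite big_modes /trunc fsbig_finite; last exact: finite_kabs.
rewrite (big_morph (@complex.Re R) (id1 := 0) (op1 := +%R))//; last by move=> [a b] [c e].
rewrite -/(freqs N); apply: eq_bigr => k _.
rewrite /fourier /cintegral /echar /= zvecN.
rewrite /coef /phi /=.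
rewrite -mulNr; congr (_ * _ + _ * _).
  by apply: eq_Rintegral => y _; rewrite dotNl mulrN cosN mulr0 subr0 mulrC.
rewrite -[LHS]mulN1r -RintegralZl//.
  by apply: eq_Rintegral => y _; rewrite dotNl mulrN sinN mulr0 add0r; ring.
have := @integrable_scale _ _ _ (lebT d) setT (-1) _ measurableT (integrable_phi (k, false) fi).
apply: eq_integrable => // y _ /=.
by rewrite dotNl mulrN sinN mulr0 add0r /phi/=; congr EFin; ring.
Qed.

Lemma uniq_freqs N : uniq (freqs N). Proof. exact: finmap.fset_uniq. Qed.

Lemma sum_freqs_pred N (F : 'rV[int]_d -> R) l : (kabs l <= N)%N ->
  \sum_(k <- freqs N) (F k * (k == l)%:R) = F l.
Proof.
move=> lN; rewrite (bigD1_seq l) ?mem_freqs ?uniq_freqs//= eqxx mulr1.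
by rewrite big1 ?addr0// => k /negbTE ->; rewrite mulr0.
Qed.

Lemma sum_freqs_pred0 N (F : 'rV[int]_d -> R) l : (N < kabs l)%N ->
  \sum_(k <- freqs N) (F k * (k == l)%:R) = 0.
Proof.
move=> lN; rewrite big_seq big1// => k; rewrite mem_freqs => kN.
by case: eqP => [kl|]; rewrite ?mulr0//; move: lN; rewrite -kl ltnNge kN.
Qed.

Definition tsum N (c : mode -> R) (x : V) : R := \sum_(j <- modes N) c j * phi j x.

Lemma continuous_tsum N c : continuous (tsum N c).
Proof.
move=> x; apply: (@cvg_sumR R V (nbhs x) _ _ _ (fun j z => c j * phi j z)) => j.
by apply: continuousM; [exact: cst_continuous|exact: continuous_phi].
Qed.

Lemma periodic_tsum N c : Zperiodic (tsum N c).
Proof. by move=> x k; apply: eq_bigr => j _; rewrite periodic_phi. Qed.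

Lemma trunc_tsum N (f : V -> R) : (lebT d).-integrable setT (EFin \o f) ->
  trunc N f = tsum N (coef f).
Proof. by move=> fi; apply/funext => x; rewrite truncE. Qed.

Lemma integrable_phi2 j l :
  (lebT d).-integrable setT (EFin \o (fun x : V => phi j x * phi l x)).
Proof.
apply: integrable_phi; apply: (@integrable_bdd _ _ _ _ _ _ 1) => //.
  exact: measurable_phi.
by move=> x _; exact: phi_le1.
Qed.

Lemma coef_tsum N (c : mode -> R) (l : mode) : coef (tsum N c) l =
  \sum_(j <- modes N) c j * \int[lebT d]_x (phi j x * phi l x).
Proof.
rewrite /coef /tsum; under eq_Rintegral => x _ do rewrite mulr_suml.
rewrite Rintegral_sum//; last first.
  move=> j; under [X in EFin \o X]eq_fun do rewrite -mulrA.
  by apply: integrable_scale => //; exact: integrable_phi2.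
apply: eq_bigr => j _; under eq_Rintegral => x _ do rewrite -mulrA.
by rewrite RintegralZl//; exact: integrable_phi2.
Qed.

(* Only coefficient families with the symmetries of Fourier coefficients are
   recovered, because the modes k and -k carry the same function up to sign. *)
Lemma coef_tsum_low N (c : mode -> R) (l : mode) :
  (forall k b, c (- k, b) = (-1) ^+ (~~ b) * c (k, b)) ->
  (kabs l.1 <= N)%N -> coef (tsum N c) l = c l.
Proof.
case: l => l b' cN /= lN; rewrite coef_tsum big_modes.
transitivity (\sum_(k <- freqs N) (2^-1 * c (k, b') * (k == l)%:R) +
  \sum_(k <- freqs N) (2^-1 * (-1) ^+ (~~ b') * c (k, b') * (k == - l)%:R)).
  rewrite -big_split; apply: eq_bigr => k _; rewrite !phi_orth.
  by case: b' => /=; rewrite ?expr0 ?expr1; ring.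
rewrite !sum_freqs_pred ?kabsN// cN.
by case: b' => /=; rewrite ?expr0 ?expr1; lra.
Qed.

Lemma coef_tsum_high N (c : mode -> R) (l : mode) :
  (N < kabs l.1)%N -> coef (tsum N c) l = 0.
Proof.
case: l => l b' /= lN; rewrite coef_tsum big_modes.
transitivity (\sum_(k <- freqs N) (2^-1 * c (k, b') * (k == l)%:R) +
  \sum_(k <- freqs N) (2^-1 * (-1) ^+ (~~ b') * c (k, b') * (k == - l)%:R)).
  rewrite -big_split; apply: eq_bigr => k _; rewrite !phi_orth.
  by case: b' => /=; rewrite ?expr0 ?expr1; ring.
by rewrite !sum_freqs_pred0 ?kabsN// addr0.
Qed.

Lemma mem_modes N j : j \in modes N -> (kabs j.1 <= N)%N.
Proof. by move=> /allpairsP[[k b] [/= + _ ->]]; rewrite mem_freqs. Qed.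

Lemma coef_trunc_low N (f : V -> R) (l : mode) : (lebT d).-integrable setT (EFin \o f) ->
  (kabs l.1 <= N)%N -> coef (trunc N f) l = coef f l.
Proof.
move=> fi lN; rewrite trunc_tsum// coef_tsum_low// => k b.
exact: coefN.
Qed.

Lemma coef_trunc_high N (f : V -> R) (l : mode) : (lebT d).-integrable setT (EFin \o f) ->
  (N < kabs l.1)%N -> coef (trunc N f) l = 0.
Proof. by move=> fi lN; rewrite trunc_tsum// coef_tsum_high. Qed.

Lemma phi_setc (j : mode) (x : V) i (s : R) : phi j (setc x i s) =
  cos (2 * pi * ((j.1 0 i)%:~R * s) +
       (2 * pi * (dot (zvec j.1) x - x 0 i * (j.1 0 i)%:~R) + mph j.2)).
Proof. by case: j => k b; rewrite phi_shift dot_setc !mxE; congr cos; rewrite /mph /=; ring. Qed.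

Lemma tsum_setc N c (x : V) i (s : R) : tsum N c (setc x i s) =
  tpoly [seq (c j, j.1 0 i, 2 * pi * (dot (zvec j.1) x - x 0 i * (j.1 0 i)%:~R) + mph j.2)
        | j <- modes N] s.
Proof.
by rewrite /tpoly big_map; apply: eq_bigr => j _; rewrite phi_setc.
Qed.

(** On each coordinate line the function is a one-dimensional trigonometric sum, so the two
    dichotomies, on lines and on the cube, combine. *)
Lemma tsum_dichotomy N c : {ae lebT d, forall x, tsum N c x != 0} \/
  (forall x, tsum N c x = 0).
Proof.
have mf := @continuous_measurable_row R d _ (@continuous_tsum N c).
have mf0 : measurable [set x | tsum N c x != 0].
  rewrite (_ : mkset _ = setT `&` (tsum N c @^-1` (~` [set 0]))).
    by apply: mf => //; exact: measurableC.
  rewrite setTI; apply/seteqP; split => x /=; first by move=> /eqP.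
  by move=> H; apply/eqP.
pose f := tsum N c \o @row_of_tuple R d.
have [||H|H] := @cube_zero_dichotomy R d f.
- exact: (measurableT_comp mf (@measurable_row_of_tuple R d)).
- move=> x i; rewrite /f /=.
  have [H|H] := tpoly_dichotomy
    [seq (c j, j.1 0 i, 2 * pi * (dot (zvec j.1) (row_of_tuple x) -
          (row_of_tuple x) 0 i * (j.1 0 i)%:~R) + mph j.2) | j <- modes N].
    by left => s; rewrite row_updt tsum_setc; exact: H.
  right; move: H; apply: filterS; first exact: (ae_filter_ringOfSetsType (@U01 R)).
  by move=> s Hs; rewrite row_updt tsum_setc; exact: Hs.
- by left; exact: ae_lebT.
- right => x; have := H [tuple x 0 i | i < d]; rewrite /f /= => <-.
  by congr tsum; apply/rowP => i; rewrite mxE tnth_mktuple.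
Qed.

End torus_trunc.

(** * Differential calculus on the torus *)

Section directional.
Context {R : realType} {W : normedModType R}.
Implicit Types (f : W -> R) (x v w : W).

Lemma line_deriveW f (a v : W) (s : R) : derivable f (a + s *: v) v ->
  is_derive s 1 (fun t : R => f (a + t *: v)) ('D_v f (a + s *: v)).
Proof.
move=> df.
have E : (fun h : R => h^-1 *: (f (a + (h *: 1 + s) *: v) - f (a + s *: v))) =
         (fun h : R => h^-1 *: (f (h *: v + (a + s *: v)) - f (a + s *: v))).
  apply/funext => h; congr (_ *: (f _ - _)).
  by rewrite scalerDl [h *: 1]mulr1 addrCA.
have df' : derivable (fun t : R => f (a + t *: v)) s 1.
  by rewrite /derivable /= E.
by apply: DeriveDef => //; rewrite /derive /= E.
Qed.

Lemma derive_line f x v (l : R) :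
  is_derive (0 : R) (1 : R) (fun t : R => f (x + t *: v)) l -> is_derive x v f l.
Proof.
move=> [df dl].
have E : (fun h : R => h^-1 *: (f (x + (h *: (1 : R) + 0) *: v) - f (x + (0 : R) *: v))) =
         (fun h : R => h^-1 *: (f (h *: v + x) - f x)).
  apply/funext => h; rewrite scale0r addr0 [h *: 1]mulr1 addr0.
  by congr (_ *: (f _ - _)); rewrite addrC.
have df' : derivable f x v.
  by move: df; rewrite /derivable /= E.
by apply: DeriveDef => //; move: dl; rewrite /derive /= E.
Qed.

Lemma derive_dirZ f x v (c : R) : derivable f x v ->
  is_derive x (c *: v) f (c * 'D_v f x).
Proof.
move=> df; apply: derive_line.
have d1 : is_derive (c * 0) (1 : R) (fun t : R => f (x + t *: v)) ('D_v f x).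
  have := @line_deriveW f x v 0; rewrite mulr0 scale0r addr0; exact.
have d2 : is_derive (0 : R) (1 : R) (fun t : R => c * t) c.
  by apply: is_derive_eq; rewrite [_%:A]mulr1.
rewrite (_ : (fun t : R => f (x + t *: (c *: v))) =
  (fun t : R => f (x + t *: v)) \o (fun t : R => c * t)); last first.
  by apply/funext => t /=; rewrite scalerA [t * c]mulrC.
by apply: is_derive_eq; rewrite mulrC.
Qed.

Lemma line_MVT f x v (t : R) : (forall y, derivable f y v) ->
  exists2 c : R, `|c| <= `|t| & f (x + t *: v) - f x = t * 'D_v f (x + c *: v).
Proof.
move=> df.
have dg s : is_derive (s : R) (1 : R) (fun t : R => f (x + t *: v)) ('D_v f (x + s *: v)).
  exact: line_deriveW.
have cg : continuous (fun t : R => f (x + t *: v)).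
  by move=> s; apply: differentiable_continuous; apply/derivable1_diffP; have [] := dg s.
have [t0|t0|<-] := ltgtP 0 t.
- have [|c] := @MVT _ _ _ 0 t t0 (fun s _ => dg s).
    exact: continuous_subspaceT.
  rewrite in_itv/= => /andP[c0 ct]; rewrite scale0r addr0 subr0 => ->.
  by exists c; [rewrite !gtr0_norm// ltW|rewrite mulrC].
- have [|c] := @MVT _ _ _ t 0 t0 (fun s _ => dg s).
    exact: continuous_subspaceT.
  rewrite in_itv/= => /andP[c0 ct]; rewrite scale0r addr0 sub0r => E.
  exists c; first by rewrite !ltr0_norm// lerN2 ltW.
  by rewrite -[LHS]opprB E; ring.
- by exists 0; rewrite ?normr0// scale0r addr0 subrr mul0r.
Qed.

(** No Frechet derivative is involved. The increment along v + w splits into one along [v] from [x]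
    and one along [w] from a displaced point; the mean value theorem and continuity of the
    derivative along [w] handle the second. *)
Lemma derive_dirD f x v w : (forall y, derivable f y v) -> (forall y, derivable f y w) ->
  {for x, continuous (fun y => 'D_w f y)} ->
  is_derive x (v + w) f ('D_v f x + 'D_w f x).
Proof.
move=> dv dw cw.
have cv : (fun t : R => t^-1 *: (f (t *: (v + w) + x) - f x)) @ 0^' -->
    'D_v f x + 'D_w f x.
  have -> : (fun t : R => t^-1 *: (f (t *: (v + w) + x) - f x)) =
    (fun t => t^-1 *: (f (t *: v + x) - f x) +
              t^-1 *: (f ((t *: v + x) + t *: w) - f (t *: v + x))).
    apply/funext => t; rewrite -scalerDr; congr (_ *: _).
    by rewrite scalerDr addrAC [RHS]addrC subrKA.
  apply: cvgD; first exact: dv.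
  apply/cvgrPdist_lt => e e0.
  move/cvgrPdist_lt: cw => /(_ e e0) /nbhs_ballP[r /= r0 rP].
  near=> t.
  have [c ct ->] := line_MVT (t *: v + x) t dw.
  have t0 : t != 0 by near: t; exact: nbhs_dnbhs_neq.
  rewrite /GRing.scale /= mulKf//; apply: rP.
  rewrite -ball_normE /ball_/= opprD addrA opprD addrCA subrr addr0.
  rewrite -opprD normrN (le_lt_trans (ler_normD _ _))// !normrZ.
  apply: (@le_lt_trans _ _ (`|t| * (`|v| + `|w|))).
    by rewrite mulrDr lerD2l ler_wpM2r.
  apply: (@le_lt_trans _ _ (`|t| * (`|v| + `|w| + 1))).
    by rewrite ler_wpM2l// lerDl.
  rewrite -ltr_pdivlMr ?ltr_wpDl ?addr_ge0//.
  near: t; apply: dnbhs0_lt; rewrite divr_gt0// ltr_wpDl ?addr_ge0//.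
have d : derivable f x (v + w) by apply/cvg_ex; exists ('D_v f x + 'D_w f x).
by apply: DeriveDef => //; apply: cvg_lim => //; exact: Rhausdorff.
Unshelve. all: by end_near. Qed.

Lemma Cn_continuous n f : Cn n f -> continuous f.
Proof. by case: n => [//|n []]. Qed.

Lemma Cn_derivable n f x v : Cn n.+1 f -> derivable f x v.
Proof. by move=> [_ /(_ v)[]]. Qed.

Lemma Cn_derive n f v : Cn n.+1 f -> Cn n (fun x => 'D_v f x).
Proof. by move=> [_ /(_ v)[]]. Qed.

Lemma Cn_le m n f : (m <= n)%N -> Cn n f -> Cn m f.
Proof.
elim: m n f => [|m IH] [|n] f // mn; first by move=> [].
move=> Cf; split; first exact: Cn_continuous Cf.
move=> v; split; first by move=> x; exact: Cn_derivable Cf.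
by apply: (IH n) => //; exact: Cn_derive.
Qed.

End directional.

(** * Gradients, integration by parts and the Laplacian on the torus *)

Section torus_calculus.
Context {R : realType} {d : nat}.
Local Notation V := 'rV[R]_d.
Local Notation leb := (@lebesgue_measure R).
Local Notation mode := ('rV[int]_d * bool)%type.

Lemma row_sum_delta (v : V) : v = \sum_i v 0 i *: delta_mx 0 i.
Proof.
apply/rowP => j; rewrite summxE (bigD1 j)//= !mxE !eqxx mulr1 big1 ?addr0// => i ij.
by rewrite !mxE eqxx eq_sym (negbTE ij) mulr0.
Qed.

Lemma derive_grad (f : V -> R) x v : Cn 1 f -> is_derive x v f (dot (grad f x) v).
Proof.
move=> Cf; rewrite {1}(row_sum_delta v).
have -> : dot (grad f x) v = \sum_i v 0 i * pderiv i f x.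
  by apply: eq_bigr => i _; rewrite mxE mulrC.
elim: (index_enum _) => [|i s IH].
  rewrite !big_nil; apply: DeriveDef; first exact: derivable0.
  exact: derive0.
rewrite !big_cons; apply: is_derive_eq.
  apply: derive_dirD.
  - by move=> y; exact: Cn_derivable Cf.
  - by move=> y; exact: Cn_derivable Cf.
  - by have := Cn_continuous (Cn_derive (\sum_(j <- s) v 0 j *: delta_mx 0 j) Cf); apply.
have d1 : derivable f x (delta_mx 0 i) by exact: Cn_derivable Cf.
have [_ ->] := derive_dirZ (v 0 i) d1.
by congr (_ + _); have [_ ->] := IH.
Qed.

Lemma periodic_derive (f : V -> R) v : Zperiodic f -> Zperiodic (fun x => 'D_v f x).
Proof.
move=> pf x k.
have E : (fun h : R => h^-1 *: (f (h *: v + (x + zvec k)) - f (x + zvec k))) =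
         (fun h : R => h^-1 *: (f (h *: v + x) - f x)).
  by apply/funext => h; rewrite addrA !pf.
by rewrite /derive E.
Qed.

(** The closed cube is compact, unlike [cell], and still meets every class modulo Z^d; bounds for
    periodic functions are taken on it. *)
Definition cubeV : set V := [set x : V | forall i, `[0, 1]%classic (x 0 i)].

Lemma compact_cubeV : compact cubeV.
Proof. by apply: (@rV_compact R d (fun=> `[0, 1]%classic)) => i; exact: segment_compact. Qed.

Lemma cubeV_floor (x : V) : cubeV (x - zvec (floorv x)).
Proof. by move=> i; rewrite /= in_itv/=; have /andP[-> /ltW ->] := floorv_cell x i. Qed.

Lemma bounded_periodic (f : V -> R) : continuous f -> Zperiodic f ->
  exists K : R, forall x, `|f x| <= K.
Proof.
move=> cf pf.
have /compact_bounded[K [_ KP]] : compact (f @` cubeV).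
  by apply: continuous_compact; [exact: continuous_subspaceT|exact: compact_cubeV].
exists (K + 1) => x; rewrite -(periodic_floor x pf).
apply: KP; first by rewrite ltrDl.
by exists (x - zvec (floorv x)) => //; exact: cubeV_floor.
Qed.

Lemma integrable_continuous (f : V -> R) : continuous f -> Zperiodic f ->
  (lebT d).-integrable setT (EFin \o f).
Proof.
move=> cf pf; have [K fK] := bounded_periodic cf pf.
by apply: (@integrable_bdd _ _ _ _ _ _ K) => //; exact: continuous_measurable_row.
Qed.

(** On each line in direction [i] the integral is a difference of values at points that differ by a
    lattice vector. *)
Lemma int_pderiv0 (f : V -> R) i : Zperiodic f -> (forall x, derivable f x (delta_mx 0 i)) ->
  continuous (pderiv i f) -> \int[lebT d]_x pderiv i f x = 0.
Proof.
move=> pf df cf; have pp := @periodic_derive f (delta_mx 0 i) pf.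
have [K fK] := bounded_periodic cf pp.
have csetc x j : continuous (fun s : R => setc x j s).
  move=> s; under eq_fun do rewrite setc_line.
  apply: (@cvgD _ _ _ (nbhs s)); first exact: cvg_cst.
  by apply: cvgZr_tmp; exact: cvg_id.
apply: (@Rintegral_line0 _ _ _ K _ _ _ i) => //.
- exact: continuous_measurable_row.
- move=> x j; apply: continuous_measurable_fun => s.
  by apply: continuous_comp; [exact: csetc|exact: cf].
- move=> x.
  have -> : \int[leb]_(s in `[0, 1]) pderiv i f (setc x i s) =
      f (setc x i 1) - f (setc x i 0).
    apply: (@FTC2_01 R (fun s => f (setc x i s))) => //.
    - move=> s; have := @line_deriveW R V f (setc x i 0) (delta_mx 0 i) s (df _).
      by under eq_fun do rewrite -setc_line; rewrite -setc_line.
    - by move=> s; apply: continuous_comp; [exact: csetc|exact: cf].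
  rewrite setc_line scale1r.
  have -> : delta_mx 0 i = zvec (delta_mx 0 i) :> V.
    by apply/rowP => j; rewrite !mxE; case: (_ && _).
  by rewrite pf subrr.
Qed.

Lemma phi_derive k b (x v : V) : is_derive x v (phi (k, b))
  ((-1) ^+ b * (2 * pi * dot (zvec k) v) * phi (k, ~~ b) x).
Proof.
apply: derive_line.
pose w : R := 2 * pi * dot (zvec k) v.
pose c : R := 2 * pi * dot (zvec k) x.
have E (t : R) : 2 * pi * dot (zvec k) (x + t *: v) = w * t + c.
  by rewrite dotDr dotZr /w /c; ring.
have d1 : is_derive (0 : R) (1 : R) (fun t : R => w * t + c) w.
  by apply: is_derive_eq; rewrite addr0 [_%:A]mulr1.
case: b => /=.
- rewrite (_ : (fun t => _) = cos \o (fun t => w * t + c)); last first.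
    by apply/funext => t; rewrite /phi /= E.
  have D := @is_derive1_comp _ _ _ (0 : R) _ _ (is_derive_cos _) d1.
  suff <- : - sin (w * 0 + c) * w = (-1) ^+ 1 * w * phi (k, false) x by [].
  by rewrite /phi/= mulr0 add0r -/c; ring.
- rewrite (_ : (fun t => _) = sin \o (fun t => w * t + c)); last first.
    by apply/funext => t; rewrite /phi /= E.
  have D := @is_derive1_comp _ _ _ (0 : R) _ _ (is_derive_sin _) d1.
  suff <- : cos (w * 0 + c) * w = (-1) ^+ 0 * w * phi (k, true) x by [].
  by rewrite /phi/= mulr0 add0r -/c; ring.
Qed.

(** The factor [c] strengthens the induction: a derivative of a mode is a multiple of the conjugate
    mode. *)
Lemma Cn_phiZ n (j : mode) (c : R) : Cn n (fun x : V => c * phi j x).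
Proof.
elim: n j c => [|n IH] j c /=.
  by move=> x; apply: continuousM; [exact: cst_continuous|exact: continuous_phi].
split.
  by move=> x; apply: continuousM; [exact: cst_continuous|exact: continuous_phi].
case: j => k b v.
have D x : is_derive x v (fun x : V => c * phi (k, b) x)
    (c * ((-1) ^+ b * (2 * pi * dot (zvec k) v) * phi (k, ~~ b) x)).
  exact: (is_deriveZ c (phi_derive k b x v)).
split; first by move=> x; have [] := D x.
rewrite (_ : (fun x => _) = (fun x => (c * ((-1) ^+ b * (2 * pi * dot (zvec k) v))) * phi (k, ~~ b) x)).
  exact: IH.
by apply/funext => x; have [_ ->] := D x; rewrite mulrA.
Qed.

Lemma Cn_phi n (j : mode) : Cn n (phi j : V -> R).
Proof.
have := Cn_phiZ n j 1; congr Cn; by apply/funext => x; rewrite mul1r.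
Qed.

(** The eigenvalue of minus the Laplacian on the mode [j]. *)
Definition lam (j : mode) : R := (2 * pi) ^+ 2 * dot (zvec j.1 : V) (zvec j.1).

Lemma pderiv_phi k b i (x : V) : pderiv i (phi (k, b)) x =
  (-1) ^+ b * (2 * pi * (k 0 i)%:~R) * phi (k, ~~ b) x.
Proof.
by rewrite /pderiv; have [_ ->] := phi_derive k b x (delta_mx 0 i); rewrite dot_delta mxE.
Qed.

Lemma pderivZ i c (f : V -> R) x : derivable f x (delta_mx 0 i) ->
  pderiv i (fun y => c * f y) x = c * pderiv i f x.
Proof. by move=> df; have [_ E] := is_deriveZ c (DeriveDef df (erefl ('D_(delta_mx 0 i) f x))); exact: E. Qed.

Lemma pderiv2_phi (j : mode) i (x : V) : pderiv i (pderiv i (phi j)) x =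
  - (2 * pi * (j.1 0 i)%:~R) ^+ 2 * phi j x.
Proof.
case: j => k b; rewrite (_ : pderiv i (phi (k, b)) = (fun x =>
  (-1) ^+ b * (2 * pi * (k 0 i)%:~R) * phi (k, ~~ b) x)); last first.
  by apply/funext => y; rewrite pderiv_phi.
rewrite pderivZ; last exact: Cn_derivable (Cn_phi 1 _).
by rewrite pderiv_phi negbK; case: b => /=; rewrite ?expr0 ?expr1; ring.
Qed.

Lemma lap_phi (j : mode) (x : V) : lap (phi j) x = - lam j * phi j x.
Proof.
rewrite /lap /mxtrace; under eq_bigr do rewrite mxE pderiv2_phi.
rewrite -mulr_suml; congr (_ * _); rewrite /lam /dot mulr_sumr -sumrN.
by apply: eq_bigr => i _; rewrite !mxE; ring.
Qed.

Lemma int_pderiv_phi (f : V -> R) (j : mode) i : Zperiodic f -> continuous f ->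
  (forall x, derivable f x (delta_mx 0 i)) -> continuous (pderiv i f) ->
  \int[lebT d]_x (pderiv i f x * phi j x) = - \int[lebT d]_x (f x * pderiv i (phi j) x).
Proof.
move=> pf cf df cdf.
have dp x : derivable (phi j : V -> R) x (delta_mx 0 i) by exact: Cn_derivable (Cn_phi 1 _).
have cp : continuous (pderiv i (phi j : V -> R)) by have := Cn_derive (delta_mx 0 i) (Cn_phi 1 j).
have E : pderiv i (fun x => f x * phi j x) =
    (fun x => pderiv i f x * phi j x + f x * pderiv i (phi j) x).
  apply/funext => x; rewrite /pderiv.
  have -> := @deriveM _ _ f (phi j) x (delta_mx 0 i) (df x) (dp x).
  by rewrite /GRing.scale /= addrC mulrC; congr (_ + _); rewrite mulrC.
have cE : continuous (fun x => pderiv i f x * phi j x + f x * pderiv i (phi j) x).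
  move=> x; apply: (@continuousD _ _ _ (fun x => pderiv i f x * phi j x)
    (fun x => f x * pderiv i (phi j) x)); apply: continuousM.
  - exact: cdf.
  - exact: continuous_phi.
  - exact: cf.
  - exact: cp.
have i1 : (lebT d).-integrable setT (EFin \o (fun x => pderiv i f x * phi j x)).
  apply: integrable_phi; apply: integrable_continuous => //.
  exact: periodic_derive.
have i2 : (lebT d).-integrable setT (EFin \o (fun x => f x * pderiv i (phi j) x)).
  apply: integrable_continuous.
    by move=> x; apply: continuousM; [exact: cf|exact: cp].
  by move=> x k; rewrite pf /pderiv (periodic_derive _ (@periodic_phi _ _ j)).
have := @int_pderiv0 (fun x => f x * phi j x) i.
rewrite E RintegralD// => H; apply/eqP; rewrite -addr_eq0; apply/eqP; apply: H.
- by move=> x k; rewrite pf periodic_phi.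
- by move=> x; exact: derivableM.
- by [].
Qed.

Lemma coef_lap (f : V -> R) (j : mode) : Zperiodic f -> Cn 2 f ->
  coef (lap f) j = - lam j * coef f j.
Proof.
move=> pf Cf; rewrite /coef /lap /mxtrace.
have Cd i : Cn 1 (pderiv i f) by exact: Cn_derive.
have pd i : Zperiodic (pderiv i f) by exact: periodic_derive.
have cf := Cn_continuous Cf.
under eq_Rintegral => x _.
  under eq_bigr do rewrite mxE.
  rewrite mulr_suml; over.
have cdd i : continuous (pderiv i (pderiv i f)).
  exact: (Cn_continuous (Cn_derive (delta_mx 0 i) (Cd i))).
rewrite Rintegral_sum//; last first.
  move=> i; apply: integrable_phi; apply: integrable_continuous; first exact: cdd.
  exact: periodic_derive (pd i).
transitivity (\sum_(i < d) (- (2 * pi * (j.1 0 i)%:~R) ^+ 2 * coef f j)).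
  apply: eq_bigr => i _.
  rewrite int_pderiv_phi//; last first.
  - by move=> x; exact: Cn_derivable (Cd i).
  - exact: Cn_continuous (Cd i).
  (* The first integration by parts produces the conjugate mode [(k, ~~ b)]; the second one returns
     to [(k, b)]. *)
  case: j => k b /=.
  transitivity (- ((-1) ^+ b * (2 * pi * (k 0 i)%:~R)) *
     \int[lebT d]_x (pderiv i f x * phi (k, ~~ b) x)).
    rewrite mulNr -RintegralZl//; last first.
      apply: integrable_phi; apply: integrable_continuous => //.
      exact: Cn_continuous (Cd i).
    by congr (- _); apply: eq_Rintegral => x _; rewrite pderiv_phi; ring.
  have ci : continuous (pderiv i f) by exact: Cn_continuous (Cd i).
  rewrite int_pderiv_phi//; last first.
    by move=> x; exact: Cn_derivable Cf.
  rewrite mulrNN /coef -RintegralZl//; last first.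
    apply: integrable_continuous.
      move=> x; apply: continuousM; [exact: cf|].
      exact: (Cn_continuous (Cn_derive (delta_mx 0 i) (Cn_phi 1 (k, ~~ b)))).
    by move=> x l; rewrite pf /pderiv (periodic_derive _ (@periodic_phi _ _ _)).
  rewrite -RintegralZl//; last first.
    by apply: integrable_phi; exact: integrable_continuous.
  apply: eq_Rintegral => x _; rewrite pderiv_phi negbK.
  by case: b => /=; rewrite ?expr0 ?expr1; ring.
rewrite -mulr_suml; congr (_ * _); rewrite /lam /dot mulr_sumr -sumrN.
by apply: eq_bigr => i _; rewrite !mxE; ring.
Qed.

End torus_calculus.

(** * Convex duality between the Hamiltonian and the Lagrangian *)

Section slices.
Context {R : realType} {W1 W2 : normedModType R}.
Implicit Types (f : W1 * W2 -> R).

Lemma quotient_slice f x p v : (fun h : R => h^-1 *: (f (x, h *: v + p) - f (x, p))) =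
  (fun h : R => h^-1 *: (f (h *: (0, v) + (x, p)) - f (x, p))).
Proof.
apply/funext => h; congr (_ *: (f _ - _)).
by transitivity (h *: (0 : W1) + x, h *: v + p) => //; rewrite scaler0 add0r.
Qed.

Lemma derive_slice f x p v : 'D_v (fun p => f (x, p)) p = 'D_(0, v) f (x, p).
Proof. by rewrite /derive quotient_slice. Qed.

Lemma derivable_slice f x p v : derivable f (x, p) (0, v) ->
  derivable (fun p => f (x, p)) p v.
Proof. by rewrite /derivable quotient_slice. Qed.

Lemma continuous_slice f x : continuous f -> continuous (fun p => f (x, p)).
Proof.
move=> cf p; apply: (@continuous_comp _ _ _ (fun p => (x, p)) f); last exact: cf.
by apply: cvg_pair; [exact: cvg_cst|exact: cvg_id].
Qed.

Lemma continuous_pair_l (p : W2) : continuous (fun x : W1 => (x, p)).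
Proof. by move=> x; apply: cvg_pair; [exact: cvg_id|exact: cvg_cst]. Qed.

Lemma continuous_fst_pair (p : W2) : continuous (fun z : W1 * W2 => (z.1, p)).
Proof. by move=> z; apply: cvg_pair; [exact: cvg_fst|exact: cvg_cst]. Qed.

Lemma continuousNB f (g : W1 * W2 -> R) : continuous f -> continuous g ->
  continuous (fun z => - f z - g z).
Proof.
by move=> cf cg z; apply: cvgB; [apply: cvgN; exact: cf|exact: cg].
Qed.

Lemma Cn_slice n f x : Cn n f -> Cn n (fun p => f (x, p)).
Proof.
elim: n f => [|n IH] f; first exact: continuous_slice.
move=> [cf Cf]; split; first exact: continuous_slice.
move=> v; have [df /IH Dv] := Cf (0, v); split.
  by move=> p; apply: derivable_slice.
rewrite (_ : (fun p => _) = (fun p => 'D_(0, v) f (x, p))); first exact: Dv.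
by apply/funext => p; rewrite derive_slice.
Qed.

End slices.

(** * Measurability of compositions with functions of two vectors *)

Section pack.
Context {R : realType} {d : nat}.
Local Notation V := 'rV[R]_d.

Definition unpack (y : 'rV[R]_(d + d)) : V * V := (lsubmx y, rsubmx y).

Lemma continuous_unpack : continuous unpack.
Proof.
have cl : continuous (@lsubmx R 1 d d).
  move=> y A /nbhs_ballP[e /= e0 eA]; apply/nbhs_ballP; exists e => // z [_ zy].
  by apply: eA; split => // i j; rewrite !mxE; exact: zy.
have cr : continuous (@rsubmx R 1 d d).
  move=> y A /nbhs_ballP[e /= e0 eA]; apply/nbhs_ballP; exists e => // z [_ zy].
  by apply: eA; split => // i j; rewrite !mxE; exact: zy.
by move=> y; exact: (cvg_pair (cl y) (cr y)).
Qed.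

(** The hypothesis on [K] concerns the product topology, whereas measurability on pairs refers to
    the product sigma-algebra. Packing the pair into a single row of length d + d reduces both to
    the Borel sets of one space. *)
Lemma measurable_lsc_comp d' (T : measurableType d') (D : set T) (K : V * V -> R)
    (f g : T -> V) : measurable D -> (forall c, open [set z | c < K z]) ->
  measurable_fun D f -> measurable_fun D g ->
  measurable_fun D (fun t => K (f t, g t)).
Proof.
move=> mD lK mf mg.
have mK : measurable_fun setT (K \o unpack).
  apply: lsc_measurable_row => c.
  rewrite (_ : mkset _ = unpack @^-1` [set z | c < K z])//.
  apply: open_comp; last exact: lK.
  by move=> x _; exact: continuous_unpack.
have mfg : measurable_fun D (fun t => row_mx (f t) (g t)).
  apply: measurable_rowP => // i; case: (splitP i) => j ij.
    rewrite (_ : (fun x => _) = (fun x => f x 0 j)).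
      exact: (measurableT_comp (measurable_coord j)).
    by apply/funext => t; rewrite (_ : i = lshift d j) ?row_mxEl//; exact/val_inj.
  rewrite (_ : (fun x => _) = (fun x => g x 0 j)).
    exact: (measurableT_comp (measurable_coord j)).
  by apply/funext => t; rewrite (_ : i = rshift d j) ?row_mxEr//; exact/val_inj.
rewrite (_ : (fun t => _) = (K \o unpack) \o (fun t => row_mx (f t) (g t))).
  exact: (measurableT_comp mK).
by apply/funext => t /=; rewrite /unpack row_mxKl row_mxKr.
Qed.

Lemma measurable_continuous_comp d' (T : measurableType d') (D : set T) (K : V * V -> R)
    (f g : T -> V) : measurable D -> continuous K ->
  measurable_fun D f -> measurable_fun D g ->
  measurable_fun D (fun t => K (f t, g t)).
Proof.
move=> mD cK; apply: measurable_lsc_comp => // c.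
rewrite (_ : mkset _ = K @^-1` [set y | c < y])//; apply: open_comp; last exact: open_gt.
by move=> x _; exact: cK.
Qed.

End pack.

(** * Strong convexity of the Hamiltonian and Fenchel duality *)

Section hamiltonian.
Context {R : realType} {d : nat}.
Local Notation V := 'rV[R]_d.
Variables (H : V -> V -> R) (CH : R).
Hypothesis H2 : Cn 2 (fun z : V * V => H z.1 z.2).
Hypothesis CH0 : 0 < CH.
Hypothesis Hconv : forall x p xi : V, CH^-1 * dot xi xi <= dot (xi *m hess (H x) p) xi.
Hypothesis H_torus : forall p, Zperiodic (fun x => H x p).

Lemma Cn2_H x : Cn 2 (H x).
Proof. exact: (@Cn_slice R V V 2 (fun z => H z.1 z.2) x). Qed.

Definition gH (x p : V) : V := grad (H x) p.

Lemma gH_coordE i (z : V * V) : gH z.1 z.2 0 i = 'D_(0, delta_mx 0 i) (fun z : V * V => H z.1 z.2) z.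
Proof.
case: z => x p; rewrite mxE /pderiv /=.
exact: (@derive_slice R V V (fun z => H z.1 z.2) x p).
Qed.

Lemma continuous_gH_coord i : continuous (fun z : V * V => gH z.1 z.2 0 i).
Proof.
rewrite (_ : (fun z => _) = (fun z => 'D_(0, delta_mx 0 i) (fun z : V * V => H z.1 z.2) z)).
  by apply: (@Cn_continuous _ _ 1); exact: Cn_derive.
by apply/funext => z; exact: gH_coordE.
Qed.

Lemma dot_hess x p v :
  is_derive p v (fun p => dot (gH x p) v) (dot (v *m hess (H x) p) v).
Proof.
have C1 j : Cn 1 (pderiv j (H x)) by apply: Cn_derive; exact: Cn2_H.
have D j : is_derive p v (fun p => v 0 j * pderiv j (H x) p)
    (v 0 j * dot (grad (pderiv j (H x)) p) v).
  by apply: (is_deriveZ (v 0 j)); apply: derive_grad.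
have := @is_derive_sum _ _ _ _ (fun j : 'I_d => fun p => v 0 j * pderiv j (H x) p) p v _ D.
move=> D'.
rewrite (_ : (fun p => dot (gH x p) v) = \sum_(j < d) (fun p => v 0 j * pderiv j (H x) p)); last first.
  by apply/funext => y; rewrite fct_sumE; apply: eq_bigr => j _; rewrite mxE mulrC.
rewrite (_ : dot _ _ = \sum_(j < d) v 0 j * dot (grad (pderiv j (H x)) p) v)//.
apply: eq_bigr => j _; rewrite mxE mulrC; congr (_ * _).
by apply: eq_bigr => i _; rewrite !mxE mulrC.
Qed.

(** Two mean value arguments on the segment: the Hessian bound controls the growth of the
    directional derivative, which in turn controls the value. *)
Lemma H_strong_convex x p p' :
  H x p + dot (gH x p) (p' - p) + (2 * CH)^-1 * dot (p' - p) (p' - p) <= H x p'.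
Proof.
set v := p' - p.
have C2 := Cn2_H x; have C1 := Cn_le (leqnSn 1) C2.
have dg (s : R) : is_derive s (1 : R) (fun t : R => H x (p + t *: v)) (dot (gH x (p + s *: v)) v).
  have [df E] := @derive_grad R d (H x) (p + s *: v) v C1.
  by rewrite /gH -E; exact: line_deriveW.
have dg' (s : R) : is_derive s (1 : R) (fun t : R => dot (gH x (p + t *: v)) v)
    (dot (v *m hess (H x) (p + s *: v)) v).
  have [df E] := dot_hess x (p + s *: v) v.
  by rewrite -E; exact: (@line_deriveW _ _ (fun p => dot (gH x p) v)).
have cont (f df : R -> R) (a b : R) : (forall s : R, is_derive s (1 : R) f (df s)) ->
    {within `[a, b], continuous f}.
  move=> D; apply: continuous_subspaceT => s.
  by apply: differentiable_continuous; apply/derivable1_diffP; have [] := D s.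
set c := CH^-1 * dot v v.
have G1 (s : R) : 0 <= s -> s * c <= dot (gH x (p + s *: v)) v - dot (gH x p) v.
  rewrite le_eqVlt => /predU1P[<-|s0]; first by rewrite mul0r scale0r addr0 subrr.
  have [t _] := @MVT _ _ _ 0 s s0 (fun s _ => dg' s) (cont _ _ _ _ dg').
  rewrite scale0r addr0 => ->; rewrite subr0 mulrC.
  by apply: ler_wpM2r; [exact: ltW|exact: Hconv].
(* The tangent and the quadratic lower bound are subtracted, so that [G1] says precisely that [psi]
   has nonnegative derivative. *)
pose psi (t : R) := H x (p + t *: v) - (t * dot (gH x p) v + t ^+ 2 * (c / 2)).
have dpsi (s : R) : is_derive s (1 : R) psi
    (dot (gH x (p + s *: v)) v - (dot (gH x p) v + s * c)).
  have dq : is_derive s (1 : R)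
      (fun t : R => t * dot (gH x p) v + t ^+ 2 * (c / 2)) (dot (gH x p) v + s * c).
    by apply: is_derive_eq; rewrite /GRing.scale/=; field.
  exact: is_deriveB (dg s) dq.
have [t] := @MVT _ _ _ 0 1 ltr01 (fun s _ => dpsi s) (cont _ _ _ _ dpsi).
rewrite in_itv/= => /andP[t0 t1]; rewrite subr0 mulr1 => E.
have : 0 <= psi 1 - psi 0 by rewrite E opprD addrA subr_ge0 G1// ltW.
rewrite /psi scale1r scale0r addr0 mul0r expr0n mul0r expr1n !mul1r addr0 subr0.
rewrite (_ : p + v = p'); last by rewrite /v addrC subrK.
have -> : (2 * CH)^-1 * dot v v = c / 2 by rewrite /c invfM; ring.
by lra.
Qed.

Lemma norm_coord_le (a : V) i : `|a 0 i| <= `|a|.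
Proof. by rewrite [leRHS]mx_normE; exact: (le_bigmax _ (fun ij => `|a ij.1 ij.2|%:nng) (0, i)). Qed.

Lemma dot_norm_le (a : V) (K : R) : (forall i, `|a 0 i| <= K) -> dot a a <= d%:R * K ^+ 2.
Proof.
move=> aK; rewrite mulr_natl -[X in _ *+ X]card_ord -sumr_const.
apply: ler_sum => i _; rewrite -expr2 -[_ ^+ 2]ger0_norm ?sqr_ge0// normrX.
by rewrite lerXn2r ?nnegrE// (le_trans _ (aK i)).
Qed.

Variable L : V -> V -> R.
Hypothesis LH : fenchel_pair L H.

Lemma fenchel_ge x a p : - dot a p - H x p <= L x a.
Proof.
rewrite -lee_fin LH.2; apply: ereal_sup_ubound; by exists p.
Qed.

Lemma fenchel_le x a B : (forall p, - dot a p - H x p <= B) -> L x a <= B.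
Proof.
move=> h; rewrite -lee_fin LH.2; apply: ge_ereal_sup => _ [p _ <-].
by rewrite lee_fin.
Qed.

(** Convexity puts the graph of [H x] above its tangent at [p], so [p] attains the supremum that
    defines the Lagrangian at minus the gradient. *)
Lemma fenchel_feedback x p : L x (- gH x p) = dot (gH x p) p - H x p.
Proof.
apply/eqP; rewrite eq_le; apply/andP; split; last first.
  by have := fenchel_ge x (- gH x p) p; rewrite dotNl opprK.
apply: fenchel_le => p'; rewrite dotNl opprK.
have := H_strong_convex x p p'; rewrite dotBr.
have : 0 <= (2 * CH)^-1 * dot (p' - p) (p' - p).
  by rewrite mulr_ge0 ?dot_ge0// invr_ge0 mulr_ge0// ltW.
by lra.
Qed.

(** Equality makes [p] a minimum point of [H x] plus the linear function given by [a]; the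
    conclusion is the first-order condition in each coordinate. *)
Lemma fenchel_eq x a p : L x a = - dot a p - H x p -> a = - gH x p.
Proof.
move=> E; apply/rowP => i; rewrite [RHS]mxE.
pose g (t : R) := H x (p + t *: delta_mx 0 i) + t * a 0 i.
have C1 := Cn_le (leqnSn 1) (Cn2_H x).
have dg (s : R) : is_derive s (1 : R) g (gH x (p + s *: delta_mx 0 i) 0 i + a 0 i).
  have d1 : is_derive s (1 : R) (fun t : R => H x (p + t *: delta_mx 0 i))
      (gH x (p + s *: delta_mx 0 i) 0 i).
    have := @line_deriveW _ _ (H x) p (delta_mx 0 i) s.
    by rewrite /gH mxE; apply; exact: Cn_derivable C1.
  have d2 : is_derive s (1 : R) (fun t : R => t * a 0 i) (a 0 i).
    by apply: is_derive_eq; rewrite /GRing.scale/=; ring.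
  exact: is_deriveD d1 d2.
have gmin t : g 0 <= g t.
  have := fenchel_ge x a (p + t *: delta_mx 0 i).
  rewrite E dotDr dotZr dot_delta /g scale0r addr0 mul0r addr0; lra.
have [_ E0] : is_derive (0 : R) (1 : R) g 0.
  apply: (@derive1_at_min _ g (-1) 1 0).
  - by rewrite lerNl (le_trans _ ler01)// lerNl oppr0.
  - by move=> t _; have [] := dg t.
  - by rewrite in_itv/= ltrN10 ltr01.
  - by move=> t _; exact: gmin.
have [_] := dg 0; rewrite E0 scale0r addr0 => /esym/eqP.
by rewrite addrC addr_eq0 => /eqP.
Qed.

Lemma H_periodic x k : H (x + zvec k) = H x.
Proof. by apply/funext => p; exact: H_torus. Qed.

(** The choice p = 0 bounds the supremum from below; from above, the quadratic growth of the
    Hamiltonian around p = 0 absorbs the linear term. *)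
Lemma fenchel_bounded (K : R) : exists B : R, forall x a, `|a| <= K -> `|L x a| <= B.
Proof.
have cH : continuous (fun x => H x 0).
  move=> x; apply: (@continuous_comp _ _ _ (fun x : V => (x, 0 : V)) (fun z => H z.1 z.2)).
    exact: continuous_pair_l.
  exact: (Cn_continuous H2).
have [B1 hB1] := bounded_periodic cH (H_torus 0).
have [B2 hB2] : exists B2 : R, forall x i, `|gH x 0 0 i| <= B2.
  have : forall i, exists B2 : R, forall x, `|gH x 0 0 i| <= B2.
    move=> i; apply: bounded_periodic; last by move=> x k; rewrite /gH H_periodic.
    move=> x; apply: (@continuous_comp _ _ _ (fun x : V => (x, 0 : V)) (fun z => gH z.1 z.2 0 i)).
      exact: continuous_pair_l.
    exact: continuous_gH_coord.
  move=> /choice[b hb]; exists (\sum_i `|b i|) => x i.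
  apply: (le_trans (hb i x)); rewrite (bigD1 i)//= (le_trans (ler_norm _))// lerDl.
  exact: sumr_ge0.
(* With b the gradient at p = 0, completing the square gives CH / 2 times |a + b|^2 as the largest
   value of -(a + b).p - |p|^2 / (2 CH); the other factor bounds |a + b|^2. *)
pose B3 := CH / 2 * (d%:R * (K + B2) ^+ 2).
exists (B1 + `|B3|) => x a aK; rewrite ler_norml; apply/andP; split.
  have := fenchel_ge x a 0; rewrite dot0r oppr0 sub0r; apply: le_trans.
  by have := hB1 x; rewrite ler_norml => /andP[_]; have := normr_ge0 B3; lra.
apply: (@le_trans _ _ (B1 + B3)); last by rewrite lerD2l ler_norm.
apply: fenchel_le => p.
have := H_strong_convex x 0 p; rewrite subr0.
set b := gH x 0 => Hp.
have : dot (a + b) (a + b) <= d%:R * (K + B2) ^+ 2.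
  apply: dot_norm_le => i; rewrite mxE (le_trans (ler_normD _ _))// lerD ?hB2//.
  exact: le_trans (norm_coord_le _ _) aK.
move=> q2.
have q1 : 0 <= (2 * CH)^-1 * dot p p + dot (a + b) p + CH / 2 * dot (a + b) (a + b).
  have -> : (2 * CH)^-1 * dot p p + dot (a + b) p + CH / 2 * dot (a + b) (a + b) =
     (2 * CH)^-1 * dot (p + CH *: (a + b)) (p + CH *: (a + b)).
    rewrite dotDl !(dotDr p) dotDr !dotZl !dotZr [dot p (a + b)]dotC.
    by field; rewrite gt_eqF.
  by rewrite mulr_ge0 ?dot_ge0// invr_ge0 mulr_ge0// ltW.
have q3 : CH / 2 * dot (a + b) (a + b) <= B3 by rewrite /B3; apply: ler_wpM2l; [rewrite divr_ge0// ltW|exact: q2].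
have := hB1 x; rewrite ler_norml => /andP[h1 _].
by move: q1; rewrite dotDl => q1; lra.
Qed.

(** A superlevel set of a supremum is the union of the superlevel sets of its members, here
    continuous functions of (x, a). *)
Lemma open_fenchel c : open [set z : V * V | c < L z.1 z.2].
Proof.
rewrite (_ : mkset _ = \bigcup_p [set z : V * V | c < - dot z.2 p - H z.1 p]).
  apply: bigcup_open => p _.
  rewrite (_ : mkset _ = (fun z : V * V => - dot z.2 p - H z.1 p) @^-1` [set y | c < y])//.
  apply: open_comp; last exact: open_gt.
  move=> z _; apply: (@continuousNB R V V (fun z => dot z.2 p) (fun z => H z.1 p)).
    move=> {}z; under eq_fun do rewrite dotC.
    by apply: (@continuous_comp _ _ _ snd (dot p)); [exact: cvg_snd|exact: continuous_dotr].
  move=> {}z.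
  apply: (@continuous_comp _ _ _ (fun z : V * V => (z.1, p)) (fun z => H z.1 z.2)).
    exact: continuous_fst_pair.
  exact: (Cn_continuous H2).
apply/seteqP; split => z /=.
  move=> cL; apply: contrapT => nz; move: cL; rewrite ltNge => /negP; apply.
  apply: fenchel_le => p; rewrite leNgt; apply/negP => h; apply: nz.
  by exists p.
by move=> [p _]/= /lt_le_trans; apply; exact: fenchel_ge.
Qed.

End hamiltonian.

(** * Functionals of measures with densities *)

Section densities.
Context {R : realType} {d : nat}.
Local Notation V := 'rV[R]_d.

Lemma L2norm_le (f : V -> R) (k : R) : 0 <= k -> measurable_fun setT f ->
  (forall x, `|f x| <= k) -> (L2norm f <= k%:E)%E.
Proof.
move=> k0 mf fk; rewrite /L2norm unlock.
have -> : k%:E = ((k ^+ 2)%:E `^ 2^-1)%E.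
  by rewrite poweR_EFin -powR_mulrn// -powRrM mulfV// powRr1.
apply: gt0_ler_poweR; rewrite ?invr_ge0 ?in_itv/= ?leey ?andbT//.
- by apply: integral_ge0 => x _; rewrite lee_fin powR_ge0.
- by rewrite lee_fin sqr_ge0.
have -> : (k ^+ 2)%:E = (\int[lebT d]_x (cst (k ^+ 2)%:E x))%E.
  rewrite integral_cst// -[LHS]mule1; congr (_ * _)%E; exact/esym/probability_setT.
apply: ge0_le_integral => //.
- apply/measurable_EFinP; apply: (@measurableT_comp _ _ _ _ _ _ (@powR R ^~ 2)) => //.
  exact: measurableT_comp.
- by move=> x _; rewrite /= -powR_mulrn// lee_fin; apply: ge0_ler_powR; rewrite ?nnegrE.
Qed.

(** Hoelder's inequality against the constant 1, which has norm 1 for a probability. *)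
Lemma L1_le_L2 (f : V -> R) : measurable_fun setT f ->
  (\int[lebT d]_x `|f x|%:E <= L2norm f)%E.
Proof.
move=> mf.
have := @hoelder _ _ _ (lebT d) f (cst 1) 2 2 mf (measurable_cst _).
move=> /(_ (ltr0n _ 2) (ltr0n _ 2)).
rewrite (_ : 2^-1 + 2^-1 = 1 :> R); last by field.
move=> /(_ erefl); rewrite Lnorm1 Lnorm_cst1 [X in (X `^ _)%E]probability_setT.
rewrite poweR1r mule1; apply: le_trans.
by under [leRHS]eq_integral do rewrite /= mulr1.
Qed.

Lemma in_L2_integrable (f : V -> R) : in_L2 f -> (lebT d).-integrable setT (EFin \o f).
Proof.
move=> [mf _ fL]; apply/integrableP; split; first exact/measurable_EFinP.
exact: le_lt_trans (L1_le_L2 mf) fL.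
Qed.

Lemma density_integrable (mu : PT R d) (f : V -> R) : has_density mu f ->
  (lebT d).-integrable setT (EFin \o f).
Proof.
move=> [mf _ f0 E]; apply/integrableP; split; first exact/measurable_EFinP.
have := E _ measurableT; rewrite [LHS]probability_setT => E1.
rewrite (ae_eq_integral (EFin \o f))//= -?E1 ?ltry//.
  by do 2 apply: measurableT_comp => //.
  exact/measurable_EFinP.
by apply: filterS f0 => x fx _ /=; rewrite ger0_norm.
Qed.

Lemma density_dominates (mu : PT R d) (f : V -> R) : has_density mu f ->
  PT_prob mu `<< lebT d.
Proof.
move=> [mf _ f0 E]; apply/null_content_dominatesP => A mA A0.
rewrite E//; apply: null_set_integral => //.
exact/measurable_EFinP/measurable_funTS.
Qed.

(** [has_density] speaks of measures of sets; the passage to integrals uses the Radon-Nikodym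
    derivative, identified with [f] almost everywhere through its integrals over measurable sets. *)
Lemma integral_density (mu : PT R d) (f g : V -> R) (K : R) : has_density mu f ->
  measurable_fun setT g -> (forall x, `|g x| <= K) ->
  \int[mu]_x g x = \int[lebT d]_x (g x * f x).
Proof.
move=> hf mg gK; have fi := density_integrable hf.
have dom := density_dominates hf.
have [mf _ f0 E] := hf.
have gi : (PT_prob mu).-integrable setT (EFin \o g).
  exact: (@integrable_bdd _ _ _ _ _ _ K).
rewrite /Rintegral -(Radon_Nikodym_change_of_variables dom measurableT gi).
congr fine; apply: ae_eq_integral => //.
- apply: emeasurable_funM; first exact/measurable_EFinP.
  by apply: (measurable_int (lebT d)); exact: Radon_Nikodym_integrable.
- exact/measurable_EFinP/measurable_funM.
have : ae_eq (lebT d) setT (Radon_Nikodym (charge_of_finite_measure (PT_prob mu)) (lebT d)) (EFin \o f).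
  apply: integral_ae_eq => //.
  - exact: Radon_Nikodym_integrable.
  - exact/measurable_EFinP.
  - move=> A _ mA; rewrite -E// -Radon_Nikodym_integral//.
by apply: filterS => x Hx _ /=; rewrite Hx.
Qed.

End densities.

Lemma lipschitz_within {R : realType} (f : R -> R) (a b K : R) :
  (forall s t, s \in `[a, b] -> t \in `[a, b] -> `|f s - f t| <= K * `|s - t|) ->
  {within `[a, b], continuous f}.
Proof.
move=> fK; apply/subspace_continuousP => t tab; apply/cvgrPdist_lt => e e0.
rewrite near_withinE; near=> s => sab.
rewrite (le_lt_trans (fK _ _ _ _))//.
apply: (@le_lt_trans _ _ ((`|K| + 1) * `|t - s|)).
  by rewrite ler_wpM2r// (le_trans (ler_norm _))// lerDl.
rewrite mulrC -ltr_pdivlMr ?ltr_wpDl//.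
by near: s; apply/nbhs_ballP; exists (e / (`|K| + 1)) => //=; rewrite divr_gt0// ltr_wpDl.
Unshelve. all: by end_near. Qed.

(** * Mixtures of measures *)

Section mixtures.
Context {R : realType} {d : nat}.
Local Notation V := 'rV[R]_d.

Lemma dens_density (f : V -> R) : is_density f -> has_density (dens f) f.
Proof. by move=> [mu hmu]; rewrite /dens; case: xgetP => [nu _ //|/(_ mu)]. Qed.

(** [mix] is defined by choice, so a convex combination has to be exhibited as a probability carried
    by the cell before [mix] has its intended meaning. *)
Lemma mix_exists (t : R) (mu nu : PT R d) : 0 <= t <= 1 ->
  exists rho : PT R d, forall A, measurable A ->
    rho A = (t%:E * mu A + (1 - t)%:E * nu A)%E.
Proof.
move=> /andP[t0 t1].
have t1' : 0 <= 1 - t by rewrite subr_ge0.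
pose m := measure_add (mscale (NngNum t0) (PT_prob mu)) (mscale (NngNum t1') (PT_prob nu)).
have mE A : m A = (t%:E * mu A + (1 - t)%:E * nu A)%E by rewrite /m measure_addE.
have m1 : m setT = 1%E.
  rewrite mE (@probability_setT _ _ _ mu) (@probability_setT _ _ _ nu) !mule1 -EFinD.
  by congr EFin; rewrite addrC subrK.
pose H1 := Measure_isProbability.Build _ _ _ m m1.
pose P : probability V R := HB.pack_for (probability V R) (Measure.sort m) H1.
have Pc : P cell = 1%E.
  have := mE cell; rewrite (PT_cell mu) (PT_cell nu) !mule1 -EFinD.
  by rewrite (_ : t + (1 - t) = 1)//; rewrite addrC subrK.
by exists (MkPT Pc) => A mA; exact: mE.
Qed.

Lemma mixE (t : R) (mu nu : PT R d) A : 0 <= t <= 1 -> measurable A ->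
  mix t mu nu A = (t%:E * mu A + (1 - t)%:E * nu A)%E.
Proof.
move=> t01 mA; rewrite /mix; case: xgetP => [rho _ ->//|].
by have [rho hrho] := mix_exists mu nu t01 => /(_ rho).
Qed.

Lemma mix_density (t : R) (mu nu : PT R d) (f g : V -> R) : 0 <= t <= 1 ->
  has_density mu f -> has_density nu g ->
  has_density (mix t mu nu) (fun x => t * f x + (1 - t) * g x).
Proof.
move=> t01 hf hg; have [t0 t1] := andP t01.
have fi := density_integrable hf; have gi := density_integrable hg.
case: hf hg => [mf pf f0 fE] [mg pg g0 gE]; split.
- by apply: measurable_funD; apply: measurable_funM.
- by move=> x k; rewrite pf pg.
- by apply: filterS2 f0 g0 => x fx gx; rewrite addr_ge0// mulr_ge0// subr_ge0.
move=> A mA; rewrite mixE// fE// gE//.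
have fiA : (lebT d).-integrable A (EFin \o f) by apply: integrableS fi.
have giA : (lebT d).-integrable A (EFin \o g) by apply: integrableS gi.
rewrite -!integralZl// -integralD//; exact: integrableZl.
Qed.

End mixtures.

(** * Consequences of the linear derivative for densities *)

Section linear_derivative.
Context {R : realType} {d : nat}.
Local Notation V := 'rV[R]_d.
Local Notation leb := (@lebesgue_measure R).
Variables (q : nat) (F : PT R d -> R) (dF : PT R d -> V -> R).
Hypothesis F_C1 : C1_with_deriv F dF.
Hypothesis dF_Cq : derivative_Cq q dF.
Hypothesis dF_lip : derivative_L2_lipschitz dF.

Lemma dF_continuous mu : continuous (dF mu).
Proof. by case: dF_Cq => /(_ mu) /Cn_continuous. Qed.

Lemma dF_periodic mu : Zperiodic (dF mu).
Proof. by case: F_C1. Qed.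

Lemma dF_bounded : exists2 K : R, 0 <= K & forall mu x, `|dF mu x| <= K.
Proof.
case: dF_Cq => _ [K hK]; exists `|K| => // mu x; apply: le_trans (ler_norm K).
rewrite -lee_fin; apply: le_trans (hK mu); rewrite /supnorm.
apply: (@le_trans _ _ (ereal_sup [set `|dF mu x|%:E | x in [set: V]])).
  by apply: ereal_sup_ubound; exists x.
rewrite leeDl// sume_ge0// => i _.
apply: (@le_trans _ _ (nabla_norm i (dF mu) 0)%:E); first by rewrite lee_fin sqrtr_ge0.
by apply: ereal_sup_ubound; exists 0.
Qed.

Section two_densities.
Variables (mu nu : PT R d) (f g : V -> R) (B : R).
Hypothesis (hf : has_density mu f) (hg : has_density nu g).
Hypothesis (fgB : forall x, `|f x - g x| <= B).
Hypothesis cf : exists K : R, forall x, `|f x| <= K.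
Hypothesis cg : exists K : R, forall x, `|g x| <= K.

Let B0 : 0 <= B. Proof. exact: le_trans (fgB 0). Qed.
Let mf : measurable_fun setT f. Proof. by case: hf. Qed.
Let mg : measurable_fun setT g. Proof. by case: hg. Qed.
Let fi := density_integrable hf.
Let gi := density_integrable hg.

Let lin_L2 t : in_L2 (fun x : V => t * f x + (1 - t) * g x).
Proof.
split.
- by apply: measurable_funD; apply: measurable_funM.
- by case: hf => _ pf _ _; case: hg => _ pg _ _ x k; rewrite pf pg.
have [Kf fK] := cf; have [Kg gK] := cg.
apply: (@le_lt_trans _ _ (`|t| * Kf + `|1 - t| * Kg)%:E); last exact: ltry.
apply: L2norm_le.
- have := fK 0; have := gK 0 => h1 h2.
  by rewrite addr_ge0// mulr_ge0// (le_trans _ h1, le_trans _ h2).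
- by apply: measurable_funD; apply: measurable_funM.
- by move=> x; rewrite (le_trans (ler_normD _ _))// !normrM lerD// ler_wpM2l.
Qed.

(** Two densities on the segment differ by (s - t)(f - g), so (FG.3) becomes a Lipschitz bound in
    the parameter. Measures enter only through their densities, so that iterated mixtures are
    covered. *)
Lemma dF_mix_lip : exists2 K : R, 0 < K & forall (P Q : PT R d) (s t : R) x,
  has_density P (fun x => s * f x + (1 - s) * g x) ->
  has_density Q (fun x => t * f x + (1 - t) * g x) ->
  `|dF P x - dF Q x| <= K * (`|s - t| * B).
Proof.
case: dF_lip => K [K0 hK]; exists K => // P Q s t x hP hQ.
rewrite -lee_fin; apply: le_trans (hK P Q _ _ hP (lin_L2 s) hQ (lin_L2 t) x) _.
rewrite EFinM; apply: lee_wpmul2l; first by rewrite lee_fin ltW.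
apply: L2norm_le.
- by rewrite mulr_ge0.
- by apply: measurable_funB; apply: measurable_funD; apply: measurable_funM.
- move=> y /=.
  rewrite (_ : _ - _ = (s - t) * (f y - g y)); last by ring.
  by rewrite normrM ler_wpM2l.
Qed.

Lemma integral_fgE (h : V -> R) : continuous h -> Zperiodic h ->
  \int[mu]_x h x - \int[nu]_x h x = \int[lebT d]_x (h x * (f x - g x)).
Proof.
move=> ch ph; have [K hK] := bounded_periodic ch ph.
have mh := continuous_measurable_row ch.
rewrite (integral_density hf mh hK) (integral_density hg mh hK) -RintegralB//.
- by apply: eq_Rintegral => x _; rewrite mulrBr.
- under [X in EFin \o X]eq_fun do rewrite mulrC.
  by apply: (@integrable_mul_bdd _ _ _ _ _ _ _ K).
- under [X in EFin \o X]eq_fun do rewrite mulrC.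
  by apply: (@integrable_mul_bdd _ _ _ _ _ _ _ K).
Qed.

Lemma integrable_dF_fg P : (lebT d).-integrable setT (EFin \o (fun x => dF P x * (f x - g x))).
Proof.
have [K K0 hK] := dF_bounded.
apply: (@integrable_bdd _ _ _ _ _ _ (K * B)) => //.
  apply: measurable_funM; last exact: measurable_funB.
  by apply: continuous_measurable_row; exact: dF_continuous.
by move=> x _; rewrite normrM ler_pM.
Qed.

Lemma dF_fg_lip : exists2 K : R, 0 <= K & forall (P Q : PT R d) (s t : R),
  has_density P (fun x => s * f x + (1 - s) * g x) ->
  has_density Q (fun x => t * f x + (1 - t) * g x) ->
  `|\int[lebT d]_x (dF P x * (f x - g x)) - \int[lebT d]_x (dF Q x * (f x - g x))|
    <= K * `|s - t|.
Proof.
have [K K0 hK] := dF_mix_lip; exists (K * B * B).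
  by rewrite !mulr_ge0// ltW.
move=> P Q s t hP hQ; rewrite -RintegralB//; [|exact: integrable_dF_fg..].
apply: le_trans (le_normr_Rintegral _ _) _ => //.
  by apply: integrable_subR => //; exact: integrable_dF_fg.
have -> : K * B * B * `|s - t| = \int[lebT d]_x (K * B * B * `|s - t|).
  by rewrite Rintegral_cst// [X in fine X]probability_setT mulr1.
apply: le_Rintegral => //.
- by apply: integrable_norm; apply: integrable_subR => //; exact: integrable_dF_fg.
- exact: finite_measure_integrable_cst.
- move=> x _; rewrite -mulrBl normrM.
  apply: (@le_trans _ _ (K * (`|s - t| * B) * B)); last by rewrite le_eqVlt; apply/orP; left; apply/eqP; ring.
  by apply: ler_pM => //; exact: hK.
Qed.

(** The direction [f - g] stays fixed when [P] is itself a mixture of [mu] and [nu]; the resulting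
    scale factor is made explicit in [F_mixE]. *)
Let Phi (P : PT R d) (t : R) : R := \int[lebT d]_x (dF (mix t P nu) x * (f x - g x)).

Let mixmix_density (e t : R) : 0 <= e <= 1 -> 0 <= t <= 1 ->
  has_density (mix t (mix e mu nu) nu) (fun x => (t * e) * f x + (1 - t * e) * g x).
Proof.
move=> e01 t01; have := mix_density t01 (mix_density e01 hf hg) hg.
by congr has_density; apply/funext => x; ring.
Qed.

Let Phi_continuous e : 0 <= e <= 1 -> {within `[0, 1], continuous (Phi (mix e mu nu))}.
Proof.
move=> e01; have [K K0 hK] := dF_fg_lip.
apply: (@lipschitz_within _ _ _ _ K) => s t; rewrite !in_itv/= => s01 t01.
apply: le_trans (hK _ _ _ _ (mixmix_density e01 s01) (mixmix_density e01 t01)) _.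
rewrite ler_wpM2l// -mulrBl normrM ler_piMr//.
by case/andP: e01 => e0 e1; rewrite ger0_norm.
Qed.

Let Phi_integrable e : 0 <= e <= 1 ->
  leb.-integrable `[0, 1] (EFin \o Phi (mix e mu nu)).
Proof.
by move=> e01; apply: continuous_compact_integrable;
  [exact: segment_compact|exact: Phi_continuous].
Qed.

Let F_mixE e : 0 <= e <= 1 ->
  F (mix e mu nu) - F nu = e * \int[leb]_(t in `[0, 1]) Phi (mix e mu nu) t.
Proof.
move=> e01; case: F_C1 => _ _ _ -> _.
rewrite -RintegralZl//; last exact: Phi_integrable.
apply: eq_Rintegral => t _; set m := mix t _ _.
have he := mix_density e01 hf hg.
have [K hK] := bounded_periodic (@dF_continuous m) (@dF_periodic m).
have mh := continuous_measurable_row (@dF_continuous m).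
rewrite (integral_density he mh hK) (integral_density hg mh hK) -RintegralB//; last 2 first.
- under [X in EFin \o X]eq_fun do rewrite mulrC.
  by apply: (@integrable_mul_bdd _ _ _ _ _ _ _ K) => //; exact: density_integrable he.
- under [X in EFin \o X]eq_fun do rewrite mulrC.
  by apply: (@integrable_mul_bdd _ _ _ _ _ _ _ K).
rewrite /Phi -/m -RintegralZl//; last exact: integrable_dF_fg.
by apply: eq_Rintegral => x _; ring.
Qed.

(** Convexity bounds F(mix e) - F(nu) by e (F(mu) - F(nu)), while the linear derivative writes it as
    e times an average of [Phi]. That average is at least A - K e by the Lipschitz bound; division
    by e and the limit e -> 0 conclude. *)
Lemma convex_first_order : convexPT F ->
  \int[lebT d]_x (dF nu x * (f x - g x)) <= F mu - F nu.
Proof.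
move=> Fc; have [K K0 hK] := dF_fg_lip.
set A := \int[lebT d]_x _.
have nu0 : has_density nu (fun x => 0 * f x + (1 - 0) * g x).
  by have := hg; congr has_density; apply/funext => x; ring.
have step e : 0 < e <= 1 -> A - K * e <= F mu - F nu.
  move=> /andP[e0 e1]; have e01 : 0 <= e <= 1 by rewrite ltW.
  have := Fc e mu nu e01 => cvx.
  have E := F_mixE e01.
  have : A - K * e <= \int[leb]_(t in `[0, 1]) Phi (mix e mu nu) t.
    have -> : A - K * e = \int[leb]_(t in `[0, 1]) (A - K * e).
      by rewrite Rintegral_cst//= lebesgue_measure_itv/= lte_fin ltr01 sube0 mulr1.
    apply: le_Rintegral => //.
    - by apply: continuous_compact_integrable;
        [exact: segment_compact|apply: continuous_subspaceT; exact: cst_continuous].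
    - exact: Phi_integrable.
    move=> t; rewrite /= in_itv/= => t01.
    have := hK _ _ _ _ (mixmix_density e01 t01) nu0.
    rewrite subr0 -/A -/(Phi _ _) => H.
    have : K * `|t * e| <= K * e.
      case/andP: t01 => t0 t1.
      have te0 : 0 <= t * e by rewrite mulr_ge0// ltW.
      by apply: ler_wpM2l => //; rewrite ger0_norm// ler_piMl// ltW.
    by move: H; rewrite ler_norml => /andP[H _] H'; lra.
  set J := \int[leb]_(t in `[0, 1]) _ in E * => AJ.
  have : e * J <= e * (F mu - F nu) by rewrite -E; lra.
  by rewrite ler_pM2l//; exact: le_trans.
apply/ler_addgt0Pr => e e0.
(* An admissible parameter with [K * e' <= e]; the denominator is [K + 1] because [K] may be 0. *)
pose e' := Num.min 1 (e / (K + 1)).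
have K1 : 0 < K + 1 by rewrite ltr_wpDl.
have e'0 : 0 < e' by rewrite lt_min ltr01 divr_gt0.
have := step e' _; rewrite e'0 ge_min lexx /= => /(_ isT).
have : K * e' <= e.
  apply: (@le_trans _ _ ((K + 1) * e')); first by apply: ler_wpM2r; [exact: ltW|rewrite lerDl].
  by rewrite mulrC -ler_pdivlMr// ge_min lexx orbT.
by lra.
Qed.

(** A bound on the derivative along the segment from [nu] to [mu]; this yields continuity of F and G
    along truncated flows. *)
Lemma C1_lipschitz K : (forall m x, `|dF m x| <= K) -> `|F mu - F nu| <= K * B.
Proof.
move=> hK.
have mix1 : has_density mu (fun x => 1 * f x + (1 - 1) * g x).
  by have := hf; congr has_density; apply/funext => x; ring.
have c1 : {within `[0, 1], continuous (Phi mu)}.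
  have [K' K0 hK'] := dF_fg_lip.
  apply: (@lipschitz_within _ _ _ _ K') => s t; rewrite !in_itv/= => s01 t01.
  exact: hK' (mix_density s01 hf hg) (mix_density t01 hf hg).
have Pi : leb.-integrable `[0, 1] (EFin \o Phi mu).
  by apply: continuous_compact_integrable; [exact: segment_compact|].
case: F_C1 => _ _ _ -> _.
have -> : \int[leb]_(t in `[0, 1]) (\int[mu]_x dF (mix t mu nu) x - \int[nu]_x dF (mix t mu nu) x)
   = \int[leb]_(t in `[0, 1]) Phi mu t.
  apply: eq_Rintegral => t _; rewrite integral_fgE//.
    exact: dF_continuous.
  exact: dF_periodic.
apply: le_trans (le_normr_Rintegral _ Pi) _ => //.
have -> : K * B = \int[leb]_(t in `[0, 1]) (K * B).
  by rewrite Rintegral_cst//= lebesgue_measure_itv/= lte_fin ltr01 sube0 mulr1.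
apply: le_Rintegral => //.
- exact: integrable_norm.
- by apply: continuous_compact_integrable;
    [exact: segment_compact|apply: continuous_subspaceT; exact: cst_continuous].
move=> t _; rewrite /Phi.
apply: le_trans (le_normr_Rintegral _ (integrable_dF_fg _)) _ => //.
have -> : K * B = \int[lebT d]_x (K * B).
  by rewrite Rintegral_cst// [X in fine X]probability_setT mulr1.
apply: le_Rintegral => //.
- by apply: integrable_norm; exact: integrable_dF_fg.
- exact: finite_measure_integrable_cst.
- by move=> x _; rewrite normrM ler_pM.
Qed.

End two_densities.
End linear_derivative.

(** * Integration in time *)

Section bounded_fubini.
Context d1 d2 (T1 : measurableType d1) (T2 : measurableType d2) (R : realType).
Variables (P : probability T1 R) (Q : probability T2 R) (k : T1 * T2 -> R) (K : R).
Hypothesis (mk : measurable_fun setT k) (kK : forall z, `|k z| <= K).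

Let ki : (P \x Q)%E.-integrable setT (EFin \o k).
Proof.
apply: measurable_bounded_integrable => //.
  have : (product_measure1 P Q (setT `*` setT) < +oo)%E.
    by rewrite product_measure1E// [X in (X * _)%E]probability_setT [X in (_ * X)%E]probability_setT mule1 ltry.
  by rewrite setXTT.
exists K; split; first exact: num_real.
by move=> y Ky x _; exact: le_trans (kK x) (ltW Ky).
Qed.

Let k1 x : Q.-integrable setT (EFin \o (fun y => k (x, y))).
Proof.
apply: (@integrable_bdd _ _ _ _ _ _ K) => //.
exact: measurableT_comp mk (measurable_pair1 x).
Qed.

Let k2 y : P.-integrable setT (EFin \o (fun x => k (x, y))).
Proof.
apply: (@integrable_bdd _ _ _ _ _ _ K) => //.
exact: measurableT_comp mk (measurable_pair2 y).
Qed.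

Let FE : fubini_F Q (EFin \o k) = EFin \o (fun x => \int[Q]_y k (x, y)).
Proof.
by apply/funext => x; rewrite /fubini_F /= /Rintegral fineK//; exact: integrable_fin_num (k1 x).
Qed.

Let GE : fubini_G P (EFin \o k) = EFin \o (fun y => \int[P]_x k (x, y)).
Proof.
by apply/funext => y; rewrite /fubini_G /= /Rintegral fineK//; exact: integrable_fin_num (k2 y).
Qed.

Lemma bounded_fubini_measurable : measurable_fun setT (fun x => \int[Q]_y k (x, y)).
Proof. by apply/measurable_EFinP; rewrite -FE; exact: measurable_fubini_F ki. Qed.

Lemma bounded_fubini_bound x : `|\int[Q]_y k (x, y)| <= K.
Proof.
apply: le_trans (le_normr_Rintegral _ (k1 x)) _ => //.
have -> : K = \int[Q]_y K by rewrite Rintegral_cst// [X in fine X]probability_setT mulr1.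
apply: le_Rintegral => //; first exact: integrable_norm (k1 x).
exact: finite_measure_integrable_cst.
Qed.

Lemma bounded_fubini : \int[P]_x \int[Q]_y k (x, y) = \int[Q]_y \int[P]_x k (x, y).
Proof.
rewrite {1}/Rintegral -/(EFin \o _) -FE (integral12_prod_meas1 ki).
by rewrite -(integral21_prod_meas1 ki) GE.
Qed.

End bounded_fubini.

Section time.
Context {R : realType}.
Local Notation mR := (measurableTypeR R).
Local Notation leb := (@lebesgue_measure R).
Variable T : R.
Hypothesis T0 : 0 < T.

(** Time is normalised to a probability so that the bounded Fubini lemmas apply to time as well as
    to the torus; the factor 1/T cancels afterwards. *)
Definition UT : probability mR R := uniform_prob T0.

Lemma Rintegral_UT (f : mR -> R) : measurable_fun setT f ->
  leb.-integrable `[0%R, T] (EFin \o f) ->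
  \int[UT]_x f x = T^-1 * \int[leb]_(x in `[0%R, T]) f x.
Proof.
move=> mf fi.
have E (g : mR -> \bar R) : measurable_fun setT g -> (forall x, 0 <= g x)%E ->
    (\int[UT]_x g x = T^-1%:E * \int[leb]_(x in `[0%R, T]) g x)%E.
  by move=> mg g0; rewrite /UT integral_uniform// subr0.
have mf' : measurable_fun setT (EFin \o f) by exact/measurable_EFinP.
have Ef : (\int[UT]_x (f x)%:E = T^-1%:E * \int[leb]_(x in `[0%R, T]) (f x)%:E)%E.
  rewrite integralE [in RHS]integralE.
  rewrite !E//; [|exact: measurable_funeneg|exact: measurable_funepos].
  have : (\int[leb]_(x in `[0%R, T]) (fun x0 => (f x0)%:E)^\+ x \is a fin_num)%E.
    exact: integrable_pos_fin_num.
  move: (\int[leb]_(x in `[0%R, T]) (fun x0 => (f x0)%:E)^\+ x)%E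
        (\int[leb]_(x in `[0%R, T]) (fun x0 => (f x0)%:E)^\- x)%E => a b afin.
  by rewrite muleBr// fin_num_adde_defr.
by rewrite /Rintegral Ef fineM//; exact: integrable_fin_num.
Qed.

Lemma within_continuous_integrable (f : R -> R) a b : {within `[a, b], continuous f} ->
  leb.-integrable `[a, b] (EFin \o f).
Proof. by move=> cf; apply: continuous_compact_integrable => //; exact: segment_compact. Qed.

Lemma within_subitv (f : R -> R) a b s t : a <= s -> t <= b ->
  {within `[a, b], continuous f} -> {within `[s, t], continuous f}.
Proof.
move=> sa tb; apply: continuous_subspaceW => x /=; rewrite !in_itv/= => /andP[sx xt].
by rewrite (le_trans sa sx) (le_trans xt tb).
Qed.

Lemma within_FTC2 (a a' : R -> R) (s t : R) : s <= t ->
  {within `[s, t], continuous a} -> {within `[s, t], continuous a'} ->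
  (forall r : R, s < r < t -> is_derive r (1 : R) a (a' r)) ->
  \int[leb]_(r in `[s, t]) a' r = a t - a s.
Proof.
rewrite le_eqVlt => /predU1P[->|st] ca ca' da.
  by rewrite set_itv1 Rintegral_set1 subrr.
rewrite /Rintegral (@continuous_FTC2 _ a' a)//.
- split; first by move=> r; rewrite in_itv/= => /da[].
  + by have [] := (continuous_within_itvP _ st).1 ca.
  + by have [] := (continuous_within_itvP _ st).1 ca.
- by move=> r; rewrite in_itv/= derive1E => /da[_ ->].
Qed.

(* At a maximum point of [S t * expR (- c * t)] with [c > C], the hypothesis forces
   the maximum to be nonpositive. *)
Lemma gronwall (S : R -> R) (C : R) : 0 <= C ->
  {within `[0, T], continuous S} -> (forall t, 0 <= t <= T -> 0 <= S t) ->
  (forall t, 0 <= t <= T -> S t <= C * \int[leb]_(s in `[0, t]) S s) ->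
  forall t, 0 <= t <= T -> S t = 0.
Proof.
move=> C0 cS S0 hS.
(* This makes [C / c] at most 1/2, so at the maximum point the integral term is at most half of
   [M * w m]; it is positive even for [C = 0]. *)
pose c := 2 * (C + 1); have c0 : 0 < c by rewrite mulr_gt0// ltr_wpDl.
pose w (t : R) : R := expR (c * t).
have w0 t : 0 < w t by exact: expR_gt0.
have dw (t : R) : is_derive t (1 : R) w (c * w t).
  have d1 : is_derive t (1 : R) (fun s : R => c * s) c.
    by apply: is_derive_eq; rewrite [_%:A]mulr1.
  have := @is_derive1_comp _ _ _ t _ _ (is_derive_expR (c * t)) d1.
  by rewrite mulrC.
have cw : continuous w.
  by move=> s; apply: differentiable_continuous; apply/derivable1_diffP; have [] := dw s.
have cSw : {within `[0, T], continuous (fun t => S t / w t)}.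
  move=> t; apply: cvgM; first exact: cS.
  apply: cvgV; first by rewrite gt_eqF.
  exact: (continuous_subspaceT cw).
have [m m0T mP] := EVT_max (ltW T0) cSw.
have mT : 0 <= m <= T by move: m0T; rewrite in_itv.
set M := S m / w m in mP.
have SM t : 0 <= t <= T -> S t <= M * w t.
  by move=> t0T; rewrite -ler_pdivrMr//; apply: mP; rewrite in_itv.
have M0 : M <= 0.
  have [m0 m1] := andP mT.
  have cS' := within_subitv (lexx 0) m1 cS.
  have iw : \int[leb]_(s in `[0, m]) (c * w s) = w m - w 0.
    apply: within_FTC2 => //; first exact: continuous_subspaceT.
    apply: continuous_subspaceT => s.
    by apply: cvgM; [exact: cvg_cst|exact: cw].
  have iS : \int[leb]_(s in `[0, m]) S s <= \int[leb]_(s in `[0, m]) (M / c * (c * w s)).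
    apply: le_Rintegral => //.
    - exact: within_continuous_integrable.
    - apply: within_continuous_integrable; apply: continuous_subspaceT => s.
      by do 2 (apply: cvgM; first exact: cvg_cst); exact: cw.
    - move=> s; rewrite /= in_itv/= => /andP[s0 sm].
      rewrite mulrA divfK ?gt_eqF//; apply: SM; by rewrite s0 (le_trans sm m1).
  rewrite RintegralZl// in iS; last first.
    apply: within_continuous_integrable; apply: continuous_subspaceT => s.
    by apply: cvgM; [exact: cvg_cst|exact: cw].
  rewrite iw in iS.
  have SmE : S m = M * w m by rewrite /M divfK// gt_eqF.
  have := hS m mT.
  have : C * \int[leb]_(s in `[0, m]) S s <= C * (M / c * (w m - w 0)) by apply: ler_wpM2l.
  rewrite SmE => h1 h2; have {h1 h2} h := le_trans h2 h1.
  rewrite leNgt; apply/negP => MM.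
  have w1 : w 0 = 1 by rewrite /w mulr0 expR0.
  have : C * (M / c * (w m - w 0)) <= M * w m / 2.
    rewrite w1 (_ : C * _ = (C / c) * (M * (w m - 1))); last by ring.
    rewrite mulrC; apply: ler_pM.
    - by rewrite mulr_ge0 ?(ltW MM)// subr_ge0 -w1 /w ler_expR mulr0 mulr_ge0// ltW.
    - by rewrite divr_ge0// ltW.
    - by rewrite ler_wpM2l ?(ltW MM)// gerBl.
    - by rewrite ler_pdivrMr// /c; lra.
  have : 0 < M * w m by rewrite mulr_gt0.
  lra.
move=> t t0T; apply/eqP; rewrite eq_le S0// andbT (le_trans (SM t t0T))//.
by rewrite pmulr_lle0.
Qed.

End time.

(** * Integration by parts in time *)

Section time_ibp.
Context {R : realType}.
Local Notation mR := (measurableTypeR R).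
Local Notation leb := (@lebesgue_measure R).
Variable T : R.
Hypothesis T0 : 0 < T.

Lemma integrable_itv_bdd (f : R -> R) (a b K : R) : measurable_fun `[a, b] f ->
  (forall x, a <= x <= b -> `|f x| <= K) -> leb.-integrable `[a, b] (EFin \o f).
Proof.
move=> mf fK; apply: measurable_bounded_integrable => //.
  by rewrite /= lebesgue_measure_itv; case: ifP => _; rewrite -?EFinB ?ltry// lt0y.
exists K; split; first exact: num_real.
by move=> y Ky x; rewrite /= in_itv/= => xab; exact: le_trans (fK x xab) (ltW Ky).
Qed.

Lemma within_bounded (f : R -> R) a b : {within `[a, b], continuous f} ->
  exists K : R, forall x, a <= x <= b -> `|f x| <= K.
Proof.
move=> cf; have /compact_bounded[K [_ KP]] : compact (f @` `[a, b]).
  by apply: continuous_compact => //; exact: segment_compact.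
exists (K + 1) => x xab; apply: KP; first by rewrite ltrDl.
by exists x => //; rewrite /= in_itv.
Qed.

Lemma within_measurable (f : R -> R) a b : {within `[a, b], continuous f} ->
  measurable_fun `[a, b] f.
Proof. by move=> cf; apply: subspace_continuous_measurable_fun. Qed.

Variables (a a' h : R -> R) (K : R).
Hypotheses (ca : {within `[0, T], continuous a}) (ca' : {within `[0, T], continuous a'})
  (da : forall r : R, 0 < r < T -> is_derive r (1 : R) a (a' r))
  (mh : measurable_fun `[0, T] h) (hK : forall t, 0 <= t <= T -> `|h t| <= K).

(** The kernel a'(t) h(s) on the triangle s <= t: integrated in s it gives a' times the primitive of
    h, integrated in t it gives h(s) (a(T) - a(s)). *)
Let k (ts : mR * mR) : R :=
  if ts.2 <= ts.1 then (a' \_ `[0, T]) ts.1 * (h \_ `[0, T]) ts.2 else 0.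

Let patchE (f : R -> R) x : 0 <= x <= T -> (f \_ `[0, T]) x = f x.
Proof. by move=> xT; rewrite /patch mem_set//= in_itv. Qed.

Let patchN (f : R -> R) x : ~~ (0 <= x <= T) -> (f \_ `[0, T]) x = 0.
Proof. by move=> xT; rewrite /patch memNset//= in_itv/=; exact/negP. Qed.

Let patch_bdd (f : R -> R) B : (forall x, 0 <= x <= T -> `|f x| <= B) ->
  forall x, `|(f \_ `[0, T]) x| <= `|B|.
Proof.
move=> fB x; have [xT|xT] := boolP (0 <= x <= T).
  by rewrite patchE// (le_trans (fB _ xT))// ler_norm.
by rewrite patchN// normr0.
Qed.

Let mpatch (f : R -> R) : measurable_fun `[0, T] f -> measurable_fun setT (f \_ `[0, T]).
Proof. by move=> mf; apply: (measurable_restrictT _ _).1. Qed.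

Let mk : measurable_fun setT k.
Proof.
apply: measurable_fun_ifT.
- by apply: measurable_fun_ler.
- apply: measurable_funM.
    by apply: measurableT_comp => //; apply: mpatch; exact: within_measurable.
  by apply: measurableT_comp => //; exact: mpatch.
- exact: measurable_cst.
Qed.

Let kK : exists B : R, forall z, `|k z| <= B.
Proof.
have [B aB] := within_bounded ca'.
exists (`|B| * `|K|) => z; rewrite /k; case: ifP => _.
  by rewrite normrM ler_pM// ?patch_bdd.
by rewrite normr0 mulr_ge0.
Qed.

Let g t := \int[leb]_(s in `[0, t]) h s.

Let hi t : 0 <= t <= T -> leb.-integrable `[0, t] (EFin \o h).
Proof.
move=> /andP[t0 tT]; apply: (@integrable_itv_bdd _ _ _ K).
  apply: measurable_funS mh => //; apply: subset_itvl; by rewrite bnd_simp.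
by move=> x /andP[x0 xt]; apply: hK; rewrite x0 (le_trans xt tT).
Qed.

Let F1E t : 0 <= t <= T -> \int[UT T0]_s k (t, s) = T^-1 * (a' t * g t).
Proof.
move=> t0T; have [B hB] := kK.
have mks : measurable_fun setT (fun s => k (t, s)).
  exact: measurableT_comp mk (measurable_pair1 t).
rewrite Rintegral_UT//; last first.
  by apply: (@integrable_itv_bdd _ _ _ B); [exact: measurable_funTS|move=> *; exact: hB].
congr (_ * _); rewrite /g -RintegralZl//; last exact: hi.
rewrite [LHS]Rintegral_mkcond [RHS]Rintegral_mkcond; apply: eq_Rintegral => s _.
have [t0 tT] := andP t0T.
rewrite /patch !mem_setE !in_itv/= /k /=.
have [st|ts] := leP s t; last by rewrite andbF; case: ifP.
rewrite andbT patchE// (le_trans st tT) andbT; case: ifP => // s0.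
by rewrite patchE// s0 (le_trans st tT).
Qed.

Let F2E s : 0 <= s <= T -> \int[UT T0]_t k (t, s) = T^-1 * (h s * (a T - a s)).
Proof.
move=> s0T; have [B hB] := kK; have [s0 sT] := andP s0T.
have mks : measurable_fun setT (fun t => k (t, s)).
  exact: measurableT_comp mk (measurable_pair2 s).
rewrite Rintegral_UT//; last first.
  by apply: (@integrable_itv_bdd _ _ _ B); [exact: measurable_funTS|move=> *; exact: hB].
congr (_ * _).
have cas := within_subitv s0 (lexx T) ca.
have cas' := within_subitv s0 (lexx T) ca'.
have <- : \int[leb]_(r in `[s, T]) a' r = a T - a s.
  apply: within_FTC2 => // r /andP[sr rT].
  by apply: da; rewrite rT (le_lt_trans s0 sr).
rewrite -RintegralZl//; last exact: within_continuous_integrable.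
rewrite [LHS]Rintegral_mkcond [RHS]Rintegral_mkcond; apply: eq_Rintegral => t _.
rewrite /patch !mem_setE !in_itv/= /k /=.
have [st|ts] := leP s t; last by rewrite if_same.
have t0 := le_trans s0 st; rewrite t0 /=; case: ifP => // tT.
by rewrite !patchE ?t0 ?tT// mulrC.
Qed.

(** Since [h] is just bounded and measurable, its primitive may fail to be differentiable at some
    points; exchanging the order of integration over the triangle replaces the product rule. *)
Lemma time_ibp : leb.-integrable `[0, T] (EFin \o (fun t => a' t * g t + a t * h t)) /\
  \int[leb]_(t in `[0, T]) (a' t * g t + a t * h t) = a T * \int[leb]_(s in `[0, T]) h s.
Proof.
have [B hB] := kK; have TV : T^-1 != 0 by rewrite invr_eq0 gt_eqF.
have m1 := @bounded_fubini_measurable _ _ _ _ _ (UT T0) (UT T0) k B mk hB.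
have b1 := @bounded_fubini_bound _ _ _ _ _ (UT T0) k B mk hB.
have msw : measurable_fun setT (fun st : mR * mR => k (st.2, st.1)).
  apply: (measurableT_comp mk); exact: measurable_swap.
have m2 := @bounded_fubini_measurable _ _ _ _ _ (UT T0) (UT T0) _ B msw (fun z => hB _).
have b2 := @bounded_fubini_bound _ _ _ _ _ (UT T0) _ B msw (fun z => hB _).
have i1 : leb.-integrable `[0, T] (EFin \o (fun t => \int[UT T0]_s k (t, s))).
  by apply: (@integrable_itv_bdd _ _ _ B); [exact: measurable_funTS|move=> *; exact: b1].
have i2 : leb.-integrable `[0, T] (EFin \o (fun s => \int[UT T0]_t k (t, s))).
  by apply: (@integrable_itv_bdd _ _ _ B); [exact: measurable_funTS|move=> *; exact: b2].
have := @bounded_fubini _ _ _ _ _ (UT T0) (UT T0) k B mk hB.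
rewrite (Rintegral_UT T0 m1 i1) (Rintegral_UT T0 m2 i2) => /(mulfI TV).
have i1' : leb.-integrable `[0, T] (EFin \o (fun t => a' t * g t)).
  have := @integrable_scale _ _ _ leb `[0, T]%classic T _ (measurable_itv _) i1.
  apply: eq_integrable => // t; rewrite inE/= in_itv/= => t0T.
  by rewrite F1E// mulrA mulfV ?mul1r// gt_eqF.
have i2' : leb.-integrable `[0, T] (EFin \o (fun t => h t * (a T - a t))).
  have := @integrable_scale _ _ _ leb `[0, T]%classic T _ (measurable_itv _) i2.
  apply: eq_integrable => // t; rewrite inE/= in_itv/= => t0T.
  by rewrite F2E// mulrA mulfV ?mul1r// gt_eqF.
have -> : \int[leb]_(t in `[0, T]) \int[UT T0]_s k (t, s) =
    T^-1 * \int[leb]_(t in `[0, T]) (a' t * g t).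
  rewrite -RintegralZl//; apply: eq_Rintegral => t; rewrite inE/= in_itv/= => t0T.
  exact: F1E.
have -> : \int[leb]_(s in `[0, T]) \int[UT T0]_t k (t, s) =
    T^-1 * \int[leb]_(t in `[0, T]) (h t * (a T - a t)).
  rewrite -RintegralZl//; apply: eq_Rintegral => t; rewrite inE/= in_itv/= => t0T.
  exact: F2E.
move=> /(mulfI TV) E.
have hi' : leb.-integrable `[0, T] (EFin \o h) by apply: hi; rewrite lexx ltW.
have i3 : leb.-integrable `[0, T] (EFin \o (fun t => a t * h t)).
  have [B' aB'] := within_bounded ca.
  have -> : EFin \o (fun t => a t * h t) = EFin \o (fun t => h t * a t).
    by apply/funext => t /=; rewrite mulrC.
  apply: (@integrable_mul_bdd _ _ _ _ _ _ _ B') => //; first exact: within_measurable.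
split; first exact: integrable_addR.
rewrite RintegralD// E -RintegralD// -RintegralZl//.
by apply: eq_Rintegral => t _; ring.
Qed.

End time_ibp.

Lemma near_continuous {R : realType} {W : topologicalType} (g : W -> R) x :
  (forall e, 0 < e -> \forall y \near x, `|g x - g y| < e) -> g @ x --> g x.
Proof. by move=> H; apply/cvgrPdist_lt. Qed.

(** * Continuity and differentiability in time of Fourier coefficients *)

Section slab.
Context {R : realType} {d : nat}.
Local Notation V := 'rV[R]_d.
Local Notation mode := ('rV[int]_d * bool)%type.
Variable T : R.

Implicit Types f : R -> V -> R.

Lemma slab_near f t x (e : R) : continuous_slab T f -> 0 <= t <= T -> 0 < e ->
  \forall z \near (t, x), 0 <= z.1 <= T -> `|f t x - f z.1 z.2| < e.
Proof.
move=> cf tT e0.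
have tx : (`[0, T] `*` [set: V]) (t, x) by split => //=; rewrite in_itv.
have := (subspace_continuousP _ _).1 cf (t, x) tx.
move=> /cvgrPdist_lt /(_ e e0); rewrite near_withinE; apply: filterS => z H z1.
by apply: H; split => //=; rewrite in_itv.
Qed.

(** Compactness of the closed cube makes joint continuity uniform in the space variable. *)
Lemma slab_uniform f t (e : R) : continuous_slab T f -> 0 <= t <= T -> 0 < e ->
  \forall s \near t, 0 <= s <= T -> forall x, cubeV x -> `|f t x - f s x| < e.
Proof.
move=> cf tT e0.
have e20 : 0 < e / 2 by rewrite divr_gt0.
have := (compact_near_coveringP (@cubeV R d)).1 compact_cubeV R (nbhs t)
  (fun s x => 0 <= s <= T -> `|f t x - f s x| < e) _.
have H x : cubeV x -> \forall x' \near x & s \near nbhs t, 0 <= s <= T -> `|f t x' - f s x'| < e.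
  move=> _; have := slab_near x cf tT e20.
  move=> [[A B] /= [At Bx] AB]; exists (B, A) => //= -[x' s] /= [Bx' As] sT.
  have h1 := AB (s, x') (conj As Bx') sT.
  have h2 := AB (t, x') (conj (nbhs_singleton At) Bx') tT.
  rewrite (le_lt_trans (ler_distD (f t x) _ _))// (splitr e) ltrD//=.
  by rewrite distrC.
move=> /(_ _ H); apply: filterS => s /= Hs sT x xc.
exact: Hs.
Qed.

Lemma slab_bounded f : continuous_slab T f -> (forall t, 0 <= t <= T -> Zperiodic (f t)) ->
  exists K : R, forall t x, 0 <= t <= T -> `|f t x| <= K.
Proof.
move=> cf pf.
have cA : compact (`[0, T] `*` @cubeV R d).
  by apply: compact_setX; [exact: segment_compact|exact: compact_cubeV].
have /compact_bounded[K [_ KP]] : compact ((fun z : R * V => f z.1 z.2) @` (`[0, T] `*` @cubeV R d)).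
  apply: continuous_compact => //; apply: continuous_subspaceW cf.
  by move=> z [].
exists (K + 1) => t x tT; rewrite -(periodic_floor x (pf t tT)).
apply: KP; first by rewrite ltrDl.
exists (t, x - zvec (floorv x)) => //; split => /=; first by rewrite in_itv.
exact: cubeV_floor.
Qed.

Lemma slab_continuous f t : continuous_slab T f -> 0 <= t <= T -> continuous (f t).
Proof.
move=> cf tT x; apply: near_continuous => e e0.
have [[A B] /= [At Bx] AB] := slab_near x cf tT e0.
move: Bx; apply: (@filterS _ (nbhs x)) => y By; exact: (AB (t, y) (conj (nbhs_singleton At) By) tT).
Qed.

Lemma coef_dist (f g : V -> R) (j : mode) (e : R) : continuous f -> continuous g ->
  Zperiodic f -> Zperiodic g -> (forall x, cubeV x -> `|f x - g x| <= e) ->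
  `|coef f j - coef g j| <= e.
Proof.
move=> cf cg pf pg fg.
have fi := integrable_continuous cf pf; have gi := integrable_continuous cg pg.
rewrite /coef -RintegralB//; [|exact: integrable_phi..].
have bi : (lebT d).-integrable setT (EFin \o (fun x => f x * phi j x - g x * phi j x)).
  by apply: integrable_subR => //; exact: integrable_phi.
apply: le_trans (le_normr_Rintegral _ bi) _ => //.
have -> : e = \int[lebT d]_x e.
  by rewrite Rintegral_cst// [X in fine X]probability_setT mulr1.
apply: le_Rintegral => //; first exact: integrable_norm.
  exact: finite_measure_integrable_cst.
move=> x _; rewrite -mulrBl normrM -[leRHS]mulr1 ler_pM//; last exact: phi_le1.
rewrite -(periodic_floor x pf) -(periodic_floor x pg).
by apply: fg; exact: cubeV_floor.
Qed.

Lemma coef_slab_continuous f j : continuous_slab T f ->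
  (forall t, 0 <= t <= T -> Zperiodic (f t)) ->
  {within `[0, T], continuous (fun t => coef (f t) j)}.
Proof.
move=> cf pf; apply/subspace_continuousP => t tT'.
have tT : 0 <= t <= T by move: tT'; rewrite /= in_itv.
apply/cvgrPdist_le => e e0; rewrite near_withinE.
have := slab_uniform cf tT e0; apply: filterS => s Hs sT'.
have sT : 0 <= s <= T by move: sT'; rewrite /= in_itv.
apply: coef_dist; [exact: slab_continuous|exact: slab_continuous|exact: pf|exact: pf|].
by move=> x xc; apply: ltW; exact: Hs.
Qed.

(** Differentiation under the integral sign; the time derivative, continuous and periodic, is
    bounded on the slab, and this constant serves as the dominating function. *)
Lemma coef_slab_derive f ft j : continuous_slab T f -> continuous_slab T ft ->
  (forall t, 0 <= t <= T -> Zperiodic (f t)) ->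
  (forall t, 0 <= t <= T -> Zperiodic (ft t)) ->
  (forall t x, 0 < t < T -> is_derive (t : R) (1 : R) (fun s => f s x) (ft t x)) ->
  forall t, 0 < t < T -> is_derive (t : R) (1 : R) (fun s => coef (f s) j) (coef (ft t) j).
Proof.
move=> cf cft pf pft df t tT.
have [K hK] := slab_bounded cft pft.
have oc s : 0 < s < T -> 0 <= s <= T by move=> /andP[s0 sT]; rewrite !ltW.
have dphi s x : 0 < s < T ->
    is_derive (s : R) (1 : R) (fun s => f s x * phi j x) (ft s x * phi j x).
  move=> sT; have D := df s x sT.
  rewrite (_ : (fun s => f s x * phi j x) = (fun s => phi j x * f s x)); last first.
    by apply/funext => r; rewrite mulrC.
  by rewrite mulrC; exact: (is_deriveZ (phi j x) D).
have tI : `]0, T[%classic t by rewrite /= in_itv.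
have int_f x : `]0, T[%classic x -> (lebT d).-integrable setT (EFin \o (fun y => f x y * phi j y)).
  rewrite /= in_itv/= => /oc xT; apply: integrable_phi; apply: integrable_continuous.
    exact: slab_continuous.
  exact: pf.
have der1 x y : `]0, T[%classic x -> setT y -> derivable (fun s => f s y * phi j y) x 1.
  by rewrite /= in_itv/= => xT _; have [] := dphi x y xT.
have G x y : `]0, T[%classic x -> setT y ->
    `|partial1of2 (fun s y => f s y * phi j y) x y| <= (cst `|K| : V -> R) y.
  rewrite /= in_itv/= => xT _; rewrite partial1of2E; have [_ ->] := dphi x y xT.
  rewrite normrM -[leRHS]mulr1 ler_pM//; last exact: phi_le1.
  by apply: le_trans (hK _ _ (oc _ xT)) (ler_norm _).
have iK : (lebT d).-integrable setT (EFin \o (cst `|K| : V -> R)).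
  exact: finite_measure_integrable_cst.
apply: DeriveDef.
  exact: (@derivable_under_integral R _ V (lebT d) (fun s y => f s y * phi j y) setT
    measurableT t 0 T tI int_f der1 _ (fun y => normr_ge0 K) iK G).
rewrite -derive1E.
rewrite [LHS](@differentiation_under_integral R _ V (lebT d) (fun s y => f s y * phi j y) setT
    measurableT t 0 T tI int_f der1 _ (fun y => normr_ge0 K) iK G).
apply: eq_Rintegral => x _; rewrite partial1of2E.
by have [_ ->] := dphi t x tT.
Qed.

(** Near an interior time the restriction of the quotient to [0, T] has no effect. *)
Lemma is_derive_within (f : R -> R) (t l : R) : 0 < t < T ->
  (fun s => (f s - f t) / (s - t)) @ within `[0, T] t^' --> l ->
  is_derive (t : R) (1 : R) f l.
Proof.
move=> tT fl.
have cv : (fun h : R => h^-1 *: (f (h *: 1 + t) - f t)) @ 0^' --> l.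
  apply/cvgrPdist_lt => e e0.
  move/cvgrPdist_lt : fl => /(_ e e0).
  move=> H.
  have : \forall s \near t, s \in `]0, T[ by apply: near_in_itvoo; rewrite in_itv.
  have {}H : \forall s \near t, s != t -> `[0, T]%classic s -> `|l - (f s - f t) / (s - t)| < e.
    exact: H.
  move=> nT; have [r /= r0 rP] := (nbhs_ballP _ _).1 (filterI H nT).
  apply/nbhs_ballP; exists r => // h; rewrite /ball/= sub0r normrN => hr h0.
  have [] := rP (h + t).
    by rewrite /ball/= opprD addrCA subrr addr0 normrN.
  move=> + hT; rewrite [h *: 1]mulr1.
  move: hT; rewrite in_itv/= => /andP[p1 p2].
  have ht : h + t != t by rewrite -subr_eq0 addrK.
  have hT' : `[0, T]%classic (h + t) by rewrite /= in_itv/= !ltW.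
  move=> /(_ ht hT').
  by rewrite addrK /GRing.scale/= [h^-1 * _]mulrC.
have df : derivable f t 1 by apply/cvg_ex; exists l.
by apply: DeriveDef => //; apply: cvg_lim.
Qed.

End slab.

Lemma periodic_pair_bounded {R : realType} {d : nat} (f : 'rV[R]_d * 'rV[R]_d -> R) (K : R) :
  continuous f -> (forall p, Zperiodic (fun x => f (x, p))) ->
  exists B : R, forall x p, `|p| <= K -> `|f (x, p)| <= B.
Proof.
move=> cf pf; pose box : set 'rV[R]_d := [set p | forall i, `[- K, K]%classic (p 0 i)].
have cbox : compact box.
  by apply: (@rV_compact R d (fun=> `[- K, K]%classic)) => i; exact: segment_compact.
have cA : compact (@cubeV R d `*` box) by apply: compact_setX => //; exact: compact_cubeV.
have /compact_bounded[B [_ BP]] : compact (f @` (@cubeV R d `*` box)).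
  by apply: continuous_compact => //; exact: continuous_subspaceT.
exists (B + 1) => x p pK; rewrite -(periodic_floor x (pf p)).
apply: BP; first by rewrite ltrDl.
exists (x - zvec (floorv x), p) => //; split => /=; first exact: cubeV_floor.
move=> i; rewrite /= in_itv/= -ler_norml (le_trans _ pK)//; exact: norm_coord_le.
Qed.

Lemma row_norm_le {R : realType} {d : nat} (v : 'rV[R]_d) (B : R) : 0 <= B ->
  (forall i, `|v 0 i| <= B) -> `|v| <= B.
Proof.
move=> B0 vB; have [/mx_norm_eq0 ->|/mx_norm_neq0[[k i] E]] := eqVneq (mx_norm v) 0.
  by rewrite normr0.
have -> : `|v| = `|v 0 i| by rewrite (ord1 k) in E.
exact: vB.
Qed.

(** * Bounded measurable fields in time and space *)

Section slab_calculus.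
Context {R : realType} {d : nat}.
Local Notation mR := (measurableTypeR R).
Local Notation V := 'rV[R]_d.
Local Notation leb := (@lebesgue_measure R).
Local Notation mode := ('rV[int]_d * bool)%type.
Variables (T : R).
Hypothesis T0 : 0 < T.

Local Notation slab := (`[0, T] `*` [set: V] : set (mR * V)).

(** A class stable under sums and products in which every space integral is again bounded and
    measurable in time, so that all iterated integrals of the verification make sense. *)
Definition slab_bm (k : R -> V -> R) : Prop :=
  measurable_fun slab (fun z : mR * V => k z.1 z.2) /\
  exists B : R, forall t x, 0 <= t <= T -> `|k t x| <= B.

Definition slab_field (b : R -> V -> V) : Prop :=
  measurable_fun slab (fun z : mR * V => b z.1 z.2) /\
  exists B : R, forall t x, 0 <= t <= T -> `|b t x| <= B.

Lemma measurable_slab : measurable slab.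
Proof. by apply: measurableX => //; exact: measurable_itv. Qed.

Lemma tsum_le M (c : mode -> R) (x : V) : `|tsum M c x| <= \sum_(j <- modes M) `|c j|.
Proof.
apply: le_trans (ler_norm_sum _ _ _) _; apply: ler_sum => j _.
by rewrite normrM ler_piMr//; exact: phi_le1.
Qed.

Lemma slab_integral_measurable (k : R -> V -> R) B :
  measurable_fun slab (fun z : mR * V => k z.1 z.2) -> (forall t x, 0 <= t <= T -> `|k t x| <= B) ->
  measurable_fun `[0, T] (fun t => \int[lebT d]_x k t x).
Proof.
move=> mk kB.
have mk' : measurable_fun setT ((fun z : mR * V => k z.1 z.2) \_ slab).
  exact: (measurable_restrictT _ measurable_slab).1.
have kB' z : `|((fun z : mR * V => k z.1 z.2) \_ slab) z| <= `|B|.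
  rewrite /patch; case: ifPn => [|_]; last by rewrite normr0.
  rewrite inE => -[/= + _]; rewrite in_itv/= => z1.
  by apply: le_trans (kB _ _ z1) (ler_norm _).
have := @bounded_fubini_measurable _ _ _ _ _ (UT T0) (lebT d) _ _ mk' kB'.
move=> /(measurable_funTS (D := `[0, T]%classic)).
apply: eq_measurable_fun => t; rewrite inE/= => tT.
by apply: eq_Rintegral => x _; rewrite /patch mem_set.
Qed.

Lemma measurable_slice_slab (k : R -> V -> R) t : 0 <= t <= T ->
  measurable_fun slab (fun z : mR * V => k z.1 z.2) -> measurable_fun setT (k t).
Proof.
move=> tT mk.
have mk' : measurable_fun setT ((fun z : mR * V => k z.1 z.2) \_ slab).
  exact: (measurable_restrictT _ measurable_slab).1.
have := measurableT_comp mk' (measurable_pair1 (t : mR)).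
apply: eq_measurable_fun => x _ /=; rewrite /patch mem_set//.
Qed.

Lemma slab_bmD k l : slab_bm k -> slab_bm l -> slab_bm (fun t x => k t x + l t x).
Proof.
move=> [mk [B hB]] [ml [C hC]]; split; first exact: measurable_funD.
by exists (B + C) => t x tT; rewrite (le_trans (ler_normD _ _))// lerD ?hB ?hC.
Qed.

Lemma slab_bmM k l : slab_bm k -> slab_bm l -> slab_bm (fun t x => k t x * l t x).
Proof.
move=> [mk [B hB]] [ml [C hC]]; split; first exact: measurable_funM.
by exists (B * C) => t x tT; rewrite normrM ler_pM ?hB ?hC.
Qed.

Lemma slab_bmN k : slab_bm k -> slab_bm (fun t x => - k t x).
Proof.
move=> [mk [B hB]]; split; first exact: measurable_funN.
by exists B => t x tT; rewrite normrN hB.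
Qed.

Lemma slab_bm_sum (I : Type) (s : seq I) (k : I -> R -> V -> R) :
  (forall i, slab_bm (k i)) -> slab_bm (fun t x => \sum_(i <- s) k i t x).
Proof.
move=> hk; split; first by apply: measurable_sum => i; have [] := hk i.
have /choice[B hB] : forall i, exists B : R, forall t x, 0 <= t <= T -> `|k i t x| <= B.
  by move=> i; have [_] := hk i.
exists (\sum_(i <- s) B i) => t x tT.
by rewrite (le_trans (ler_norm_sum _ _ _))// ler_sum// => i _; exact: hB.
Qed.

Lemma slab_bm_time (c : R -> R) : {within `[0, T], continuous c} -> slab_bm (fun t _ => c t).
Proof.
move=> cc; split; last first.
  by have [B hB] := within_bounded cc; exists B => t _; exact: hB.
have mc : measurable_fun setT (c \_ `[0, T]).
  by apply: (measurable_restrictT _ _).1 => //; exact: within_measurable.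
apply: (@eq_measurable_fun _ _ _ _ _ ((c \_ `[0, T]) \o fst)).
  by move=> z; rewrite inE => -[z1 _]; rewrite /= /patch mem_set.
by apply: measurable_funTS; exact: measurableT_comp.
Qed.

Lemma slab_bm_space (f : V -> R) (B : R) : measurable_fun setT f -> (forall x, `|f x| <= B) ->
  slab_bm (fun _ => f).
Proof.
move=> mf fB; split; last by exists B => t x _; exact: fB.
by apply: measurable_funTS; exact: measurableT_comp.
Qed.

Lemma slab_bm_phi j : slab_bm (fun _ => phi j).
Proof. by apply: (@slab_bm_space _ 1); [exact: measurable_phi|exact: phi_le1]. Qed.

Lemma slab_bm_dot b b' : slab_field b -> slab_field b' ->
  slab_bm (fun t x => dot (b t x) (b' t x)).
Proof.
move=> [mb [B hB]] [mb' [B' hB']]; apply: slab_bm_sum => i; apply: slab_bmM.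
  split; first exact: (measurableT_comp (measurable_coord i) mb).
  by exists B => t x tT; rewrite (le_trans (norm_coord_le _ _))// hB.
split; first exact: (measurableT_comp (measurable_coord i) mb').
by exists B' => t x tT; rewrite (le_trans (norm_coord_le _ _))// hB'.
Qed.

Lemma slab_field_rowP (b : R -> V -> V) : (forall i, slab_bm (fun t x => b t x 0 i)) -> slab_field b.
Proof.
move=> hb; split.
  by apply: measurable_rowP => [|i]; [exact: measurable_slab|have [] := hb i].
have /choice[B hB] : forall i, exists B : R, forall t x, 0 <= t <= T -> `|b t x 0 i| <= B.
  by move=> i; have [_] := hb i.
exists (\sum_i `|B i|) => t x tT; apply: row_norm_le; first exact: sumr_ge0.
by move=> i; rewrite (le_trans (hB i t x tT))// (bigD1 i)//= (le_trans (ler_norm _))// lerDl sumr_ge0.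
Qed.

Lemma slab_bm_int k t : slab_bm k -> 0 <= t <= T -> (lebT d).-integrable setT (EFin \o k t).
Proof.
move=> [mk [B hB]] tT; apply: (@integrable_bdd _ _ _ _ _ _ B) => //; last first.
  by move=> x _; exact: hB.
exact: measurable_slice_slab mk.
Qed.

Lemma slab_bm_integral_le k B t : slab_bm k -> 0 <= t <= T ->
  (forall x, `|k t x| <= B) -> `|\int[lebT d]_x k t x| <= B.
Proof.
move=> hk tT hB; have ki := slab_bm_int hk tT.
apply: le_trans (le_normr_Rintegral _ ki) _ => //.
have -> : B = \int[lebT d]_x B by rewrite Rintegral_cst// [X in fine X]probability_setT mulr1.
apply: le_Rintegral => //; first exact: integrable_norm.
exact: finite_measure_integrable_cst.
Qed.

Lemma slab_bm_avg (k : R -> V -> R) : slab_bm k ->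
  measurable_fun `[0, T] (fun t => \int[lebT d]_x k t x) /\
  exists B : R, forall t, 0 <= t <= T -> `|\int[lebT d]_x k t x| <= B.
Proof.
move=> hk; have [mk [B hB]] := hk; split; first exact: (slab_integral_measurable mk hB).
by exists B => t tT; apply: (slab_bm_integral_le hk tT) => x; exact: hB.
Qed.

Lemma slab_bm_time_integrable k : slab_bm k ->
  leb.-integrable `[0, T] (EFin \o (fun t => \int[lebT d]_x k t x)).
Proof. by move=> /slab_bm_avg[mk [B hB]]; exact: (integrable_itv_bdd mk hB). Qed.

Lemma slab_bm_tsum M (c : R -> mode -> R) :
  (forall j, {within `[0, T], continuous (fun t => c t j)}) ->
  slab_bm (fun t x => tsum M (c t) x).
Proof.
move=> cc; apply: slab_bm_sum => j; apply: slab_bmM; last exact: slab_bm_phi.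
exact: slab_bm_time (cc j).
Qed.

Lemma grad_phi_field (j : mode) : slab_field (fun _ x => grad (phi j : V -> R) x).
Proof.
case: j => k e; apply: slab_field_rowP => i.
have : slab_bm (fun _ (x : V) => (-1) ^+ e * (2 * pi * (k 0 i)%:~R) * phi (k, ~~ e) x).
  apply: slab_bmM; last exact: slab_bm_phi.
  by apply: (@slab_bm_space _ `|(-1) ^+ e * (2 * pi * (k 0 i)%:~R)|).
congr (slab_bm _); apply/funext => t; apply/funext => x.
by rewrite mxE pderiv_phi.
Qed.

(** Lower semicontinuity and bounds for bounded second argument are all that is asked of [K], so one
    lemma serves the Lagrangian, the Hamiltonian and the components of its gradient. *)
Lemma slab_field_id_comp (K : V * V -> R) (b : R -> V -> V) :
  (forall c, open [set z | c < K z]) ->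
  (forall C, exists B : R, forall x p, `|p| <= C -> `|K (x, p)| <= B) ->
  slab_field b -> slab_bm (fun t x => K (x, b t x)).
Proof.
move=> oK bK [mb [C hC]]; split; last first.
  by have [B hB] := bK C; exists B => t x tT; apply: hB; exact: hC.
apply: (@measurable_lsc_comp _ _ _ _ slab K snd (fun z => b z.1 z.2)) => //.
  exact: measurable_slab.
exact: measurable_funTS.
Qed.

End slab_calculus.

(** * Weak solutions of the forward equation *)

Section weak.
Context {R : realType} {d : nat}.
Local Notation V := 'rV[R]_d.
Local Notation leb := (@lebesgue_measure R).
Local Notation mode := ('rV[int]_d * bool)%type.
Variables (T : R) (N : nat) (m : V -> R).
Hypothesis T0 : 0 < T.

Lemma coef_L2_dist (f g : V -> R) j : in_L2 f -> in_L2 g ->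
  (`|coef f j - coef g j|%:E <= L2norm (fun x => f x - g x)%R)%E.
Proof.
move=> f2 g2; have fi := in_L2_integrable f2; have gi := in_L2_integrable g2.
have [mf _ _] := f2; have [mg _ _] := g2.
rewrite /coef -RintegralB//; [|exact: integrable_phi..].
apply: le_trans (L1_le_L2 (measurable_funB mf mg)).
have i1 : (lebT d).-integrable setT (EFin \o (fun x => f x * phi j x - g x * phi j x)).
  by apply: integrable_subR => //; exact: integrable_phi.
rewrite EFin_normr_Rintegral//.
apply: le_trans (le_abse_integral _ measurableT (measurable_int _ i1)) _.
apply: ge0_le_integral => //.
- by apply: measurableT_comp => //; exact: (measurable_int _ i1).
- by apply/measurable_EFinP; apply: measurableT_comp => //; exact: measurable_funB.
- move=> x _ /=; rewrite lee_fin -mulrBl normrM ler_piMr//; exact: phi_le1.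
Qed.

Lemma in_CL2_coef (mu : R -> V -> R) j : in_CL2 T mu -> {within `[0, T], continuous (fun t => coef (mu t) j)}.
Proof.
move=> [mu2 cmu]; apply/subspace_continuousP => t tT'.
have tT : 0 <= t <= T by move: tT'; rewrite /= in_itv.
apply/cvgrPdist_lt => e e0.
have /fine_cvgP[fin /cvgrPdist_lt /(_ e e0)] := cmu t tT.
move=> H; rewrite near_withinE.
apply: (@filterS _ (nbhs t) _ _ _ _ (filterI fin H)) => s {}H sT'; have [fs] := H sT'.
rewrite sub0r normrN => hs.
have sT : 0 <= s <= T by move: sT'; rewrite /= in_itv.
rewrite distrC -lte_fin; apply: le_lt_trans (coef_L2_dist j (mu2 s sT) (mu2 t tT)) _.
by rewrite -(fineK fs) lte_fin; exact: le_lt_trans (ler_norm _) hs.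
Qed.

Definition grad_phi_bound (j : mode) (K : R) : R := \sum_i `|2 * pi * (j.1 0 i)%:~R| * K.

Lemma dot_grad_phi_le (j : mode) (x b : V) K : `|b| <= K ->
  `|dot (grad (phi j) x) b| <= grad_phi_bound j K.
Proof.
case: j => k e bK; apply: le_trans (ler_norm_sum _ _ _) _; apply: ler_sum => i _.
rewrite mxE pderiv_phi !normrM normrX normrN1 expr1n mul1r.
rewrite -mulrA ler_wpM2l// -[leRHS]mul1r ler_pM//; first exact: phi_le1.
rewrite (le_trans _ bK)// [leRHS]mx_normE.
exact: (le_bigmax _ (fun ij => `|b ij.1 ij.2|%:nng) (0, i)).
Qed.

Section coefficients.
Variable b : R -> V -> V.
Hypothesis hb : slab_field T b.

Definition drift (j : mode) (c : R -> mode -> R) (t : R) : R :=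
  \int[lebT d]_x (dot (grad (phi j) x) (b t x) * tsum N (c t) x).

(** The right-hand side of the forward equation in the mode [j]. It is defined for any family of
    coefficients because uniqueness applies it to the difference of two solutions. *)
Definition rate (j : mode) (c : R -> mode -> R) (t : R) : R := - lam j * c t j + drift j c t.

Section continuous_coefficients.
Variable c : R -> mode -> R.
Hypothesis cc : forall j, {within `[0, T], continuous (fun t => c t j)}.

Lemma drift_bm j : slab_bm T (fun t x => dot (grad (phi j) x) (b t x) * tsum N (c t) x).
Proof. exact: slab_bmM (slab_bm_dot (grad_phi_field T j) hb) (slab_bm_tsum N cc). Qed.

Lemma drift_le K j t : (forall t x, 0 <= t <= T -> `|b t x| <= K) -> 0 <= t <= T ->
  `|drift j c t| <= grad_phi_bound j K * \sum_(i <- modes N) `|c t i|.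
Proof.
move=> bK tT; apply: (slab_bm_integral_le (drift_bm j) tT) => x.
by rewrite normrM ler_pM//; [apply: dot_grad_phi_le; exact: bK|exact: tsum_le].
Qed.

Lemma rate_bm j : measurable_fun `[0, T] (rate j c) /\
  exists B : R, forall t, 0 <= t <= T -> `|rate j c t| <= B.
Proof.
have [md [B hB]] := slab_bm_avg T0 (drift_bm j).
have cj := @cc j; have [C hC] := within_bounded cj; split.
  apply: measurable_funD => //; apply: measurable_funM => //.
  exact: within_measurable.
exists (`|lam j| * C + B) => t tT; rewrite (le_trans (ler_normD _ _))// lerD//; last exact: hB.
by rewrite normrM normrN ler_wpM2l// hC.
Qed.

Lemma rate_integrable j t : 0 <= t <= T -> leb.-integrable `[0, t] (EFin \o rate j c).
Proof.
move=> /andP[t0 tT]; have [mr [B hB]] := rate_bm j.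
apply: (@integrable_itv_bdd _ _ _ _ B).
  by apply: measurable_funS mr => //; apply: subset_itvl; rewrite bnd_simp.
by move=> s /andP[s0 st]; apply: hB; rewrite s0 (le_trans st tT).
Qed.

End continuous_coefficients.

Lemma rate_sub j c c' t : 0 <= t <= T ->
  (forall j, {within `[0, T], continuous (fun t => c t j)}) ->
  (forall j, {within `[0, T], continuous (fun t => c' t j)}) ->
  rate j c t - rate j c' t = rate j (fun s i => c s i - c' s i) t.
Proof.
move=> tT cc cc'; rewrite /rate opprD addrACA -mulrBr; congr (_ + _).
rewrite /drift -RintegralB//; [|exact: (slab_bm_int (drift_bm _ _) tT)..].
apply: eq_Rintegral => x _; rewrite -mulrBr /tsum -sumrB; congr (_ * _).
by apply: eq_bigr => i _; rewrite mulrBl.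
Qed.

Lemma weak_coef (mu : R -> V -> R) j t : weak_solution T N m b mu -> 0 <= t <= T ->
  coef (mu t) j = coef m j + \int[leb]_(s in `[0, t]) rate j (fun s => coef (mu s)) s.
Proof.
move=> [mu2 _ W] tT; have := W (phi j) (periodic_phi j) (fun n => Cn_phi n j) t tT.
have E f : \int[lebT d]_x (phi j x * f x) = coef f j.
  by apply: eq_Rintegral => x _; rewrite mulrC.
rewrite !E => ->; congr (_ + _); apply: eq_Rintegral => s; rewrite inE/= in_itv/= => /andP[s0 st].
have sT : 0 <= s <= T by rewrite s0 (le_trans st)//; case/andP: tT.
have mui := in_L2_integrable (mu2.1 s sT).
congr (_ + _); last by apply: eq_Rintegral => x _; rewrite trunc_tsum.
rewrite /coef -RintegralZl//; last exact: integrable_phi.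
by apply: eq_Rintegral => x _; rewrite lap_phi; ring.
Qed.

(** The drift of each mode is controlled by the finitely many modes up to N, so their differences
    obey a closed integral inequality; once all coefficients agree, injectivity of the Fourier
    transform applies. *)
Lemma weak_solution_unique (mu mu' : R -> V -> R) : weak_solution T N m b mu -> weak_solution T N m b mu' ->
  forall t, 0 <= t <= T -> {ae lebT d, forall x, mu' t x = mu t x}.
Proof.
move=> Wmu Wmu'.
have [mu2 _ _] := Wmu; have [mu2' _ _] := Wmu'.
pose e t j := coef (mu' t) j - coef (mu t) j.
have cmu j : {within `[0, T], continuous (fun t => coef (mu t) j)} by exact: in_CL2_coef.
have cmu' j : {within `[0, T], continuous (fun t => coef (mu' t) j)} by exact: in_CL2_coef.
have ce j : {within `[0, T], continuous (fun t => e t j)}.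
  by move=> t; apply: cvgB; [exact: cmu'|exact: cmu].
have [_ [K bK]] := hb.
have K0 : 0 <= K by apply: le_trans (bK 0 0 _) => //; rewrite lexx ltW.
have grad_bound0 j : 0 <= grad_phi_bound j K by apply: sumr_ge0 => i _; rewrite mulr_ge0.
have lam0 (j : mode) : 0 <= lam j :> R by rewrite mulr_ge0 ?sqr_ge0 ?dot_ge0.
have sub s t : 0 <= t <= T -> 0 <= s <= t -> 0 <= s <= T.
  by move=> /andP[t0 tT] /andP[s0 st]; rewrite s0 (le_trans st).
have eE j t : 0 <= t <= T -> e t j = \int[leb]_(s in `[0, t]) rate j e s.
  move=> tT; rewrite /e (weak_coef j Wmu' tT) (weak_coef j Wmu tT) opprD addrACA subrr add0r.
  rewrite -RintegralB//; [|exact: rate_integrable..].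
  by apply: eq_Rintegral => s; rewrite inE/= in_itv/= => /(sub _ _ tT) sT; rewrite rate_sub.
suff e0 t j : 0 <= t <= T -> e t j = 0.
  move=> t tT.
  have i1 := in_L2_integrable (mu2.1 t tT); have i2 := in_L2_integrable (mu2'.1 t tT).
  have : {ae lebT d, forall x, mu' t x - mu t x = 0}.
    apply: torus_fourier_inj; first exact: integrable_subR.
    move=> j; rewrite -[RHS](e0 t j tT) /e /coef -RintegralB//; [|exact: integrable_phi..].
    by apply: eq_Rintegral => x _; rewrite mulrBl.
  by apply: filterS => x /eqP; rewrite subr_eq0 => /eqP.
move=> tT.
(* Adding the mode [j] itself treats frequencies above N together with those that drive the
   system. *)
pose S t := `|e t j| + \sum_(i <- modes N) `|e t i|.
pose C i := lam i + grad_phi_bound i K.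
have cS : {within `[0, T], continuous S}.
  move=> s; apply: cvgD; first by apply: cvg_norm; exact: ce.
  by apply: cvg_sumR => i; apply: cvg_norm; exact: ce.
have sumS s : \sum_(i <- modes N) `|e s i| <= S s by rewrite /S lerDr.
have bnd i s : 0 <= s <= T -> (forall s, `|e s i| <= S s) -> `|e s i| <= C i * \int[leb]_(r in `[0, s]) S r.
  move=> sT iS; rewrite eE//; have [s0 sT'] := andP sT.
  have cSs := within_subitv (lexx 0) sT' cS.
  apply: le_trans (le_normr_Rintegral _ (rate_integrable ce i sT)) _ => //.
  rewrite -RintegralZl//; last exact: within_continuous_integrable.
  apply: le_Rintegral => //.
  - exact: integrable_norm (rate_integrable ce i sT).
  - apply: within_continuous_integrable => r; apply: cvgM; first exact: cvg_cst.
    exact: cSs.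
  - move=> r; rewrite /= in_itv/= => /(sub _ _ sT) rT.
    apply: le_trans (ler_normD _ _) _; rewrite mulrDl lerD//.
      by rewrite normrM normrN (ger0_norm (lam0 i)) ler_wpM2l.
    by apply: le_trans (drift_le ce i bK rT) _; rewrite ler_wpM2l.
have C0 i : 0 <= C i by rewrite addr_ge0.
have : S t = 0.
  apply: (@gronwall _ T T0 S (C j + \sum_(i <- modes N) C i)) => //.
  - by rewrite addr_ge0// sumr_ge0.
  - by move=> s _; rewrite addr_ge0// sumr_ge0.
  - move=> s sT; rewrite mulrDl lerD//.
      by apply: bnd => // r; rewrite /S lerDl sumr_ge0.
    rewrite mulr_suml big_seq [leRHS]big_seq; apply: ler_sum => i iN; apply: bnd => // r.
    apply: le_trans (sumS r).
    by rewrite (perm_big _ (perm_to_rem iN)) big_cons lerDl sumr_ge0.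
have s0 : 0 <= \sum_(i <- modes N) `|e t i| by apply: sumr_ge0.
move/eqP; rewrite paddr_eq0//.
by rewrite normr_eq0 => /andP[/eqP].
Qed.

End coefficients.
End weak.

(** * The backward equation *)

Section backward.
Context {R : realType} {d : nat}.
Local Notation V := 'rV[R]_d.
Local Notation leb := (@lebesgue_measure R).
Local Notation mode := ('rV[int]_d * bool)%type.
Variables (T : R) (N : nat) (H : V -> V -> R) (dF dG : PT R d -> V -> R).
Hypothesis H2 : Cn 2 (fun z : V * V => H z.1 z.2).
Hypothesis H_torus : forall p, Zperiodic (fun x => H x p).
Hypotheses (cdF : forall mu, continuous (dF mu)) (pdF : forall mu, Zperiodic (dF mu)).
Hypotheses (cdG : forall mu, continuous (dG mu)) (pdG : forall mu, Zperiodic (dG mu)).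

Lemma is_derive_tsum M (c : mode -> R) (x v : V) :
  is_derive x v (tsum M c) (\sum_(j <- modes M) c j * 'D_v (phi j) x).
Proof.
rewrite /tsum; elim: (modes M) => [|j s IH].
  rewrite big_nil (_ : (fun x => _) = cst 0); first exact: is_derive_cst.
  by apply/funext => y; rewrite big_nil.
rewrite big_cons (_ : (fun x => _) =
    (fun y => c j * phi j y) + (fun y => \sum_(j <- s) c j * phi j y)); last first.
  by apply/funext => y; rewrite big_cons.
apply: is_deriveD.
have Dj : is_derive x v (phi j : V -> R) ('D_v (phi j) x).
  by apply: DeriveDef => //; exact: Cn_derivable (Cn_phi 1 j).
exact: (is_deriveZ (c j) Dj).
Qed.

Lemma dot_grad_tsum M (c : mode -> R) (x b : V) :
  dot (grad (tsum M c) x) b = \sum_(j <- modes M) c j * dot (grad (phi j) x) b.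
Proof.
rewrite dotE; under eq_bigr => i _.
  rewrite mxE /pderiv.
  have [_ ->] := is_derive_tsum M c x (delta_mx 0 i).
  rewrite mulr_suml; over.
rewrite exchange_big/=; apply: eq_bigr => j _.
rewrite dotE mulr_sumr; apply: eq_bigr => i _.
by rewrite mxE mulrA.
Qed.

Variables (mu u : R -> V -> R).
Hypothesis bw : classical_backward T N H dF dG mu u.

Lemma u_periodic t : 0 <= t <= T -> Zperiodic (u t).
Proof. by have [h _ _ _] := bw; move=> /h[]. Qed.

Lemma u_Cn t : 0 <= t <= T -> Cn 2 (u t).
Proof. by have [h _ _ _] := bw; move=> /h[]. Qed.

Lemma pderiv_periodic i (f : V -> R) : Zperiodic f -> Zperiodic (pderiv i f).
Proof. exact: periodic_derive. Qed.

Lemma grad_periodic (f : V -> R) : Zperiodic f -> Zperiodic (grad f).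
Proof. by move=> pf x k; apply/rowP => i; rewrite !mxE pderiv_periodic. Qed.

Lemma gradu_bound : exists C : R, forall t x, 0 <= t <= T -> `|grad (u t) x| <= C.
Proof.
have [_ [_ cu _] _ _] := bw.
have /choice[B hB] : forall i, exists B : R, forall t x, 0 <= t <= T -> `|pderiv i (u t) x| <= B.
  move=> i; apply: (slab_bounded (cu i)) => t tT.
  by apply: pderiv_periodic; exact: u_periodic.
exists (\sum_i `|B i|) => t x tT; apply: row_norm_le; first exact: sumr_ge0.
move=> i; rewrite mxE (le_trans (hB i t x tT))// (bigD1 i)//= (le_trans (ler_norm _))//.
by rewrite lerDl sumr_ge0.
Qed.

Definition Hu (t : R) (x : V) : R := H x (grad (u t) x).

Lemma Hu_integrable t : 0 <= t <= T -> (lebT d).-integrable setT (EFin \o Hu t).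
Proof.
move=> tT; have cH := Cn_continuous H2; have [C hC] := gradu_bound.
have [B hB] := periodic_pair_bounded C cH H_torus.
apply: (@integrable_bdd _ _ _ _ _ _ B) => //; last by move=> x _; apply: hB; exact: hC.
apply: (measurable_continuous_comp (g := grad (u t)) measurableT cH) => //.
apply: measurable_rowP => // i; rewrite (_ : (fun x => _) = pderiv i (u t)).
  by apply: continuous_measurable_row; exact: Cn_continuous (Cn_derive _ (u_Cn tT)).
by apply/funext => x; rewrite mxE.
Qed.

Lemma dF_integrable P : (lebT d).-integrable setT (EFin \o dF P).
Proof. exact: integrable_continuous. Qed.

Lemma dG_integrable P : (lebT d).-integrable setT (EFin \o dG P).
Proof. exact: integrable_continuous. Qed.

Let P t := dens (trunc N (mu t)).

Lemma coef_sub (f g : V -> R) j : (lebT d).-integrable setT (EFin \o f) ->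
  (lebT d).-integrable setT (EFin \o g) ->
  coef (fun x => f x - g x) j = coef f j - coef g j.
Proof.
move=> fi gi; rewrite /coef -RintegralB//; [|exact: integrable_phi..].
by apply: eq_Rintegral => x _; rewrite mulrBl.
Qed.

Lemma lapE (f : V -> R) x : lap f x = \sum_i pderiv i (pderiv i f) x.
Proof. by rewrite /lap /mxtrace; apply: eq_bigr => i _; rewrite mxE. Qed.

Lemma lap_integrable (f : V -> R) : Zperiodic f -> Cn 2 f ->
  (lebT d).-integrable setT (EFin \o lap f).
Proof.
move=> pf cf; rewrite (_ : lap f = (fun x => \sum_i pderiv i (pderiv i f) x)); last first.
  by apply/funext => x; rewrite lapE.
apply: integrable_sumR => // i; apply: integrable_continuous.
  exact: Cn_continuous (Cn_derive _ (Cn_derive _ cf)).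
by do 2 apply: pderiv_periodic.
Qed.

Lemma integrable_tsum M (c : mode -> R) : (lebT d).-integrable setT (EFin \o tsum M c).
Proof. by apply: integrable_continuous; [exact: continuous_tsum|exact: periodic_tsum]. Qed.

Lemma integrable_trunc M (f : V -> R) : (lebT d).-integrable setT (EFin \o f) ->
  (lebT d).-integrable setT (EFin \o trunc M f).
Proof. by move=> fi; rewrite trunc_tsum//; exact: integrable_tsum. Qed.

(** The witness is the coefficient of the time derivative of [u]: it is continuous up to the end
    points of [0, T], although differentiability is claimed in the interior. *)
Lemma coef_backward : exists a' : mode -> R -> R, forall j,
  [/\ {within `[0, T], continuous (fun t => coef (u t) j)},
      {within `[0, T], continuous (a' j)},
      forall t : R, 0 < t < T -> is_derive t (1 : R) (fun s => coef (u s) j) (a' j t) &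
      forall t, 0 <= t <= T -> a' j t = lam j * coef (u t) j
        + (coef (trunc N (Hu t)) j - coef (trunc N (dF (P t))) j)].
Proof.
have [hu [cu _ _] [ut [cut dut utE]] _] := bw.
(* Periodicity of the time derivative is not part of its definition and is read off from the
   equation. *)
have put t : 0 <= t <= T -> Zperiodic (ut t).
  move=> tT x k; rewrite !utE// (trunc_tsum _ (Hu_integrable tT)) (trunc_tsum _ (dF_integrable _)).
  have -> : lap (u t) (x + zvec k) = lap (u t) x.
    by rewrite (lapE (u t) x) lapE; apply: eq_bigr => i _; do 2 apply: pderiv_periodic; exact: u_periodic.
  by rewrite (periodic_tsum N (coef (Hu t)) x k) (periodic_tsum N (coef (dF (P t))) x k).
have pu t : 0 <= t <= T -> Zperiodic (u t) by exact: u_periodic.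
have du t x : 0 < t < T -> is_derive (t : R) (1 : R) (fun s => u s x) (ut t x).
  move=> tT; apply: (is_derive_within tT); apply: dut.
  by case/andP: tT => t0 tT; rewrite !ltW.
exists (fun j t => coef (ut t) j) => j; split.
- exact: coef_slab_continuous.
- exact: coef_slab_continuous.
- by move=> t tT; exact: (coef_slab_derive j cu cut pu put du tT).
- move=> t tT.
  rewrite (_ : ut t = (fun x => (trunc N (Hu t) x - trunc N (dF (P t)) x) - lap (u t) x)); last first.
    by apply/funext => x; rewrite utE// /Hu /P; ring.
  have i1 := integrable_trunc N (Hu_integrable tT).
  have i2 := integrable_trunc N (dF_integrable (P t)).
  have i3 := lap_integrable (u_periodic tT) (u_Cn tT).
  rewrite coef_sub//; last exact: integrable_subR.
  rewrite coef_sub// coef_lap; [|exact: u_periodic|exact: u_Cn].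
  by rewrite mulNr opprK addrC.
Qed.

Lemma coef_u_T j : j \in modes N -> coef (u T) j = coef (dG (P T)) j.
Proof.
move=> /mem_modes jN; have [_ _ _ uT] := bw.
have -> : u T = trunc N (dG (P T)) by apply/funext.
by rewrite coef_trunc_low//; exact: dG_integrable.
Qed.

(* [t |-> coef (u t) j * expR (- lam j * t)] is constant and vanishes at [T]. *)
Lemma coef_u_high j t : 0 <= t <= T -> (N < kabs j.1)%N -> coef (u t) j = 0.
Proof.
move=> tT jN; have [a' ha] := coef_backward; have [ca ca' da aE] := ha j.
have aE0 s : 0 <= s <= T -> a' j s = lam j * coef (u s) j.
  move=> sT; rewrite aE// !coef_trunc_high//; last exact: Hu_integrable.
    by rewrite subrr addr0.
  exact: dF_integrable.
have uT0 : coef (u T) j = 0.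
  have [_ _ _ uT] := bw.
  have -> : u T = trunc N (dG (P T)) by apply/funext.
  by rewrite coef_trunc_high//; exact: dG_integrable.
pose l : R := lam j.
pose w (s : R) : R := expR (- l * s).
have dw (s : R) : is_derive s (1 : R) w (- l * w s).
  have d1 : is_derive s (1 : R) (fun s : R => - l * s) (- l).
    by apply: is_derive_eq; rewrite [_%:A]mulr1.
  have := @is_derive1_comp _ _ _ s _ _ (is_derive_expR (- l * s)) d1.
  by rewrite mulrC.
have cw : continuous w.
  by move=> s; apply: differentiable_continuous; apply/derivable1_diffP; have [] := dw s.
have [t0 tT'] := andP tT.
have E : \int[leb]_(r in `[t, T]) (0 : R) = coef (u T) j * w T - coef (u t) j * w t.
  apply: (@within_FTC2 _ (fun s => coef (u s) j * w s)) => //.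
  - apply: (within_subitv t0 (lexx T)) => s; apply: cvgM; first exact: ca.
    exact: (continuous_subspaceT cw).
  - by apply: continuous_subspaceT => s; exact: cvg_cst.
  - move=> s /andP[ts sT]; have s0 : 0 < s by exact: le_lt_trans ts.
    have sT' : 0 < s < T by rewrite s0.
    have := @is_deriveM _ _ _ _ s 1 _ _ (da s sT') (dw s).
    rewrite aE0 ?(ltW s0) ?(ltW sT)//; congr (is_derive _ _ _ _).
    by rewrite /GRing.scale/= /l; ring.
move: E; rewrite Rintegral_cst// mul0r uT0 mul0r sub0r => /esym.
by move/eqP; rewrite oppr_eq0 mulf_eq0 (gt_eqF (expR_gt0 _)) orbF => /eqP.
Qed.

(** The difference between [u t] and its truncation has only zero coefficients; being continuous, it
    vanishes everywhere and not just almost everywhere. *)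
Lemma u_trig t : 0 <= t <= T -> u t = tsum N (coef (u t)).
Proof.
move=> tT; have cu := Cn_continuous (u_Cn tT); have pu := u_periodic tT.
have iu := integrable_continuous cu pu.
apply/funext => x; apply/eqP; rewrite -subr_eq0 -(trunc_tsum N iu); apply/eqP.
pose g y := u t y - trunc N (u t) y.
apply: (@ae0_continuous _ _ g) => //.
- move=> y; rewrite /g trunc_tsum//.
  by apply: continuousB; [exact: cu|exact: continuous_tsum].
- by move=> y k; rewrite /g trunc_tsum// periodic_tsum pu.
- have itr := integrable_trunc N iu.
  apply: torus_fourier_inj; first exact: integrable_subR.
  move=> j; rewrite coef_sub//.
  have [jN|jN] := leqP (kabs j.1) N; first by rewrite coef_trunc_low// subrr.
  by rewrite coef_trunc_high// coef_u_high// subrr.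
Qed.

Lemma dot_gradu t x b : 0 <= t <= T ->
  dot (grad (u t) x) b = \sum_(j <- modes N) coef (u t) j * dot (grad (phi j) x) b.
Proof. by move=> tT; rewrite {1}(u_trig tT) dot_grad_tsum. Qed.

(** The finite expansion of [u] gives joint measurability at once: each term is a continuous
    function of time times a mode. *)
Lemma gradu_field : slab_field T (fun t x => grad (u t) x).
Proof.
have [a' ha] := coef_backward.
apply: slab_field_rowP => i.
have bm : slab_bm T (fun t x => \sum_(j <- modes N) coef (u t) j *
    ((-1) ^+ j.2 * (2 * pi * (j.1 0 i)%:~R) * phi (j.1, ~~ j.2) x)).
  apply: slab_bm_sum => j; apply: slab_bmM; first by apply: slab_bm_time; have [] := ha j.
  apply: slab_bmM; last exact: slab_bm_phi.
  by apply: (@slab_bm_space _ _ _ _ `|(-1) ^+ j.2 * (2 * pi * (j.1 0 i)%:~R)|).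
have E t x : 0 <= t <= T -> grad (u t) x 0 i = \sum_(j <- modes N) coef (u t) j *
    ((-1) ^+ j.2 * (2 * pi * (j.1 0 i)%:~R) * phi (j.1, ~~ j.2) x).
  move=> tT; rewrite -dot_delta dot_gradu//; apply: eq_bigr => -[k e] _.
  by rewrite dot_delta mxE pderiv_phi.
have [mb [B hB]] := bm; split; last by exists B => t x tT; rewrite E// hB.
apply: eq_measurable_fun mb => -[t x]; rewrite inE => -[/= + _]; rewrite in_itv/= => tT.
by rewrite E.
Qed.

Lemma slab_bm_Hu : slab_bm T Hu.
Proof.
have oK c : open [set z : V * V | c < H z.1 z.2].
  rewrite (_ : mkset _ = (fun z : V * V => H z.1 z.2) @^-1` [set y | c < y])//.
  by apply: open_comp; [move=> z _; exact: (Cn_continuous H2)|exact: open_gt].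
have bK C : exists B : R, forall x p : V, `|p| <= C -> `|H x p| <= B.
  by apply: (periodic_pair_bounded (f := fun z => H z.1 z.2)) => //; exact: Cn_continuous H2.
exact: (@slab_field_id_comp _ _ _ (fun z : V * V => H z.1 z.2) _ oK bK gradu_field).
Qed.

Lemma feedback_field : slab_field T (feedback H u).
Proof.
apply: slab_field_rowP => i.
pose K (z : V * V) := gH H z.1 z.2 0 i.
have cK : continuous K by exact: continuous_gH_coord.
have oK c : open [set z : V * V | c < K z].
  rewrite (_ : mkset _ = K @^-1` [set y | c < y])//.
  by apply: open_comp; [move=> z _; exact: cK|exact: open_gt].
have bK C : exists B : R, forall x p : V, `|p| <= C -> `|K (x, p)| <= B.
  by apply: periodic_pair_bounded => // p x k; rewrite /K /gH /= H_periodic.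
have := slab_bmN (@slab_field_id_comp _ _ _ K _ oK bK gradu_field).
congr (slab_bm _ _); apply/funext => t; apply/funext => x.
by rewrite /feedback mxE.
Qed.

Lemma feedback_periodic t : 0 <= t <= T -> Zperiodic (feedback H u t).
Proof.
move=> tT x k; rewrite /feedback grad_periodic; last exact: u_periodic.
have -> : H (x + zvec k) = H x by apply/funext => p; exact: H_torus.
by [].
Qed.

End backward.

(** * Verification *)

Section paths.
Context {R : realType} {d : nat}.
Local Notation V := 'rV[R]_d.
Local Notation mode := ('rV[int]_d * bool)%type.
Variables (T : R) (N : nat).

(** This turns the sums over modes of the duality argument back into integrals over the torus. *)
Lemma sum_coef_tsum (f : V -> R) (c : mode -> R) : (lebT d).-integrable setT (EFin \o f) ->
  \sum_(j <- modes N) coef f j * c j = \int[lebT d]_x (f x * tsum N c x).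
Proof.
move=> fi; transitivity (\int[lebT d]_x \sum_(j <- modes N) (c j * (f x * phi j x))).
  rewrite Rintegral_sum//; last by move=> j; apply: integrable_scale => //; exact: integrable_phi.
  apply: eq_bigr => j _; rewrite RintegralZl//; last exact: integrable_phi.
  by rewrite mulrC.
apply: eq_Rintegral => x _; rewrite mulr_sumr; apply: eq_bigr => j _; ring.
Qed.

(** Flows are determined up to null sets, but their truncations, and hence the costs, do not depend
    on the representative. *)
Lemma ae_eq_trunc (f g : V -> R) : in_L2 f -> in_L2 g ->
  {ae lebT d, forall x, f x = g x} -> trunc N f = trunc N g.
Proof.
move=> f2 g2 fg; have fi := in_L2_integrable f2; have gi := in_L2_integrable g2.
rewrite !trunc_tsum//; congr (tsum N _); apply/funext => j.
rewrite /coef /Rintegral; congr fine; apply: ae_eq_integral => //.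
- exact: measurable_int (integrable_phi j fi).
- exact: measurable_int (integrable_phi j gi).
- by move: fg; apply: filterS => x fgx _; rewrite fgx.
Qed.

Section one_path.
Variables (m : V -> R) (b : R -> V -> V) (nu : R -> V -> R).
Hypothesis W : weak_solution T N m b nu.
Hypothesis D : forall t, 0 <= t <= T -> is_density (trunc N (nu t)).

Definition tpath t : V -> R := tsum N (coef (nu t)).

Lemma coef_path_continuous j : {within `[0, T], continuous (fun t => coef (nu t) j)}.
Proof. by have [nu2 _ _] := W; exact: in_CL2_coef. Qed.

Lemma trunc_path t : 0 <= t <= T -> trunc N (nu t) = tpath t.
Proof.
move=> tT; have [[nu2 _] _ _] := W.
by rewrite trunc_tsum//; exact: in_L2_integrable (nu2 t tT).
Qed.

Lemma path_density t : 0 <= t <= T -> has_density (dens (trunc N (nu t))) (tpath t).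
Proof. by move=> tT; rewrite -(trunc_path tT); exact: dens_density (D tT). Qed.

Lemma path_bm : slab_bm T tpath.
Proof. by apply: slab_bm_tsum => j; exact: coef_path_continuous. Qed.

Lemma path_bounded t : exists K : R, forall x, `|tpath t x| <= K.
Proof. by exists (\sum_(j <- modes N) `|coef (nu t) j|) => x; exact: tsum_le. Qed.

Lemma path_ge0 t : 0 <= t <= T -> {ae lebT d, forall x, 0 <= tpath t x}.
Proof. by move=> tT; have [] := path_density tT. Qed.

(** The other alternative of [tsum_dichotomy], an identically zero function, cannot be a probability
    density. *)
Lemma path_neq0 t : 0 <= t <= T -> {ae lebT d, forall x, tpath t x != 0}.
Proof.
move=> tT; have [//|p0] := tsum_dichotomy N (coef (nu t)).
have [_ _ _ /(_ setT measurableT)] := path_density tT.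
rewrite [LHS]probability_setT; under eq_integral => x _ do rewrite [tpath t x]p0.
by rewrite integral0 => /eqP; rewrite onee_eq0.
Qed.

Section functional.
Variables (q : nat) (F : PT R d -> R) (dF : PT R d -> V -> R).
Hypothesis F_C1 : C1_with_deriv F dF.
Hypothesis dF_Cq : derivative_Cq q dF.
Hypothesis dF_lip : derivative_L2_lipschitz dF.

(** The sum of the coefficient differences bounds the uniform distance of two truncated flows, and
    [C1_lipschitz] transfers it to the functional. This makes the running cost integrable in
    time. *)
Lemma functional_path_continuous :
  {within `[0, T], continuous (fun t => F (dens (trunc N (nu t))))}.
Proof.
have [K K0 hK] := dF_bounded dF_Cq.
apply/subspace_continuousP => t tT'.
have tT : 0 <= t <= T by move: tT'; rewrite /= in_itv.
pose S s := \sum_(j <- modes N) `|coef (nu t) j - coef (nu s) j|.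
have cS : {within `[0, T], continuous S}.
  move=> s; apply: cvg_sumR => j; apply: cvg_norm; apply: cvgB; first exact: cvg_cst.
  exact: coef_path_continuous.
have S0 : K * S t = 0.
  by rewrite /S big1 ?mulr0// => j _; rewrite subrr normr0.
have cKS : (fun s => K * S s) @ within `[0, T] (nbhs t) --> (0 : R).
  rewrite -[X in _ --> X]S0; apply: cvgM; first exact: cvg_cst.
  exact: ((subspace_continuousP _ _).1 cS t tT').
apply/cvgrPdist_lt => e e0.
move/cvgrPdist_lt : cKS => /(_ e e0); rewrite !near_withinE.
apply: (@filterS _ (nbhs t)) => s Hs sT'.
have sT : 0 <= s <= T by move: sT'; rewrite /= in_itv.
have := Hs sT'; rewrite sub0r normrN; apply: le_lt_trans.
apply: le_trans (ler_norm _).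
apply: (C1_lipschitz F_C1 dF_Cq dF_lip (path_density tT) (path_density sT)) => //.
- move=> x; rewrite /tpath /tsum -sumrB (le_trans (ler_norm_sum _ _ _))//.
  by apply: ler_sum => j _; rewrite -mulrBl normrM ler_piMr//; exact: phi_le1.
- exact: path_bounded.
- exact: path_bounded.
Qed.

End functional.

Lemma integral_path (f : R -> V -> R) t : slab_bm T f -> 0 <= t <= T ->
  \int[dens (trunc N (nu t))]_x f t x = \int[lebT d]_x (f t x * tpath t x).
Proof.
move=> [mf [B hB]] tT; apply: (integral_density (K := B) (path_density tT)).
  exact: measurable_slice_slab mf.
by move=> x; exact: hB.
Qed.

End one_path.
End paths.

Section integral_algebra.
Context dd (S : measurableType dd) {R : realType} (mu : {measure set S -> \bar R}) (D : set S).
Hypothesis mD : measurable D.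
Variables f g h : S -> R.
Hypotheses (fi : mu.-integrable D (EFin \o f)) (gi : mu.-integrable D (EFin \o g)).

Lemma Rintegral_add3 : mu.-integrable D (EFin \o h) ->
  \int[mu]_(x in D) (f x + g x + h x) =
  \int[mu]_(x in D) f x + \int[mu]_(x in D) g x + \int[mu]_(x in D) h x.
Proof. by move=> hi; rewrite RintegralD// ?RintegralD//; exact: integrable_addR. Qed.

Lemma Rintegral_oppD : \int[mu]_(x in D) (- (f x + g x)) =
  - (\int[mu]_(x in D) f x) - \int[mu]_(x in D) g x.
Proof.
rewrite -opprD -RintegralD// -mulN1r -RintegralZl//; last exact: integrable_addR.
by apply: eq_Rintegral => x _; rewrite mulN1r.
Qed.

End integral_algebra.

Lemma subrDl {R : zmodType} (c x y : R) : (c + x) - (c + y) = x - y.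
Proof. by rewrite opprD addrACA subrr add0r. Qed.

(** The eigenvalue terms of the backward and forward equations cancel, which is self-adjointness of
    the Laplacian in one mode. *)
Lemma mode_energy {R : comRingType} (l a cH cF x y rx ry : R) :
  (l * a + (cH - cF)) * (x - y) + a * ((- l * x + rx) - (- l * y + ry)) =
  cH * (x - y) - cF * (x - y) + (a * rx - a * ry).
Proof. ring. Qed.

(** The bookkeeping of [path_cost_gap] at a fixed time: [e] is the integrated gap,
    [h - f + (a2 - a5)] the pairing, [lr] and [ls] the two Lagrangian costs, and [f <= g - g'] the
    convexity of F. *)
Lemma energy_split {R : realDomainType} (e lr ls h a1 a2 a3 a4 a5 f g g' : R) :
  e = a1 + a2 + a3 -> lr = a1 -> ls = - a5 - a4 -> h = a3 - a4 -> f <= g - g' ->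
  e - (h - f + (a2 - a5)) <= (g + lr) - (g' + ls).
Proof. by move=> -> -> -> ->; lra. Qed.

Lemma Rintegral_eq0_ae dd (S : measurableType dd) {R : realType}
    (mu : {measure set S -> \bar R}) (D : set S) (f : S -> R) : measurable D ->
  mu.-integrable D (EFin \o f) -> (forall x, D x -> 0 <= f x) ->
  \int[mu]_(x in D) f x = 0 -> {ae mu, forall x, D x -> f x = 0}.
Proof.
move=> mD fi f0 if0.
have mf := measurable_int _ fi.
have : (\int[mu]_(x in D) `|(EFin \o f) x| = 0)%E.
  transitivity (\int[mu]_(x in D) (EFin \o f) x)%E.
    by apply: eq_integral => x; rewrite inE => Dx; rewrite /= ger0_norm// f0.
  by rewrite -(fineK (integrable_fin_num mD fi)) [X in X%:E]if0.
move/(ae_eq_integral_abs mu mD mf).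
by apply: filterS => x h Dx; have [] := h Dx.
Qed.

Section verification.
Context {R : realType} {d : nat}.
Local Notation mR := (measurableTypeR R).
Local Notation V := 'rV[R]_d.
Local Notation leb := (@lebesgue_measure R).
Local Notation mode := ('rV[int]_d * bool)%type.
Variables (T : R) (N q : nat) (F G : PT R d -> R) (dF dG : PT R d -> V -> R)
  (L H : V -> V -> R) (CH : R).
Hypothesis T0 : 0 < T.
Hypotheses (F_C1 : C1_with_deriv F dF) (G_C1 : C1_with_deriv G dG).
Hypotheses (dF_Cq : derivative_Cq q dF) (dG_Cq : derivative_Cq q dG).
Hypotheses (dF_lip : derivative_L2_lipschitz dF) (dG_lip : derivative_L2_lipschitz dG).
Hypotheses (F_convex : convexPT F) (G_convex : convexPT G).
Hypothesis H_torus : forall p, Zperiodic (fun x => H x p).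
Hypothesis LH : fenchel_pair L H.
Hypothesis H2 : Cn 2 (fun z : V * V => H z.1 z.2).
Hypothesis CH0 : 0 < CH.
Hypothesis Hconv : forall x p xi : V, CH^-1 * dot xi xi <= dot (xi *m hess (H x) p) xi.

Variables (m : V -> R) (mu u : R -> V -> R).
Hypothesis fb : fb_solution T N H dF dG m mu u.

Let al := feedback H u.

Let cdF P : continuous (dF P). Proof. exact: dF_continuous dF_Cq _. Qed.
Let cdG P : continuous (dG P). Proof. exact: dF_continuous dG_Cq _. Qed.
Let pdF P : Zperiodic (dF P). Proof. by have [_ _ p _ _] := F_C1. Qed.
Let pdG P : Zperiodic (dG P). Proof. by have [_ _ p _ _] := G_C1. Qed.
Let bw : classical_backward T N H dF dG mu u. Proof. by case: fb. Qed.
Let Wmu : weak_solution T N m al mu. Proof. by case: fb. Qed.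
Let Dmu t : 0 <= t <= T -> is_density (trunc N (mu t)). Proof. by case: fb => _ _; exact. Qed.
Let al_field : slab_field T al.
Proof. exact: (feedback_field H2 H_torus cdF pdF cdG pdG bw). Qed.
Let gu_field : slab_field T (fun t x => grad (u t) x).
Proof. exact: (gradu_field H2 H_torus cdF pdF cdG pdG bw). Qed.
Let Hu_bm : slab_bm T (Hu H u).
Proof. exact: (slab_bm_Hu H2 H_torus cdF pdF cdG pdG bw). Qed.

Let P t := dens (trunc N (mu t)).
Local Notation sig := (tpath N mu).

Section competitor.
Variables (b : R -> V -> V) (nu : R -> V -> R).
Hypothesis hb : slab_field T b.
Hypothesis W : weak_solution T N m b nu.
Hypothesis D : forall t, 0 <= t <= T -> is_density (trunc N (nu t)).
Local Notation rho := (tpath N nu).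

Lemma sum_coef_drift c (k : R -> mode -> R) t : slab_field T c ->
  (forall j, {within `[0, T], continuous (fun t => k t j)}) -> 0 <= t <= T ->
  \sum_(j <- modes N) coef (u t) j * drift N c j k t =
  \int[lebT d]_x (dot (grad (u t) x) (c t x) * tsum N (k t) x).
Proof.
move=> hc ck tT.
have ij j := slab_bm_int (drift_bm N hc ck j) tT.
transitivity (\int[lebT d]_x \sum_(j <- modes N)
    (coef (u t) j * (dot (grad (phi j) x) (c t x) * tsum N (k t) x))).
  rewrite Rintegral_sum//; last by move=> j; exact: integrable_scale.
  by apply: eq_bigr => j _; rewrite RintegralZl.
apply: eq_Rintegral => x _; rewrite (dot_gradu H2 H_torus cdF pdF cdG pdG bw)// mulr_suml.
by apply: eq_bigr => j _; rewrite mulrA.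
Qed.

(** Formally the time derivative of the integral of u^N against [rho - sig], once both equations
    have been used to eliminate time derivatives. *)
Definition pairing (s : R) : R :=
  \int[lebT d]_x (Hu H u s x * (rho s x - sig s x)) -
  \int[lebT d]_x (dF (P s) x * (rho s x - sig s x)) +
  (\int[lebT d]_x (dot (grad (u s) x) (b s x) * rho s x) -
   \int[lebT d]_x (dot (grad (u s) x) (al s x) * sig s x)).

Let sum_coef_diff (f : V -> R) s : (lebT d).-integrable setT (EFin \o f) ->
  \int[lebT d]_x (f x * (rho s x - sig s x)) =
  \sum_(j <- modes N) coef f j * (coef (nu s) j - coef (mu s) j).
Proof.
move=> fi; rewrite sum_coef_tsum//; apply: eq_Rintegral => x _; congr (_ * _).
by rewrite /tpath /tsum -sumrB; apply: eq_bigr => j _; rewrite mulrBl.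
Qed.

Lemma duality : leb.-integrable `[0, T] (EFin \o pairing) /\
  \int[leb]_(s in `[0, T]) pairing s = \int[lebT d]_x (dG (P T) x * (rho T x - sig T x)).
Proof.
have [a' ha] := coef_backward H2 H_torus cdF pdF bw.
pose cnu s := coef (nu s); pose cmu s := coef (mu s).
have ccnu := coef_path_continuous W; have ccmu := coef_path_continuous Wmu.
pose h j s := rate N b j cnu s - rate N al j cmu s.
have TT : 0 <= T <= T by rewrite lexx ltW.
(* Both flows start from [m], so the initial coefficients cancel and no boundary term at time 0
   survives. *)
have hE j t : 0 <= t <= T -> \int[leb]_(s in `[0, t]) h j s = coef (nu t) j - coef (mu t) j.
  move=> tT.
  have e1 : coef (nu t) j = coef m j + \int[leb]_(s in `[0, t]) rate N b j cnu s by exact: weak_coef W tT.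
  have e2 : coef (mu t) j = coef m j + \int[leb]_(s in `[0, t]) rate N al j cmu s by exact: weak_coef Wmu tT.
  have i1 := rate_integrable N T0 hb ccnu j tT; have i2 := rate_integrable N T0 al_field ccmu j tT.
  have e3 : \int[leb]_(s in `[0, t]) h j s =
      \int[leb]_(s in `[0, t]) rate N b j cnu s - \int[leb]_(s in `[0, t]) rate N al j cmu s.
    exact: (RintegralB _ i1 i2).
  rewrite e3 e1 e2; exact/esym/subrDl.
pose K j s := a' j s * (\int[leb]_(r in `[0, s]) h j r) + coef (u s) j * h j s.
have ibp j : leb.-integrable `[0, T] (EFin \o K j) /\
    \int[leb]_(s in `[0, T]) K j s = coef (u T) j * \int[leb]_(s in `[0, T]) h j s.
  have [ca ca' da _] := ha j.
  have [m1 [B1 hB1]] := rate_bm N T0 hb ccnu j.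
  have [m2 [B2 hB2]] := rate_bm N T0 al_field ccmu j.
  have mh : measurable_fun `[0, T] (h j) by exact: (measurable_funB m1 m2).
  have hh t : 0 <= t <= T -> `|h j t| <= B1 + B2.
    by move=> tT; exact: le_trans (ler_normB _ _) (lerD (hB1 _ tT) (hB2 _ tT)).
  exact: (@time_ibp R T T0 _ _ (h j) (B1 + B2) ca ca' da mh hh).
have KE s : 0 <= s <= T -> \sum_(j <- modes N) K j s = pairing s.
  move=> sT.
  have iH := Hu_integrable H2 H_torus bw sT.
  have iF := dF_integrable cdF pdF (P s).
  have E1 := sum_coef_drift hb (coef_path_continuous W) sT.
  have E2 := sum_coef_drift al_field (coef_path_continuous Wmu) sT.
  rewrite /pairing (sum_coef_diff s iH) (sum_coef_diff s iF) -[X in _ + (X - _)]E1 -[X in _ - X]E2.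
  rewrite -!sumrB -big_split/= big_seq [RHS]big_seq; apply: eq_bigr => j /mem_modes jN.
  have [_ _ _ aE] := ha j.
  (* For modes up to N the coefficients of the truncated right-hand side are those of the
     untruncated one; this is where self-adjointness of the truncation enters. *)
  rewrite /K hE// aE// !coef_trunc_low//.
  exact: mode_energy.
have iK : leb.-integrable `[0, T] (EFin \o (fun s => \sum_(j <- modes N) K j s)).
  by apply: integrable_sumR => // j; have [] := ibp j.
split.
  by apply: eq_integrable iK => // s; rewrite inE/= in_itv/= => sT; rewrite KE.
transitivity (\int[leb]_(s in `[0, T]) \sum_(j <- modes N) K j s).
  by apply: eq_Rintegral => s; rewrite inE/= in_itv/= => sT; rewrite KE.
rewrite Rintegral_sum//; last by move=> j; have [] := ibp j.
have iG := dF_integrable cdG pdG (P T).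
rewrite (sum_coef_diff T iG) big_seq [RHS]big_seq; apply: eq_bigr => j jN.
have [_ ->] := ibp j.
by rewrite hE// (coef_u_T cdG pdG bw jN).
Qed.

Definition gap (s : R) (x : V) : R :=
  L x (b s x) + dot (b s x) (grad (u s) x) + Hu H u s x.

Lemma gap_ge0 s x : 0 <= gap s x.
Proof. by have := fenchel_ge LH x (b s x) (grad (u s) x); rewrite /gap /Hu; lra. Qed.

Lemma L_bm (c : R -> V -> V) : slab_field T c -> slab_bm T (fun s x => L x (c s x)).
Proof.
move=> hc; have oL e := @open_fenchel _ _ _ H2 _ LH e.
have bL C : exists B : R, forall x p : V, `|p| <= C -> `|L x p| <= B.
  exact: (fenchel_bounded H2 CH0 Hconv H_torus LH).
exact: (@slab_field_id_comp _ _ _ (fun z : V * V => L z.1 z.2) _ oL bL hc).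
Qed.

Lemma gap_bm : slab_bm T gap.
Proof.
apply: slab_bmD => //; apply: slab_bmD; first exact: L_bm.
exact: slab_bm_dot.
Qed.

(** The cost along an explicitly given flow. It separates the estimates from the flow chosen in
    [controlled], which agrees with [mu] only almost everywhere. *)
Definition path_cost (c : R -> V -> V) (eta : R -> V -> R) : R :=
  G (dens (trunc N (eta T))) +
  \int[leb]_(s in `[0, T])
    (F (dens (trunc N (eta s))) + \int[dens (trunc N (eta s))]_x L x (c s x)).

Lemma eq_path_cost c eta eta' :
  (forall t, 0 <= t <= T -> trunc N (eta t) = trunc N (eta' t)) ->
  path_cost c eta = path_cost c eta'.
Proof.
move=> E; have TT : 0 <= T <= T by rewrite lexx ltW.
rewrite /path_cost (E T TT); apply: (f_equal (fun y => _ + y)).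
by apply: eq_Rintegral => s; rewrite inE/= in_itv/= => sT; rewrite (E s sT).
Qed.

Lemma running_integrable (c : R -> V -> V) (eta : R -> V -> R) : slab_field T c ->
  weak_solution T N m c eta -> (forall t, 0 <= t <= T -> is_density (trunc N (eta t))) ->
  leb.-integrable `[0, T] (EFin \o (fun s => F (dens (trunc N (eta s))) +
    \int[dens (trunc N (eta s))]_x L x (c s x))).
Proof.
move=> hc We De; apply: integrable_addR => //.
  apply: within_continuous_integrable.
  exact: (functional_path_continuous We De F_C1 dF_Cq dF_lip).
have := slab_bm_time_integrable T0 (slab_bmM (L_bm hc) (path_bm We)).
apply: eq_integrable => // s; rewrite inE/= in_itv/= => sT.
by rewrite (integral_path We De (L_bm hc)).
Qed.

Lemma path_cost_gap :
  \int[leb]_(s in `[0, T]) \int[lebT d]_x (gap s x * rho s x) <=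
  path_cost b nu - path_cost al mu.
Proof.
have TT : 0 <= T <= T by rewrite lexx ltW.
have [ip dual] := duality.
have ir := running_integrable hb W D.
have ia := running_integrable al_field Wmu Dmu.
have ig := slab_bm_time_integrable T0 (slab_bmM gap_bm (path_bm W)).
have dist s : exists B : R, forall x, `|rho s x - sig s x| <= B.
  have [B1 h1] := path_bounded N nu s; have [B2 h2] := path_bounded N mu s.
  by exists (B1 + B2) => x; rewrite (le_trans (ler_normB _ _))// lerD.
have GT : \int[lebT d]_x (dG (P T) x * (rho T x - sig T x)) <=
    G (dens (trunc N (nu T))) - G (P T).
  have [B hB] := dist T.
  apply: (convex_first_order G_C1 dG_Cq dG_lip (path_density W D TT)
    (path_density Wmu Dmu TT) hB) => //; exact: path_bounded.
suff : \int[leb]_(s in `[0, T]) (\int[lebT d]_x (gap s x * rho s x) - pairing s) <=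
    \int[leb]_(s in `[0, T])
      ((F (dens (trunc N (nu s))) + \int[dens (trunc N (nu s))]_x L x (b s x)) -
       (F (dens (trunc N (mu s))) + \int[dens (trunc N (mu s))]_x L x (al s x))).
  rewrite [X in X <= _](RintegralB _ ig ip)// [X in _ <= X](RintegralB _ ir ia)// dual => h.
  have {}h := lerD h GT; rewrite subrK in h; apply: le_trans h _.
  by rewrite /path_cost [leLHS]addrC [leLHS]addrACA -opprD.
apply: le_Rintegral; [by []|exact: (integrable_subR _ ig ip)|exact: (integrable_subR _ ir ia)|].
move=> s; rewrite /= in_itv/= => sT.
have FT : \int[lebT d]_x (dF (P s) x * (rho s x - sig s x)) <=
    F (dens (trunc N (nu s))) - F (P s).
  have [B hB] := dist s.
  apply: (convex_first_order F_C1 dF_Cq dF_lip (path_density W D sT)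
    (path_density Wmu Dmu sT) hB) => //; exact: path_bounded.
have E4 : \int[dens (trunc N (nu s))]_x L x (b s x) = \int[lebT d]_x (L x (b s x) * rho s x).
  exact: (integral_path W D (L_bm hb) sT).
have E5 : \int[dens (trunc N (mu s))]_x L x (al s x) = \int[lebT d]_x (L x (al s x) * sig s x).
  exact: (integral_path Wmu Dmu (L_bm al_field) sT).
have bmr := path_bm W; have bms := path_bm Wmu.
have bmI k : slab_bm T k -> (lebT d).-integrable setT (EFin \o k s).
  by move=> hk; exact: (slab_bm_int hk sT).
have i1 := bmI _ (slab_bmM (L_bm hb) bmr).
have i2 := bmI _ (slab_bmM (slab_bm_dot hb gu_field) bmr).
have i2' := bmI _ (slab_bmM (slab_bm_dot gu_field hb) bmr).
have i3 := bmI _ (slab_bmM Hu_bm bmr).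
have i4 := bmI _ (slab_bmM Hu_bm bms).
have i5 := bmI _ (slab_bmM (slab_bm_dot gu_field al_field) bms).
have E1 : \int[lebT d]_x (gap s x * rho s x) =
    \int[lebT d]_x (L x (b s x) * rho s x) +
    \int[lebT d]_x (dot (grad (u s) x) (b s x) * rho s x) +
    \int[lebT d]_x (Hu H u s x * rho s x).
  rewrite -(Rintegral_add3 measurableT i1 i2' i3).
  by apply: eq_Rintegral => x _; rewrite /gap (dotC (b s x)) !mulrDl.
have E2 : \int[lebT d]_x (Hu H u s x * (rho s x - sig s x)) =
    \int[lebT d]_x (Hu H u s x * rho s x) - \int[lebT d]_x (Hu H u s x * sig s x).
  by rewrite -(RintegralB measurableT i3 i4); apply: eq_Rintegral => x _; rewrite mulrBr.
(* Along the feedback the Fenchel inequality is an equality, so the Lagrangian can be eliminated. *)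
have E3 : \int[lebT d]_x (L x (al s x) * sig s x) =
    - (\int[lebT d]_x (dot (grad (u s) x) (al s x) * sig s x)) -
      \int[lebT d]_x (Hu H u s x * sig s x).
  apply: etrans (Rintegral_oppD measurableT i5 i4); apply: eq_Rintegral => x _ /=.
  rewrite /al /feedback -/(gH H x (grad (u s) x)) (fenchel_feedback H2 CH0 Hconv LH).
  by rewrite dotNr (dotC (gH _ _ _)) mulrBl opprD mulNr opprK.
exact: (energy_split E1 E4 (etrans E5 E3) E2 FT).
Qed.

(** The density [rho] is nonnegative only almost everywhere; the absolute value makes the integrand
    nonnegative at every point. *)
Lemma gap_cost_ge0 s : 0 <= s <= T ->
  \int[lebT d]_x (gap s x * rho s x) = \int[lebT d]_x (gap s x * `|rho s x|).
Proof.
move=> sT; have bm := slab_bmM gap_bm (path_bm W).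
have i1 := slab_bm_int bm sT.
rewrite /Rintegral; congr fine; apply: ae_eq_integral => //.
- exact: measurable_int i1.
- apply/measurable_EFinP; apply: measurable_funM.
    by apply/measurable_EFinP; exact: measurable_int (slab_bm_int gap_bm sT).
  apply: measurableT_comp => //.
  by apply/measurable_EFinP; exact: measurable_int (slab_bm_int (path_bm W) sT).
- by have := path_ge0 W D sT; apply: filterS => x r0 _; rewrite ger0_norm.
Qed.

Let gap_abs_bm : slab_bm T (fun s x => gap s x * `|rho s x|).
Proof.
apply: slab_bmM; first exact: gap_bm.
have [mr [B hB]] := path_bm W; split; first exact: measurableT_comp.
by exists B => t x tT; rewrite normr_id hB.
Qed.

Let gap_abs_ge0 s x : 0 <= gap s x * `|rho s x|.
Proof. by rewrite mulr_ge0// gap_ge0. Qed.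

Lemma total_gap_ge0 : 0 <= \int[leb]_(s in `[0, T]) \int[lebT d]_x (gap s x * rho s x).
Proof.
apply: Rintegral_ge0 => s; rewrite /= in_itv/= => sT.
by rewrite gap_cost_ge0//; apply: Rintegral_ge0 => x _; exact: gap_abs_ge0.
Qed.

Lemma total_gap_eq0 : \int[leb]_(s in `[0, T]) \int[lebT d]_x (gap s x * rho s x) = 0 ->
  {ae leb, forall s, 0 <= s <= T -> {ae lebT d, forall x, gap s x = 0}}.
Proof.
move=> g0.
have gi := slab_bm_time_integrable T0 (slab_bmM gap_bm (path_bm W)).
have ge s : `[0, T]%classic s -> 0 <= \int[lebT d]_x (gap s x * rho s x).
  rewrite /= in_itv/= => sT; rewrite gap_cost_ge0//.
  by apply: Rintegral_ge0 => x _; exact: gap_abs_ge0.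
have mI : measurable (`[0, T]%classic : set mR) by exact: measurable_itv.
have := Rintegral_eq0_ae mI gi ge g0.
apply: filterS => s h sT; have {h} : \int[lebT d]_x (gap s x * rho s x) = 0 by apply: h; rewrite /= in_itv.
rewrite gap_cost_ge0// => h.
have := Rintegral_eq0_ae measurableT (slab_bm_int gap_abs_bm sT) (fun x _ => gap_abs_ge0 s x) h.
apply: filterS2 (path_neq0 W D sT) => x r0 /(_ I)/eqP.
by rewrite mulf_eq0 normr_eq0 (negbTE r0) orbF => /eqP.
Qed.

Lemma gap_eq0 s x : gap s x = 0 -> b s x = al s x.
Proof.
move=> g0; apply: (fenchel_eq H2 LH (p := grad (u s) x)).
by move: g0; rewrite /gap /Hu => g0; apply/eqP; rewrite -subr_eq0 opprB opprK addrA addrAC g0.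
Qed.

(** For almost every time the gap vanishes for almost every point. Tonelli turns this into one
    statement for the product measure, provided the exceptional set is measurable; the set where the
    gap is nonzero is. *)
Lemma total_gap_eq0_control :
  \int[leb]_(s in `[0, T]) \int[lebT d]_x (gap s x * rho s x) = 0 ->
  {ae (leb \x lebT d)%E, forall z, 0 <= z.1 <= T -> b z.1 z.2 = al z.1 z.2}.
Proof.
move=> /total_gap_eq0 g0.
pose A : set (mR * V) := (`[0, T] `*` [set: V]) `&` (fun z : mR * V => gap z.1 z.2) @^-1` [set~ 0].
have mA : measurable A.
  by apply: gap_bm.1; [exact: measurable_slab|exact: measurableC].
exists A; split => //.
- rewrite /product_measure1/=.
  have mS := measurable_fun_xsection (lebT d) mA.
  transitivity (\int[leb]_(s in setT) (cst 0%E s))%E; last exact: integral0.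
  apply: ae_eq_integral => //.
  have FF := @ae_filter_ringOfSetsType _ mR R leb.
  move: g0; apply: (@filterS _ _ FF) => s h _ /=; have [sT|sT] := boolP (0 <= s <= T); last first.
    rewrite (_ : xsection A s = set0) ?measure0// -subset0 => x.
    by rewrite /xsection/= inE => -[[/= + _] _]; rewrite in_itv/= (negbTE sT).
  have [M [mM M0 AM]] := h sT.
  apply/eqP; rewrite eq_le measure_ge0 andbT -M0 le_measure ?inE//.
    exact: measurable_xsection.
  move=> x; rewrite /xsection/= inE => -[_ /= gx]; apply: AM.
  exact: gx.
- move=> z /= hz; apply: contrapT => Az; apply: hz => zT; apply: gap_eq0.
  apply: contrapT => gz; apply: Az; split => //; split => //=.
Qed.

End competitor.

Lemma feedback_admissible : admissible T N m al.
Proof.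
have [mb [K hK]] := al_field; split.
- exact: mb.
- by move=> t tT; exact: (feedback_periodic H_torus bw tT).
- by exists K.
exists mu; split; [exact: Wmu| |exact: Dmu].
by move=> mu' Wmu' t tT; exact: (weak_solution_unique T0 al_field Wmu Wmu' tT).
Qed.

(** [admissible] provides the density property for some solution, and uniqueness carries it over to
    the truncation of the chosen one. *)
Lemma controlled_weak b : admissible T N m b ->
  weak_solution T N m b (controlled T N m b) /\
  forall t, 0 <= t <= T -> is_density (trunc N (controlled T N m b t)).
Proof.
move=> [_ _ _ [nu [Wn un Dn]]].
have Wc : weak_solution T N m b (controlled T N m b).
  by apply: (@xgetPex _ (fun _ => m) [set nu | weak_solution T N m b nu]); exists nu.
split; first exact: Wc.
move=> t tT; have [[n2 _] _ _] := Wn; have [[c2 _] _ _] := Wc.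
by rewrite (ae_eq_trunc N (c2 t tT) (n2 t tT) (un _ Wc t tT)); exact: Dn.
Qed.

Lemma cost_feedback : cost T N F G L m al = path_cost al mu.
Proof.
have [Wc _] := controlled_weak feedback_admissible.
have E t : 0 <= t <= T -> trunc N (controlled T N m al t) = trunc N (mu t).
  move=> tT; have [[m2 _] _ _] := Wmu; have [[c2 _] _ _] := Wc.
  by apply: ae_eq_trunc; [exact: c2|exact: m2|exact: (weak_solution_unique T0 al_field Wmu Wc tT)].
have -> : cost T N F G L m al = path_cost al (controlled T N m al) by [].
exact: eq_path_cost.
Qed.

Lemma admissible_field b : admissible T N m b -> slab_field T b.
Proof. by move=> [mb _ [K hK] _]; split => //; exists K. Qed.

Lemma feedback_unique_minimizer : unique_minimizer T N F G L m al.
Proof.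
split; first exact: feedback_admissible.
- move=> b ab; have [W D] := controlled_weak ab; have hb := admissible_field ab.
  rewrite cost_feedback -subr_ge0.
  exact: le_trans (total_gap_ge0 hb W D) (path_cost_gap hb W D).
- move=> b ab; have [W D] := controlled_weak ab; have hb := admissible_field ab.
  rewrite cost_feedback => E; apply: (total_gap_eq0_control hb W D).
  apply/eqP; rewrite eq_le (total_gap_ge0 hb W D) andbT.
  apply: le_trans (path_cost_gap hb W D) _.
  by rewrite [path_cost b _]E subrr.
Qed.

End verification.

Theorem proposition3p25 (R : realType) (d : nat) (hd : (0 < d)%N)
    (T : R) (hT : 0 < T) (q : nat) (hq : (d + 3 <= q)%N)
    (F G : PT R d -> R) (dF dG : PT R d -> 'rV[R]_d -> R)
    (L H : 'rV[R]_d -> 'rV[R]_d -> R)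
    (F_C1 : C1_with_deriv F dF) (G_C1 : C1_with_deriv G dG)
    (dF_Cq : derivative_Cq q dF) (dG_Cq : derivative_Cq q dG)
    (dF_lip : derivative_L2_lipschitz dF) (dG_lip : derivative_L2_lipschitz dG)
    (F_convex : convexPT F) (G_convex : convexPT G)
    (L_torus : forall a, Zperiodic (fun x => L x a))
    (H_torus : forall p, Zperiodic (fun x => H x p))
    (LH : fenchel_pair L H)
    (H_smooth : smooth_unif_convex q H)
    (gamma M : R) (hgamma : 0 < gamma < 1) :
  exists Ntilde : nat,
    ((exists N0 : nat, well_posed_from T q H dF dG gamma M N0) ->
       well_posed_from T q H dF dG gamma M Ntilde) /\
    forall (N : nat) (m : 'rV[R]_d -> R),
      (0 < N)%N -> (Ntilde <= N)%N -> initial_class q gamma M m ->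
      forall mu u : R -> 'rV[R]_d -> R,
        fb_solution T N H dF dG m mu u ->
        unique_minimizer T N F G L m (feedback H u).
Proof.
have [HC [CH [CH1 Hc]]] := H_smooth.
have H2 : Cn 2 (fun z : 'rV[R]_d * 'rV[R]_d => H z.1 z.2).
  by apply: Cn_le HC; apply: leq_trans hq; rewrite (leq_trans (_ : 2 <= 3)%N)// leq_addl.
have CH0 : 0 < CH by exact: lt_trans CH1.
have Hconv x p xi : CH^-1 * dot xi xi <= dot (xi *m hess (H x) p) xi.
  by have /andP[] := Hc x p xi.
have key N m mu u : fb_solution T N H dF dG m mu u ->
    unique_minimizer T N F G L m (feedback H u).
  exact: (feedback_unique_minimizer hT F_C1 G_C1 dF_Cq dG_Cq dF_lip dG_lip
    F_convex G_convex H_torus LH H2 CH0 Hconv).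
(* Optimality holds for every [N], so [Ntilde] only has to serve well-posedness. *)
have [[N0 wp]|nwp] := pselect (exists N0, well_posed_from T q H dF dG gamma M N0).
  by exists N0; split; [move=> _; exact: wp|move=> N m _ _ _ mu u; exact: key].
by exists 0%N; split; [move=> /nwp|move=> N m _ _ _ mu u; exact: key].
Qed.
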